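(* For every $n$ there is $\epsilon>0$ such that for any fixed $\varphi\in(-\epsilon,\epsilon)$ the following holds for the star configuration $G_n(\varphi)$ (described in the context). If the finite sequence of suspension angles $\varphi_0(\varphi),\varphi_1(\varphi),\dots,\varphi_n(\varphi)$ never repeats itself (its terms are pairwise distinct), then all edges of the resulting geodesic net $G_n(\varphi)$ intersect transversally, if at all, in the sense that no two distinct edges overlap in a segment of positive length. In other words, there are no edges with weight other than one.
   Context: **Star construction with deviation $\varphi$.** Work in the Euclidean plane with origin $O$; $\rho$ is the counterclockwise (ccw) rotation about $O$ by $2\pi/7$. Fix $\alpha_0=88/21$ (radians, about $240.1^\circ$) and $R=\frac{\sin(\alpha_0/2)}{\sin(\pi/7+\alpha_0/2)}$. For each integer $i$ define a fixed reference point $H_i$ at polar angle $i\pi/7$: for $i$ odd $H_i$ is at distance $R$ from $O$ (these seven points are the outer vertices); for $i$ even $H_i$ is at distance $R\,\frac{\sin(\pi/7+\pi/6)}{\sin(\pi/6)}$ from $O$ (so $H_i$ is the apex of the equilateral triangle with base $H_{i-1}H_{i+1}$ lying outside the outer circle). Put $v_{-1}=H_{-1}$. For small real $\varphi$, $v_0=v_0(\varphi)$ is the point on the ray from $H_0$ obtained by rotating the ray $H_0O$ ccw about $H_0$ by $\varphi$, lying on the same side of line $H_{-1}H_1$ as $O$, with $\angle H_{-1}v_0H_1=2\pi-\alpha_0$ (equivalently, reflex angle $\alpha_0$ on the side of $O$). Layers are $V_i=\{\rho^k v_i:0\le k\le 6\}$, with $V_{-1}$ the outer vertices; $V_0$ is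 the inner circle (it has radius $1$ when $\varphi=0$). Inductive step ($i\ge 0$): $v_i$ has two incoming edges, to $v_{i-1}$ and to $\rho v_{i-1}$. Let $\alpha_i$ be the interior angle at $v_i$ of the 14-gon with vertices alternating between $V_{i-1}$ and $V_i$ (the angle swept ccw from the direction $v_i\to\rho v_{i-1}$ to the direction $v_i\to v_{i-1}$). It is required that $\alpha_i\ne\pi$. Case A, $\alpha_i>\pi$: no suspension; the two wings at $v_i$ are the extensions of the two incoming edges beyond $v_i$: $w_i^+$ is the unit vector opposite to $v_i\to v_{i-1}$, and $w_i^-$ the unit vector opposite to $v_i\to\rho v_{i-1}$. Case B, $\alpha_i<\pi$: first suspend $v_i$: if $i$ is odd, add the edge $v_iH_i$; if $i$ is even, add the Fermat point $F$ of the triangle $H_{i-1}v_iH_{i+1}$ (the point in the triangle at which the three sides are seen under angles $120^\circ$; it lies on the segment $v_iH_i$) and the edges $FH_{i-1},FH_{i+1},Fv_i$. In both cases the new edge at $v_i$ has the direction of the unit vector $s_i$ pointing from $v_i$ to $H_i$. Then the wings $w_i^\pm$ are the two unit vectors such that $s_i$, the two unit vectors along the incoming edges, $w_i^+$ and $w_i^-$ sum to $0$ (this requires that the imbalance, i.e. the sum of the first three vectors, be nonzero of norm $<2$); $w_i^+$ is the one on the ccw side of $s_i$ and $w_i^-$ the one on the clockwise side. Finally $v_{i+1}$ is the intersection of the ray from $v_i$ in direction $w_i^+$ with the ray from $\rho v_i$ in direction $\rho w_i^-$; the segments $v_iv_{i+1}$ and $(\rho v_i)v_{i+1}$ are the wings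 and become the incoming edges of $v_{i+1}$. Everything is repeated under the rotations $\rho^k$. For every $n$ this can be carried out up to layer $V_n$ for all sufficiently small $|\varphi|$. **The net $G_n(\varphi)$.** Its edges are: the layer-connecting edges, i.e. the $14$ segments $\rho^k(v_{i-1}v_i)$, $\rho^k((\rho v_{i-1})v_i)$ for each $0\le i\le n$; and the suspension edges, i.e. for each $0\le i\le n-1$ with $\alpha_i<\pi$, all images under $\rho^k$ of $v_iH_i$ ($i$ odd) or of $FH_{i-1},FH_{i+1},Fv_i$ with $F$ the Fermat point of $H_{i-1}v_iH_{i+1}$ ($i$ even). The edges are counted as a family (each added edge separately, even if two of them occupy the same set); an edge weight greater than one arises where several of them overlap. The unbalanced vertices are the seven outer vertices and the seven vertices of $V_n$. **Suspension angle.** $\varphi_i=\varphi_i(\varphi)$ is the signed angle (ccw positive) at $H_i$ from the ray $H_iO$ to the ray $H_iv_i$; so $\varphi_0(\varphi)=\varphi$ and $\varphi_i(0)=0$ for all $i$. *)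

(* Defs.v *)
(* Stdlib reals with Coquelicot; the Euclidean plane is C, the origin O is 0. *)
From Stdlib Require Import Reals ZArith.
From Coquelicot Require Import Coquelicot.
Open Scope R_scope.

(** * Plane geometry *)

Definition cis (t : R) : C := (cos t, sin t).

(* Principal argument, in (-PI, PI].  The value PI/2 at z = 0 is junk. *)
Definition Arg (z : C) : R :=
  if Rle_dec 0 (Im z) then acos (Re z / Cmod z) else - acos (Re z / Cmod z).

(* Signed angle in (-PI, PI], ccw positive, from the vector u to the vector w. *)
Definition signed_angle (u w : C) : R := Arg (w / u)%C.

(* The angle in [0, 2 PI) swept ccw from the vector u to the vector w. *)
Definition swept_angle (u w : C) : R :=
  if Rlt_dec (signed_angle u w) 0 then signed_angle u w + 2 * PI
  else signed_angle u w.

(* The unsigned angle a p b, with apex p, in [0, PI]. *)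
Definition angle (a p b : C) : R := Rabs (signed_angle (a - p)%C (b - p)%C).

Definition cross (u w : C) : R := Re u * Im w - Im u * Re w.

Definition dir (p q : C) : C := ((q - p) / RtoC (Cmod (q - p)))%C.

Definition ray (p d z : C) : Prop :=
  exists t : R, 0 <= t /\ z = (p + RtoC t * d)%C.

Definition seg (p q z : C) : Prop :=
  exists t : R, 0 <= t <= 1 /\ z = (p + RtoC t * (q - p))%C.

Definition in_triangle (a b c z : C) : Prop :=
  exists x y t : R, 0 <= x /\ 0 <= y /\ 0 <= t /\ x + y + t = 1 /\
    z = (RtoC x * a + RtoC y * b + RtoC t * c)%C.

Definition same_side (a b p q : C) : Prop :=
  0 < cross (b - a)%C (p - a)%C * cross (b - a)%C (q - a)%C.

(* No vertex of the triangle qualifies: an angle at p with a = p is PI/2. *)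
Definition is_fermat_point (a b c p : C) : Prop :=
  in_triangle a b c p /\ angle a p b = 2 * PI / 3 /\
  angle b p c = 2 * PI / 3 /\ angle c p a = 2 * PI / 3.

(** * Reference points *)

Definition rho : C := cis (2 * PI / 7).

Definition alpha0 : R := 88 / 21.

Definition Rout : R := sin (alpha0 / 2) / sin (PI / 7 + alpha0 / 2).

Definition H (i : Z) : C :=
  ((if Z.odd i then RtoC Rout
    else RtoC (Rout * (sin (PI / 7 + PI / 6) / sin (PI / 6))))
   * cis (IZR i * PI / 7))%C.

(** * The star construction *)

(* [vtx i] is v_i for i >= 0 (v_{-1} is fixed, see [vprev]); [wing_ccw i] and
   [wing_cw i] are w_i^+ and w_i^-; [fermat i] is the Fermat point used when
   v_i is suspended with i even, and is irrelevant otherwise. *)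
Record star : Type := Star {
  vtx : nat -> C;
  wing_ccw : nat -> C;
  wing_cw : nat -> C;
  fermat : nat -> C
}.

(* v_{i-1} *)
Definition vprev (G : star) (i : nat) : C :=
  match i with O => H (-1) | S j => vtx G j end.

Definition refpt (i : nat) : C := H (Z.of_nat i).

Definition interior_angle (G : star) (i : nat) : R :=
  swept_angle (rho * vprev G i - vtx G i)%C (vprev G i - vtx G i)%C.

Definition suspension_angle (G : star) (i : nat) : R :=
  signed_angle (0 - refpt i)%C (vtx G i - refpt i)%C.

Definition is_v0 (phi : R) (v : C) : Prop :=
  ray (H 0) (cis phi * (0 - H 0))%C v /\
  same_side (H (-1)) (H 1) v 0 /\
  angle (H (-1)) v (H 1) = 2 * PI - alpha0.

Definition extended_wings (G : star) (i : nat) : Prop :=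
  wing_ccw G i = (- dir (vtx G i) (vprev G i))%C /\
  wing_cw G i = (- dir (vtx G i) (rho * vprev G i))%C.

Definition imbalance (G : star) (i : nat) : C :=
  (dir (vtx G i) (refpt i) + dir (vtx G i) (vprev G i)
   + dir (vtx G i) (rho * vprev G i))%C.

Definition balancing_wings (G : star) (i : nat) : Prop :=
  0 < Cmod (imbalance G i) < 2 /\
  Cmod (wing_ccw G i) = 1 /\ Cmod (wing_cw G i) = 1 /\
  (imbalance G i + wing_ccw G i + wing_cw G i)%C = 0 /\
  0 < cross (dir (vtx G i) (refpt i)) (wing_ccw G i) /\
  cross (dir (vtx G i) (refpt i)) (wing_cw G i) < 0.

Definition star_step (G : star) (i : nat) : Prop :=
  ((PI < interior_angle G i /\ extended_wings G i) \/
   (interior_angle G i < PI /\ balancing_wings G i /\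
    (Nat.Even i ->
     is_fermat_point (H (Z.of_nat i - 1)) (vtx G i) (H (Z.of_nat i + 1))
       (fermat G i)))) /\
  (forall z : C,
     ray (vtx G i) (wing_ccw G i) z /\
     ray (rho * vtx G i)%C (rho * wing_cw G i)%C z <-> z = vtx G (S i)).

Definition is_star (n : nat) (phi : R) (G : star) : Prop :=
  is_v0 phi (vtx G 0) /\ forall i : nat, (i < n)%nat -> star_step G i.

(** * The net *)

(* Labels for the edges of the family: i is the layer, k the rotation index.
   The last three label the edges at the Fermat point of layer i. *)
Inductive edge : Type :=
| LayerEdge (i k : nat)
| LayerEdgeRho (i k : nat)
| OddSuspension (i k : nat)
| FermatPrev (i k : nat)
| FermatNext (i k : nat)
| FermatVtx (i k : nat).

Definition suspended (n : nat) (G : star) (i : nat) : Prop :=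
  (i < n)%nat /\ interior_angle G i < PI.

Definition in_net (n : nat) (G : star) (e : edge) : Prop :=
  match e with
  | LayerEdge i k | LayerEdgeRho i k => (i <= n)%nat /\ (k < 7)%nat
  | OddSuspension i k => suspended n G i /\ Nat.Odd i /\ (k < 7)%nat
  | FermatPrev i k | FermatNext i k | FermatVtx i k =>
      suspended n G i /\ Nat.Even i /\ (k < 7)%nat
  end.

Definition on_edge (G : star) (e : edge) : C -> Prop :=
  let rseg (k : nat) (p q : C) := seg (rho ^ k * p)%C (rho ^ k * q)%C in
  match e with
  | LayerEdge i k => rseg k (vprev G i) (vtx G i)
  | LayerEdgeRho i k => rseg k (rho * vprev G i)%C (vtx G i)
  | OddSuspension i k => rseg k (vtx G i) (refpt i)
  | FermatPrev i k => rseg k (fermat G i) (H (Z.of_nat i - 1))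
  | FermatNext i k => rseg k (fermat G i) (H (Z.of_nat i + 1))
  | FermatVtx i k => rseg k (fermat G i) (vtx G i)
  end.

Definition overlap (A B : C -> Prop) : Prop :=
  exists p q : C, p <> q /\ forall z : C, seg p q z -> A z /\ B z.

(* Main.v *)
(* At phi = 0 the configuration is symmetric: v_i lies on the ray at angle i PI/7, and the
   angle a_i between its incoming edges and its radius obeys a piecewise analytic recursion
   started at a_0 = 44/21.  By Hermite's argument cos (44/21) is transcendental, while for c
   a multiple of PI/42 the sines of a_i + c, a_i + a_j + c and a_j - a_i + c are algebraic
   functions of cos a_0; if one of them vanishes, it vanishes for all starting angles near
   44/21.  This is impossible, since a_i is an increasing function of the starting angle and,
   as soon as a suspension occurs between the layers i and j, a_j is a strictly convex
   function of a_i.  Hence two edges are parallel at phi = 0 only for a structural reason: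
   they are successive extensions of one edge (collinear for every phi, meeting in at most a
   vertex), suspension edges on opposite sides of the origin, or suspension edges at the same
   reference point, whose directions differ by a difference of suspension angles.  All other
   pairs stay transversal for small phi, because the construction depends continuously on phi
   there; the bound on the radii which this requires comes from the existence of the Fermat
   points. *)

(* The number of layers is arbitrary, so no numerical estimate can exclude an accidental parallel
   pair. An exact argument is possible because half of [alpha0] is a nonzero rational: a coincidence
   becomes an algebraic relation for its cosine, hence an identity in the starting angle, which can
   be refuted by differentiation. For sums of angles the first derivative suffices. A difference
   could be stationary, and after extensions alone it is in fact constant, so there second-order
   information is used. The same transcendence keeps every [ang i] away from PI / 2, so that for
   small phi the choice between extension and suspension does not depend on phi. The constant 88/21
   plays a second role: it exceeds 4 PI / 3 exactly because PI < 22/7, which puts the inner circle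
   where Fermat points exist. Radii matter because a vertex beyond its reference point would be
   suspended in the opposite direction. The denominator 42 combines the rotations by PI / 7 with the
   angles PI / 3 at Fermat points. *)
Require Import Defs.
From Stdlib Require Import Reals ZArith.
From Coquelicot Require Import Coquelicot.
From Stdlib Require Import Lra Lia Psatz Classical.
From HB Require structures.
From mathcomp Require all_boot all_order all_algebra.
From mathcomp Require boolp classical_sets functions Rstruct ring complex.
Open Scope R_scope.

(* If A - iB is the sum of the (- i / b)^j g^(j), then (A - iB) e^(- i b u) has derivative
   - i b g e^(- i b u); U - iV below is this product. *)
Lemma hermite_error (A B g : R -> R) (b x M : R) :
  0 <= b -> 0 <= x ->
  (forall u, is_derive A u (b * B u)) ->
  (forall u, is_derive B u (b * (g u - A u))) ->
  (forall u, 0 <= u <= x -> Rabs (g u) <= M) ->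
  Rabs (A x - (cos (b * x) * A 0 + sin (b * x) * B 0)) <= 2 * (b * x * M).
Proof.
  intros Hb Hx HA HB HM.
  assert (bounded_increment : forall (F f : R -> R),
    (forall u, is_derive F u (b * g u * f u)) -> (forall u, Rabs (f u) <= 1) ->
    Rabs (F x - F 0) <= b * x * M).
  { intros F f HF Hf.
    destruct (MVT_gen F 0 x (fun u => b * g u * f u)) as [c [Hc E]].
    - intros; apply HF.
    - intros u _. apply continuity_pt_filterlim, @ex_derive_continuous.
      eexists; apply HF.
    - rewrite Rmin_left, Rmax_right in Hc by lra.
      rewrite E, !Rabs_mult, (Rabs_pos_eq b), (Rabs_pos_eq (x - 0)) by lra.
      assert (H1 := HM c Hc). assert (H2 := Hf c).
      assert (H3 := Rabs_pos (g c)). assert (H4 := Rabs_pos (f c)).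
      assert (Rabs (g c) * Rabs (f c) <= M) by nra.
      replace (b * Rabs (g c) * Rabs (f c) * (x - 0))
        with (b * x * (Rabs (g c) * Rabs (f c))) by ring.
      apply Rmult_le_compat_l; [nra | assumption]. }
  set (U := fun u => A u * cos (b * u) - B u * sin (b * u)).
  set (V := fun u => A u * sin (b * u) + B u * cos (b * u)).
  assert (HU : Rabs (U x - U 0) <= b * x * M).
  { apply (bounded_increment U (fun u => - sin (b * u))).
    - intros u. unfold U. auto_derive.
      + repeat split; [eexists; apply HA | eexists; apply HB].
      + change (Derive (fun u => A u) u) with (Derive A u).
        change (Derive (fun u => B u) u) with (Derive B u).
        rewrite (is_derive_unique _ _ _ (HA u)), (is_derive_unique _ _ _ (HB u)). ring.
    - intros u. rewrite Rabs_Ropp. apply Rabs_le, SIN_bound. }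
  assert (HV : Rabs (V x - V 0) <= b * x * M).
  { apply (bounded_increment V (fun u => cos (b * u))).
    - intros u. unfold V. auto_derive.
      + repeat split; [eexists; apply HA | eexists; apply HB].
      + change (Derive (fun u => A u) u) with (Derive A u).
        change (Derive (fun u => B u) u) with (Derive B u).
        rewrite (is_derive_unique _ _ _ (HA u)), (is_derive_unique _ _ _ (HB u)). ring.
    - intros u. apply Rabs_le, COS_bound. }
  assert (U0 : U 0 = A 0) by (unfold U; rewrite Rmult_0_r, cos_0, sin_0; ring).
  assert (V0 : V 0 = B 0) by (unfold V; rewrite Rmult_0_r, cos_0, sin_0; ring).
  replace (A x - (cos (b * x) * A 0 + sin (b * x) * B 0))
    with (cos (b * x) * (U x - U 0) + sin (b * x) * (V x - V 0)).
  2:{ rewrite U0, V0. unfold U, V.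
      pose proof (sin2_cos2 (b * x)) as E. unfold Rsqr in E.
      transitivity (A x * (sin (b*x) * sin (b*x) + cos (b*x) * cos (b*x))
        - (cos (b * x) * A 0 + sin (b * x) * B 0)); [ring | rewrite E; ring]. }
  eapply Rle_trans; [apply Rabs_triang|]. rewrite !Rabs_mult.
  assert (Hc : Rabs (cos (b * x)) <= 1) by apply Rabs_le, COS_bound.
  assert (Hs : Rabs (sin (b * x)) <= 1) by apply Rabs_le, SIN_bound.
  pose proof (Rabs_pos (U x - U 0)). pose proof (Rabs_pos (V x - V 0)).
  nra.
Qed.

Lemma fact_gt_exp (K L : R) :
  exists m0 : nat, forall m : nat, (m0 <= m)%nat -> K * L ^ m < INR (fact m).
Proof.
  assert (K1 : 0 < Rabs K + 1) by (pose proof (Rabs_pos K); lra).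
  destruct (cv_speed_pow_fact L (/ (Rabs K + 1))) as [m0 H0].
  { apply Rinv_0_lt_compat, K1. }
  exists m0; intros m Hm. specialize (H0 m Hm). unfold Rdist in H0.
  rewrite Rminus_0_r in H0.
  pose proof (INR_fact_lt_0 m) as Hf.
  rewrite Rabs_div, (Rabs_pos_eq (INR _)) in H0 by lra.
  apply (Rmult_lt_compat_r (INR (fact m))) in H0; [|lra].
  apply (Rmult_lt_compat_l (Rabs K + 1)) in H0; [|lra].
  replace ((Rabs K + 1) * (Rabs (L ^ m) / INR (fact m) * INR (fact m)))
    with ((Rabs K + 1) * Rabs (L ^ m)) in H0 by (field; lra).
  replace ((Rabs K + 1) * (/ (Rabs K + 1) * INR (fact m)))
    with (INR (fact m)) in H0 by (field; lra).
  apply Rle_lt_trans with (Rabs (K * L ^ m)); [apply Rle_abs|].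
  rewrite Rabs_mult. pose proof (Rabs_pos (L ^ m)). nra.
Qed.

(** * Transcendence of cos (44/21) *)

Module AlgebraicFunctions.
Import HB.structures all_boot all_order all_algebra.
Import boolp classical_sets functions Rstruct ring complex.
Import Order.TTheory GRing.Theory Num.Theory.
Set Implicit Arguments.
Unset Strict Implicit.
Local Open Scope ring_scope.

Section DerivativeSums.
Variable K : comNzRingType.
Implicit Types (e f : nat -> K) (mu b : K) (d j : nat) (g h : {poly K}).

Definition dsum e mu d g : {poly K} :=
  \sum_(j < d.+1) (e j * mu ^+ j) *: g^`(j).

(** Differentiation shifts the summation index. With the weights [eps] and [eta] this yields the
    system A' = b B, B' = b (g - A) assumed in [hermite_error]. *)
Lemma deriv_dsum e f mu b d g :
  b * mu = 1 -> (forall j, f j.+1 = e j) -> g^`(d.+1) = 0 ->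
  (dsum e mu d g)^`() = b *: (dsum f mu d g - f 0%N *: g).
Proof.
move=> bmu fe gd; rewrite /dsum big_ord_recr big_ord_recl /= derivD derivZ.
rewrite -derivnS gd scaler0 addr0 expr0 mulr1 addrAC subrr add0r.
rewrite raddf_sum scaler_sumr; apply: eq_bigr => j _.
by rewrite /= derivZ -derivnS /bump /= add1n fe scalerA exprS (mulrCA (e j)) (mulrA b) bmu mul1r.
Qed.

Lemma derivn_root j m a h : (j < m)%N -> ((('X - a%:P) ^+ m * h)^`(j)).[a] = 0.
Proof.
elim: j m h => [|j IH] [|m] h // ltjm.
  by rewrite derivn0 hornerM exprS hornerM !hornerE subrr !mul0r.
rewrite derivSn.
have -> : (('X - a%:P) ^+ m.+1 * h)^`() =
    ('X - a%:P) ^+ m * (h *+ m.+1 + ('X - a%:P) * h^`()).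
  rewrite derivM deriv_exp derivXsubC mul1r /= mulrDr mulrnAl mulrnAr.
  by rewrite mulrA -exprSr.
exact: IH.
Qed.

End DerivativeSums.

Lemma fact_dvdn m n : (m <= n -> m`! %| n`!)%N.
Proof.
move=> lemn; rewrite -(subnK lemn); elim: (n - m)%N => [|k IH]; first by rewrite add0n.
by rewrite addSn factS dvdn_mull.
Qed.

(** Below order m the root kills the derivative; from order m on, the j-th derivative is j! times an
    integer polynomial. *)
Lemma dvdz_derivn_root m j (a : int) (h : {poly int}) :
  (m`!%:Z %| ((('X - a%:P) ^+ m * h)^`(j)).[a])%Z.
Proof.
have [ltjm|lemj] := ltnP j m; first by rewrite derivn_root.
rewrite nderivn_def hornerMn -mulr_natr; apply: dvdz_mull.
by rewrite natz dvdzE !absz_nat fact_dvdn.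
Qed.

Lemma derivn_mulXn m (h : {poly int}) : (('X^m * h)^`(m)).[0] = h.[0] * m`!%:Z.
Proof.
rewrite nderivn_def hornerMn horner_coef0 coef_nderivn addn0 binn mulr1n.
by rewrite coefXnM ltnn subnn -horner_coef0 -mulr_natr natz.
Qed.

(* [eps j - i * eta j] is [(- i) ^ j]. *)
Definition eps (j : nat) : int := if odd j then 0 else (-1) ^+ j./2.
Definition eta (j : nat) : int := if odd j then (-1) ^+ j./2 else 0.

Lemma etaS j : eta j.+1 = eps j.
Proof.
by rewrite /eta /eps oddS /= uphalf_half; case: (odd j).
Qed.

Lemma epsS j : eps j.+1 = - eta j.
Proof.
rewrite /eta /eps oddS /= uphalf_half; case: (odd j); rewrite ?oppr0 //=.
by rewrite exprS mulN1r.
Qed.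

Definition shifts N : {poly int} := \prod_(k < N) ('X - (k.+1)%:Z%:P).
(** Hermite's auxiliary polynomial for the prime p = m + 1. The root 0 has order one less than the
    roots 1, ..., N, so that only the value at 0 escapes divisibility by p!. *)
Definition aux N m : {poly int} := 'X^m * shifts N ^+ m.+1.
Definition auxdeg N m := (m + N * m.+1)%N.

Lemma size_aux N m : size (aux N m) = (auxdeg N m).+1.
Proof.
have hm : shifts N \is monic by apply: monic_prod_XsubC.
have sz : size (shifts N) = N.+1.
  by rewrite /shifts -(big_mkord xpredT (fun k => 'X - (k.+1)%:Z%:P)) size_prod_XsubC size_iota subn0.
have nz : shifts N ^+ m.+1 != 0 by rewrite expf_neq0 ?monic_neq0.
rewrite /aux size_monicM ?monicXn // size_polyXn.
by rewrite -[size (shifts N ^+ m.+1)]prednK ?size_poly_gt0 // size_exp sz addSn addnS.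
Qed.

(** The function A of [hermite_error] at a, for b = 44/21, multiplied by 44^d to become an integer.
    Only this real part is ever evaluated at integers k > 0, so the argument stays in the ordinary
    integers. *)
Definition wsum d (g : {poly int}) (a : int) : int :=
  \sum_(j < d.+1) eps j * 21 ^+ j * 44 ^+ (d - j) * (g^`(j)).[a].

Lemma wsum_intr d g a :
  (wsum d g a)%:~R = 44%:R ^+ d *
    (dsum (fun j => (eps j)%:~R) (21%:R / 44%:R) d (map_poly intr g)).[a%:~R] :> R.
Proof.
rewrite /wsum /dsum horner_sum rmorph_sum mulr_sumr; apply: eq_bigr => j _.
rewrite hornerZ !rmorphM !rmorphXn /= derivn_map horner_map /= expr_div_n.
have n0 : 44%:R != 0 :> R by rewrite pnatr_eq0.
have -> : 44%:R ^+ d = 44%:R ^+ (d - j) * 44%:R ^+ j :> R.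
  by rewrite -exprD subnK // -ltnS.
rewrite -!pmulrn.
have n1 : 44%:R ^+ j != 0 :> R by rewrite expf_neq0.
by field.
Qed.

Lemma dvdz_wsum_root N m d (k : 'I_N) :
  ((m.+1)`!%:Z %| wsum d (aux N m) (k.+1)%:Z)%Z.
Proof.
apply: rpred_sum => j _; apply: dvdz_mull.
rewrite /aux /shifts (bigD1 k) //= exprMn mulrCA.
exact: dvdz_derivn_root.
Qed.

(** Modulo (m + 1)! only the term j = m survives: lower derivatives vanish at 0, higher ones carry
    the factor j!. *)
Lemma wsum_zero N m :
  exists z : int, wsum (auxdeg N m) (aux N m) 0 =
    m`!%:Z * (eps m * 21 ^+ m * 44 ^+ (N * m.+1) * (shifts N).[0] ^+ m.+1)
    + (m.+1)`!%:Z * z.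
Proof.
have ltm : (m < (auxdeg N m).+1)%N by rewrite ltnS leq_addr.
rewrite /wsum (bigD1 (Ordinal ltm)) //= /aux derivn_mulXn horner_exp.
have /dvdzP[z ->] : ((m.+1)`!%:Z %| \sum_(j < (auxdeg N m).+1 | j != Ordinal ltm)
   eps j * 21 ^+ j * 44 ^+ (auxdeg N m - j) * ((aux N m)^`(j)).[0])%Z.
  apply: rpred_sum => j; rewrite -val_eqE /= neq_ltn => jm; apply: dvdz_mull.
  have X0 : 'X = 'X - 0%:P :> {poly int} by rewrite subr0.
  case/orP: jm => [ltj|ltj].
    by rewrite /aux X0 derivn_root.
  rewrite nderivn_def hornerMn -mulr_natr; apply: dvdz_mull.
  by rewrite natz dvdzE !absz_nat fact_dvdn.
exists z; rewrite /auxdeg addKn; ring.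
Qed.

Lemma dvdz_shifts0 N p : prime p -> (N < p)%N -> ~~ (p%:Z %| (shifts N).[0])%Z.
Proof.
move=> pp; elim: N => [|N IH] ltNp.
  by rewrite /shifts big_ord0 hornerC dvdz1 /= gtn_eqF // prime_gt1.
rewrite /shifts big_ord_recr /= hornerM dvdzE abszM Euclid_dvdM // negb_or.
rewrite -!dvdzE IH ?(ltnW ltNp) //= hornerXsubC sub0r dvdzE abszN !absz_nat.
by rewrite gtnNdvd.
Qed.

Lemma aux_bound N m (u : R) : 0 <= u <= N%:R ->
  `|(map_poly intr (aux N m)).[u]| <= N.+1%:R ^+ auxdeg N m.
Proof.
case/andP=> u0 uN.
have leN : forall k, (k <= N)%N -> `|u - k%:R| <= N.+1%:R.
  move=> k kN; rewrite ler_norml; apply/andP; split.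
    rewrite lerBrDl (le_trans _ u0) // subr_le0 ler_nat; exact: leqW.
  rewrite lerBlDr (le_trans uN) // -natrD ler_nat; exact: leq_trans (leqnSn N) (leq_addr _ _).
rewrite /aux rmorphM !rmorphXn /= map_polyX hornerM normrM hornerXn.
rewrite /auxdeg exprD ler_pM // ?normr_ge0 //.
  rewrite normrX lerXn2r ?nnegrE ?normr_ge0 // -[u]subr0; exact: (leN 0%N).
rewrite horner_exp normrX exprM lerXn2r ?nnegrE ?normr_ge0 ?exprn_ge0 ?ler0n //.
rewrite /shifts rmorph_prod horner_prod normr_prod.
rewrite -[X in _ <= _ ^+ X]card_ord -prodr_const; apply: ler_prod => k _.
rewrite normr_ge0 rmorphB /= map_polyX map_polyC hornerXsubC /=.
by rewrite -pmulrn leN.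
Qed.

Lemma derive_horner (q : {poly R}) (u : R) : is_derive (fun x : R => q.[x]) u (q^`()).[u].
Proof.
elim/poly_ind: q => [|q c IH].
  rewrite deriv0 horner0; apply: (is_derive_ext (fun _ : R => R0)).
    by move=> t; rewrite horner0.
  exact: is_derive_const.
rewrite derivMXaddC hornerD hornerMX.
apply: (is_derive_ext (fun x : R => Rplus (Rmult q.[x] x) c)).
  by move=> t; rewrite hornerMXaddC.
auto_derive; first by exists (q^`()).[u]; exact: IH.
rewrite (_ : Derive _ u = (q^`()).[u]); last exact: is_derive_unique.
by rewrite !RealsE mul1r mulr1 addrC.
Qed.

Section HermiteSum.
Variables (N m : nat) (c : nat -> int).
Let d := auxdeg N m.
Let b : R := 44%:R / 21%:R.
Let G : {poly R} := map_poly intr (aux N m).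
Let A := dsum (fun j => (eps j)%:~R) (21%:R / 44%:R) d G.
Let B := dsum (fun j => (eta j)%:~R) (21%:R / 44%:R) d G.

Lemma wsum_error (k : nat) : (k <= N)%N ->
  `|A.[k%:R] - (cos (b * k%:R) * A.[0] + sin (b * k%:R) * B.[0])|
    <= 2%:R * (b * N%:R * N.+1%:R ^+ d).
Proof.
move=> kN.
have Gd : G^`(d.+1) = 0.
  by apply: derivn_poly0; rewrite (leq_trans (size_poly _ _)) // size_aux.
have bmu : b * (21%:R / 44%:R) = 1.
  by rewrite /b mulrA divfK ?divff ?pnatr_eq0.
have dA : A^`() = b *: B.
  rewrite /A (deriv_dsum bmu (f := fun j => (eta j)%:~R) _ Gd) => [|j].
    by rewrite /eta /= scale0r subr0.
  by rewrite etaS.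
have dB : B^`() = b *: (G - A).
  rewrite /B (deriv_dsum bmu (f := fun j => - (eps j)%:~R) _ Gd) => [|j].
    rewrite /eps /= expr0 scaleNr scale1r opprK addrC; congr (_ *: (_ + _)).
    rewrite /A /dsum -sumrN; apply: eq_bigr => j _.
    by rewrite mulNr scaleNr.
  by rewrite epsS rmorphN opprK.
have b0 : 0 <= b by rewrite divr_ge0 ?ler0n.
have k0 : 0 <= k%:R :> R by rewrite ler0n.
have hA u : is_derive (fun u : R => A.[u]) u (Rmult b B.[u]).
  by move: (derive_horner A u); rewrite dA hornerZ.
have hB u : is_derive (fun u : R => B.[u]) u (Rmult b (Rminus G.[u] A.[u])).
  by move: (derive_horner B u); rewrite dB hornerZ hornerD hornerN.
have hG u : Rle 0 u /\ Rle u k%:R -> Rle (Rabs G.[u]) (N.+1%:R ^+ d).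
  case=> /RleP u0 /RleP uk; apply/RleP; rewrite RabsE; apply: aux_bound.
  by rewrite u0 (le_trans uk) // ler_nat.
move/RleP: b0 => b0; move/RleP: k0 => k0.
have /RleP := @hermite_error (horner A) (horner B) (horner G) b k%:R (N.+1%:R ^+ d) b0 k0 hA hB hG.
rewrite !RealsE => h; apply: (le_trans h).
rewrite ler_pM2l ?ltr0n // ler_wpM2r ?exprn_ge0 ?ler0n // ler_wpM2l ?ler_nat //.
exact/RleP.
Qed.

Hypothesis hc : \sum_(k < N.+1) (c k)%:~R * cos (b * k%:R) = 0.
Hypothesis hs : \sum_(k < N.+1) (c k)%:~R * sin (b * k%:R) = 0.

(** The two vanishing sums cancel the main terms cos (b k) A(0) and sin (b k) B(0), so only the
    errors of [wsum_error] remain. *)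
Lemma wsum_comb_bound :
  `|(\sum_(k < N.+1) c k * wsum d (aux N m) k%:Z)%:~R : R|
   <= 44%:R ^+ d * \sum_(k < N.+1) `|(c k)%:~R| * (2%:R * (b * N%:R * N.+1%:R ^+ d)).
Proof.
have -> : (\sum_(k < N.+1) c k * wsum d (aux N m) k%:Z)%:~R =
   44%:R ^+ d * \sum_(k < N.+1) (c k)%:~R *
     (A.[k%:R] - (cos (b * k%:R) * A.[0] + sin (b * k%:R) * B.[0])) :> R.
  under [X in _ * X]eq_bigr => k _ do rewrite mulrBr mulrDr !mulrA.
  rewrite sumrB big_split /= -!mulr_suml hc hs !mul0r addr0 subr0.
  rewrite rmorph_sum mulr_sumr; apply: eq_bigr => k _.
  by rewrite rmorphM /= wsum_intr mulrCA -pmulrn.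
rewrite normrM normrX normr_nat ler_wpM2l ?exprn_ge0 ?ler0n //.
apply: le_trans (ler_norm_sum _ _ _) _; apply: ler_sum => k _.
by rewrite normrM ler_wpM2l // wsum_error // -ltnS.
Qed.

End HermiteSum.

(** The integer combination T of the sums [wsum] is a nonzero multiple of m!, while the analytic
    bound on it grows only exponentially in m. *)
Lemma trig_sums_neq0 N (c : nat -> int) : c 0%N != 0 ->
  \sum_(k < N.+1) (c k)%:~R * cos (44%:R / 21%:R * k%:R) = 0 ->
  \sum_(k < N.+1) (c k)%:~R * sin (44%:R / 21%:R * k%:R) = 0 -> False.
Proof.
move=> c0 hc hs.
pose b : R := 44%:R / 21%:R.
pose L : R := (44%:R * N.+1%:R) ^+ N.+1.
pose C : R := \sum_(k < N.+1) `|(c k)%:~R| * (2%:R * (b * N%:R)).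
have [m0 hm0] := fact_gt_exp (C * L) L.
(* With p = m + 1: above 44, p divides neither 21 nor 44, and m is even, so [eps m] is a unit; above
   N, p does not divide [(shifts N).[0]]; above |c 0| it does not divide [c 0]; above m0 the
   factorial has overtaken the exponential. *)
have [p] := prime_above (maxn m0.+1 (maxn 44 (maxn N `|c 0%N|%N))).
rewrite !gtn_max => /and4P[pm0 p44 pN pc] pp.
case: p pp pm0 p44 pN pc => // m pm pm0 p44 pN pc.
have em : ~~ odd m.
  by case: (even_prime pm) p44 => [-> //|/=].
pose T := \sum_(k < N.+1) c k * wsum (auxdeg N m) (aux N m) k%:Z.
pose X : int := eps m * 21 ^+ m * 44 ^+ (N * m.+1) * (shifts N).[0] ^+ m.+1.
have [z Tz] : exists z, T = m`!%:Z * (c 0%N * X + m.+1%:Z * z).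
  have [z0 hz0] := wsum_zero N m.
  have /dvdzP[z1 hz1] : ((m.+1)`!%:Z %|
      \sum_(k < N) c (bump 0 k) * wsum (auxdeg N m) (aux N m) (bump 0 k)%:Z)%Z.
    by apply: rpred_sum => k _; apply: dvdz_mull; apply: dvdz_wsum_root.
  exists (c 0%N * z0 + z1); rewrite /T big_ord_recl /= hz0 hz1 factS PoszM -/X; ring.
have nT : ~~ (m.+1%:Z %| c 0%N * X + m.+1%:Z * z)%Z.
  have -> : (m.+1%:Z %| c 0%N * X + m.+1%:Z * z)%Z = (m.+1%:Z %| c 0%N * X)%Z.
    by apply: rpredDr; apply: dvdz_mulr; apply: dvdzz.
  have d0 : ~~ (m.+1 %| `|c 0%N|)%N by rewrite gtnNdvd // absz_gt0.
  have d21 : ~~ (m.+1 %| `|21%Z|)%N by rewrite gtnNdvd // (leq_trans _ p44).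
  have d44 : ~~ (m.+1 %| `|44%Z|)%N by rewrite gtnNdvd.
  have de : ~~ (m.+1 %| `|eps m|)%N.
    by rewrite /eps (negbTE em) abszX exp1n gtnNdvd // prime_gt1.
  have dh := dvdz_shifts0 pm pN; rewrite dvdzE absz_nat in dh.
  rewrite dvdzE absz_nat /X !abszM !abszX !Euclid_dvdM // !Euclid_dvdX //.
  by rewrite !negb_or !negb_and d0 d21 d44 de dh.
have T0 : (m`! <= `|T|)%N.
  rewrite Tz abszM absz_nat leq_pmulr // absz_gt0; apply: contraNneq nT => ->.
  exact: dvdz0.
have := wsum_comb_bound m hc hs; rewrite -/T -/b; apply/negP; rewrite -ltNge.
apply: (@lt_le_trans _ _ m`!%:R); last first.
  by rewrite -intr_norm -abszE -pmulrn ler_nat.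
have le0m : (m0 <= m)%N by apply: ltnW.
have /RltP := hm0 m (elimT ssrnat.leP le0m); rewrite INRE factE RpowE.
apply: le_lt_trans; rewrite !RealsE.
have -> : \sum_(k < N.+1) `|(c k)%:~R| *
    (2%:R * (b * N%:R * N.+1%:R ^+ auxdeg N m)) = C * N.+1%:R ^+ auxdeg N m.
  by rewrite /C mulr_suml; apply: eq_bigr => k _; rewrite !mulrA.
rewrite mulrCA -exprMn -mulrA -exprS /L -exprM ler_wpM2l //.
  by apply: sumr_ge0 => k _; rewrite !mulr_ge0 ?normr_ge0 ?invr_ge0 ?ler0n.
rewrite ler_eXn2l; first by rewrite /auxdeg mulSn leq_add2r leqnSn.
by rewrite -natrM ltr1n mulnS ltn_addr.
Qed.

Lemma cis_natmul (t : R) k :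
  (Complex (cos t) (sin t)) ^+ k = Complex (cos (t * k%:R)%R) (sin (t * k%:R)%R).
Proof.
elim: k => [|k IH]; first by rewrite expr0 mulr0n mulr0; congr Complex; symmetry; [exact: cos_0 | exact: sin_0].
rewrite exprS IH -natr1 mulrDr mulr1 addrC cosD sinD; apply/eqP; rewrite eq_complex /= eqxx /=.
by apply/eqP; rewrite addrC.
Qed.

(** If c = cos t were algebraic, so would be z = cis t, a root of X^2 - 2 c X + 1. The real and
    imaginary parts of an integer relation between powers of z are the two sums excluded by
    [trig_sums_neq0]. *)
Lemma cos_transcendental (P : {poly rat}) : P != 0 ->
  (map_poly ratr P).[cos (44%:R / 21%:R)] <> 0 :> R.
Proof.
set t : R := 44%:R / 21%:R => P0 Pt.
pose z : complex R := Complex (cos t) (sin t).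
pose cz : complex R := Complex (cos t) 0.
have alg_c : algebraicOver ratr cz.
  exists P => //.
  rewrite (_ : map_poly ratr P = map_poly (real_complex R) (map_poly ratr P)); last first.
    by rewrite -map_poly_comp; apply: eq_map_poly => x; rewrite -[LHS](fmorph_eq_rat (real_complex R \o ratr)).
  by rewrite (_ : cz = real_complex R (cos t)) // fmorph_root /root Pt.
have root_z : root ('X^2 - (cz *+ 2) *: 'X + 1) z.
  rewrite /root !hornerE /z expr2; apply/eqP/eqP; rewrite eq_complex /=.
  have cs : sin t * sin t + cos t * cos t = 1 := sin2_cos2 t.
  rewrite -cs; apply/andP; split; apply/eqP; ring.
have mon : 'X^2 - (cz *+ 2) *: 'X + 1 \is monic.
  rewrite monicE /lead_coef [size _](_ : _ = 3).
    by rewrite !coefE /= mulr0 subr0 addr0.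
  rewrite -addrA size_polyDl size_polyXn //.
  rewrite (leq_ltn_trans (size_polyD _ _)) // gtn_max size_poly1 andbT size_polyN.
  by rewrite (leq_ltn_trans (size_scale_leq _ _)) // size_polyX.
have int_c := (integral_algebraic _ _).1 alg_c.
have int1 := integral1 (ratr : {rmorphism rat -> complex R}).
have int0 := integral0 (ratr : {rmorphism rat -> complex R}).
have [q q0 qz] : algebraicOver ratr z.
  apply/integral_algebraic/(integral_root_monic mon root_z).
  apply/integral_poly => i; rewrite !coefE.
  apply: integral_add; last by case: (i == 0%N).
  apply: integral_sub; first by case: (i == 2%N).
  apply: integral_mul; last by case: (i == 1%N).
  by rewrite mulr2n; apply: integral_add.
have [q1 [a a0 qE]] := rat_poly_scale q.
have q1z : root (map_poly intr q1) z.
  move: qz; rewrite qE linearZ /= -map_poly_comp rootZ ?fmorph_eq0 ?invr_eq0 ?intr_eq0 //.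
  by rewrite (eq_map_poly (g := intr)) // => x /=; rewrite ratr_int.
have q10 : q1 != 0.
  by apply: contraNneq q0 => q10; rewrite qE q10 rmorph0 scaler0.
(* Powers of X are divided out, since the constant coefficient has to be nonzero. *)
have [s [r]] := multiplicity_XsubC q1 0; rewrite q10 /= => r0 q1E.
have nz : z != 0.
  apply/eqP=> -[c0 s0]; have : sin t * sin t + cos t * cos t = 1 := sin2_cos2 t.
  by rewrite c0 s0 !mulr0 addr0 => /esym/eqP; rewrite oner_eq0.
have rz : (map_poly intr r).[z] = 0.
  move: q1z; rewrite /root q1E subr0 rmorphM rmorphXn /= map_polyX hornerM hornerXn.
  by rewrite mulf_eq0 (negbTE (expf_neq0 _ nz)) orbF => /eqP.
have szr : size (map_poly (intr : int -> complex R) r) = (size r).-1.+1.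
  rewrite size_map_inj_poly ?prednK // ?size_poly_gt0; last exact: intr_inj.
  by apply: contraNneq r0 => ->; rewrite root0.
move: rz; rewrite horner_coef szr.
under eq_bigr => k _ do rewrite coef_map cis_natmul.
move=> rz.
apply: (@trig_sums_neq0 (size r).-1 (fun k => r`_k)).
- by rewrite -horner_coef0.
- move: (congr1 (@complex.Re R) rz).
  rewrite raddf_sum /= => {2}<-; apply: eq_bigr => k _.
  by rewrite -(rmorph_int (real_complex R)) /= mul0r subr0.
- move: (congr1 (@complex.Im R) rz).
  rewrite raddf_sum /= => {2}<-; apply: eq_bigr => k _.
  by rewrite -(rmorph_int (real_complex R)) /= mul0r addr0.
Qed.

(** * Algebraic functions *)

HB.instance Definition _ := isPointed.Build R R0.

(** Clipping turns an identity on an interval into one between total functions, so that integrality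
    can be taken in the ring of all functions R -> R. *)
Definition clip (c r x : R) : R := Rmax (Rminus c r) (Rmin (Rplus c r) x).

Definition polyfun c r (p : {poly rat}) : R -> R :=
  fun x => (map_poly ratr p).[cos (clip c r x)].

Lemma polyfun_is_zmod_morphism c r : zmod_morphism (polyfun c r).
Proof. by move=> p q; apply/funext => x; rewrite /polyfun rmorphB hornerD hornerN. Qed.
HB.instance Definition _ c r :=
  GRing.isZmodMorphism.Build {poly rat} (R -> R) (polyfun c r) (polyfun_is_zmod_morphism c r).

Lemma polyfun_is_monoid_morphism c r : monoid_morphism (polyfun c r).
Proof.
split=> [|p q]; apply/funext => x; rewrite /polyfun.
  by rewrite rmorph1 hornerC.
by rewrite rmorphM hornerM.
Qed.
HB.instance Definition _ c r :=
  GRing.isMonoidMorphism.Build {poly rat} (R -> R) (polyfun c r) (polyfun_is_monoid_morphism c r).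

(* Functions on [c - r, c + r], extended to R by clipping, that are integral over Q[cos]. *)
Definition algfun (c r : R) (f : R -> R) : Prop :=
  integralOver (polyfun c r) (fun x => f (clip c r x)).

Lemma clipP c r x : Rle 0 r -> Rle (Rabs (Rminus (clip c r x) c)) r.
Proof.
move=> r0; rewrite /clip; apply: Rabs_le.
have h1 := Rmax_l (Rminus c r) (Rmin (Rplus c r) x).
have h2 := Rmin_l (Rplus c r) x.
have h3 : Rle (Rmax (Rminus c r) (Rmin (Rplus c r) x)) (Rplus c r).
  by apply: Rmax_lub; lra.
split; lra.
Qed.

Lemma clip_id c r x : Rle (Rabs (Rminus x c)) r -> clip c r x = x.
Proof.
move=> /Rabs_le_between h; rewrite /clip Rmin_right ?Rmax_right //; lra.
Qed.

Lemma algfun_ext c r f g : Rle 0 r ->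
  (forall x, Rle (Rabs (Rminus x c)) r -> f x = g x) -> algfun c r f -> algfun c r g.
Proof.
move=> r0 fg; rewrite /algfun; congr (integralOver _ _).
by apply/funext => x; apply: fg; apply: clipP.
Qed.

Lemma algfun_cos c r : algfun c r cos.
Proof.
have := integral_id (polyfun c r) 'X; congr (integralOver _ _).
by apply/funext => x; rewrite /= /polyfun map_polyX hornerX.
Qed.

Lemma algfun_ratr c r q : algfun c r (fun _ => ratr q).
Proof.
have := integral_id (polyfun c r) q%:P; congr (integralOver _ _).
by apply/funext => x; rewrite /= /polyfun map_polyC hornerC.
Qed.

Lemma algfun_plus c r f g :
  algfun c r f -> algfun c r g -> algfun c r (fun x => Rplus (f x) (g x)).
Proof. exact: integral_add. Qed.

Lemma algfun_mult c r f g :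
  algfun c r f -> algfun c r g -> algfun c r (fun x => Rmult (f x) (g x)).
Proof. exact: integral_mul. Qed.

Lemma algfun_opp c r f : algfun c r f -> algfun c r (fun x => Ropp (f x)).
Proof. exact: integral_opp. Qed.

Lemma fct_exp (g : R -> R) n x : (g ^+ n) x = g x ^+ n.
Proof. by elim: n => [|n IH] //; rewrite !exprS -IH. Qed.

(** Degree 4 covers every root that is extracted: the quartic of cos (PI / 7), and square roots in
    the form f^4 = g f^2. *)
Lemma algfun_root4 c r (f g0 g1 g2 g3 : R -> R) : Rle 0 r ->
  algfun c r g0 -> algfun c r g1 -> algfun c r g2 -> algfun c r g3 ->
  (forall x, Rle (Rabs (Rminus x c)) r ->
    pow (f x) 4 = Rplus (Rmult (g3 x) (pow (f x) 3)) (Rplus (Rmult (g2 x) (pow (f x) 2))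
      (Rplus (Rmult (g1 x) (f x)) (g0 x)))) ->
  algfun c r f.
Proof.
move=> r0 h0 h1 h2 h3 hf.
pose cl (g : R -> R) : R -> R := fun x => g (clip c r x).
pose p : {poly (R -> R)} := \poly_(i < 4) nth 0 [:: cl g0; cl g1; cl g2; cl g3] i.
have sp : (size p < size ('X^4 : {poly (R -> R)}))%N by rewrite size_polyXn ltnS size_poly.
have hp i : integralOver (polyfun c r) p`_i.
  rewrite /p coef_poly; case: ifP => [|_]; last exact: integral0.
  by case: i => [|[|[|[|]]]].
apply: (@integral_root_monic _ _ _ _ ('X^4 - p)).
- by rewrite monicE lead_coefDl ?lead_coefXn // size_polyN.
- rewrite /root hornerD hornerN hornerXn subr_eq0; apply/eqP/funext => x.
  rewrite horner_poly !big_ord_recr big_ord0 /= add0r expr0 mulr1 expr1.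
  have := hf _ (clipP c x r0).
  rewrite !RealsE => hx; rewrite fct_exp [LHS]hx.
  set y := clip c r x.
  transitivity (g0 y + g1 y * f y + g2 y * f y ^+ 2 + g3 y * f y ^+ 3).
    by move: (f y) (g0 y) (g1 y) (g2 y) (g3 y) => *; ring.
  by rewrite -!(fct_exp (fun x => f (clip c r x))).
- apply/integral_poly => i; rewrite coefB; apply: integral_sub => //.
  by rewrite coefXn; case: eqP => _; [exact: integral1 | exact: integral0].
Qed.

Definition evalfun (Q : {poly {poly rat}}) (f : R -> R) (x : R) : R :=
  (map_poly (fun p : {poly rat} => (map_poly ratr p).[cos x]) Q).[f x].

Lemma continuity_pt_horner (p : {poly R}) f x :
  continuity_pt f x -> continuity_pt (fun y => p.[f y]) x.
Proof.
move=> hf; apply: (continuity_pt_comp f (horner p)) => //.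
apply/continuity_pt_filterlim/ex_derive_continuous.
by eexists; apply: derive_horner.
Qed.

Lemma evalfun_continuity Q f x :
  continuity_pt f x -> continuity_pt (evalfun Q f) x.
Proof.
move=> hf.
have hc : continuity_pt cos x by apply: continuity_cos.
have eqE y : evalfun Q f y = \sum_(i < size Q) (map_poly ratr Q`_i).[cos y] * f y ^+ i.
  rewrite /evalfun (@horner_coef_wide _ (size Q)) ?size_poly //.
  by apply: eq_bigr => i _; rewrite coef_poly ltn_ord.
apply: (continuity_pt_ext (fun y => \sum_(i < size Q) (map_poly ratr Q`_i).[cos y] * f y ^+ i)).
  by move=> y; rewrite eqE.
elim: (size Q) => [|n IH].
  apply: (continuity_pt_ext (fun _ => R0)); first by move=> y; rewrite big_ord0.
  exact: continuity_pt_const.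
apply: (continuity_pt_ext (fun y => Rplus (\sum_(i < n) (map_poly ratr Q`_i).[cos y] * f y ^+ i)
   (Rmult (map_poly ratr Q`_n).[cos y] (('X^n).[f y])))).
  by move=> y; rewrite big_ord_recr /= hornerXn.
apply: continuity_pt_plus => //; apply: continuity_pt_mult; exact: continuity_pt_horner.
Qed.

(* Write the monic relation of f as Q * X^s with Q(0) <> 0: wherever f does not vanish,
   f is a root of Q, so if f had nonzero values arbitrarily close to c then Q(0) would
   vanish at cos c. *)
Lemma algfun_locally_zero c r f : Rlt 0 r -> algfun c r f ->
  (forall p : {poly rat}, p != 0 -> (map_poly ratr p).[cos c] <> 0) ->
  continuity_pt f c -> f c = 0 ->
  exists d, Rlt 0 d /\ forall x, Rlt (Rabs (Rminus x c)) d -> f x = 0.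
Proof.
move=> r0 [P monP rP] tr cf fc0.
have [s [Q]] := multiplicity_XsubC P 0; rewrite monic_neq0 //= => Q0 PE.
have hQ x : Rle (Rabs (Rminus x c)) r -> f x = 0 \/ evalfun Q f x = 0.
  move=> hx.
  have : evalfun P f x = 0.
    move/eqP/(congr1 (fun h : R -> R => h x)): rP.
    rewrite !horner_coef fct_sumE.
    rewrite /evalfun (@horner_coef_wide _ (size P)) ?size_poly //.
    move=> h; rewrite -[RHS]h size_map_poly_id0; last first.
      by rewrite (monicP monP) rmorph1 oner_neq0.
    apply: eq_bigr => i _; rewrite !coef_map_id0 ?rmorph0 ?horner0 //.
    have -> : forall (u v : R -> R), (u * v) x = u x * v x by [].
    by rewrite fct_exp /polyfun clip_id.
  rewrite PE subr0 /evalfun.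
  pose ev : {rmorphism {poly rat} -> R} := horner_eval (cos x) \o map_poly ratr.
  rewrite -[fun p : {poly rat} => _]/(ev : _ -> _).
  rewrite rmorphM rmorphXn /= map_polyX hornerM hornerXn => /eqP.
  by rewrite mulf_eq0 => /orP[/eqP->|]; [right|rewrite expf_eq0 => /andP[_ /eqP]; left].
have Qc : evalfun Q f c <> 0.
  rewrite /evalfun fc0 horner_coef0 coef_map_id0 ?rmorph0 ?horner0 //.
  by apply: tr; rewrite -horner_coef0.
have /continuity_pt_locally lc := evalfun_continuity Q cf.
have aQ : Rlt 0 (Rabs (evalfun Q f c)) by apply: Rabs_pos_lt.
have [d hd] := lc (mkposreal _ aQ).
exists (Rmin d r); split; first by apply: Rmin_pos => //; apply: cond_pos.
move=> x hx.
case: (hQ x) => [|//|xQ].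
  by apply: Rlt_le; apply: Rlt_le_trans hx (Rmin_r _ _).
have /= := hd x (Rlt_le_trans _ _ _ hx (Rmin_l _ _)).
by rewrite xQ /Rminus Rplus_0_l Rabs_Ropp => /Rlt_irrefl.
Qed.

Lemma algfun_one c r : algfun c r (fun _ => R1).
Proof. by have := algfun_ratr c r 1; rewrite rmorph1. Qed.

Lemma algfun_half c r : algfun c r (fun _ => Rinv (IZR 2)).
Proof.
have := algfun_ratr c r (2%:R^-1); congr (algfun c r _).
by apply/funext => _; rewrite fmorphV rmorph_nat !RealsE.
Qed.

Lemma algfun_zero_near r f : Rlt 0 r -> algfun (Rdiv (IZR 44) (IZR 21)) r f ->
  continuity_pt f (Rdiv (IZR 44) (IZR 21)) -> f (Rdiv (IZR 44) (IZR 21)) = R0 ->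
  exists d, Rlt 0 d /\ forall x, Rlt (Rabs (Rminus x (Rdiv (IZR 44) (IZR 21)))) d -> f x = R0.
Proof.
move=> r0 af cf f0; apply: (algfun_locally_zero r0 af) => // p p0.
have -> : Rdiv (IZR 44) (IZR 21) = 44%:R / 21%:R by rewrite !RealsE.
exact: cos_transcendental.
Qed.

End AlgebraicFunctions.
Import AlgebraicFunctions.

(** * Bounds on PI, the arc cosine, and the quartic of cos (PI / 7) *)

Lemma PI_lt_22_7 : PI < 22 / 7.
Proof.
  (* h' = x^4 (1 - x)^4 / (1 + x^2) and h 1 - h 0 = 22/7 - PI *)
  set (h := fun x => x ^ 7 / 7 - 2 * x ^ 6 / 3 + x ^ 5 - 4 * x ^ 3 / 3 + 4 * x - 4 * atan x).
  set (dh := fun x => x ^ 4 * (1 - x) ^ 4 / (1 + x ^ 2)).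
  assert (Hd : forall x, is_derive h x (dh x)).
  { intros x. unfold h, dh. auto_derive; [trivial|]. unfold Rsqr. field. nra. }
  assert (Hle : forall x y, x <= y -> h x <= h y).
  { intros x y Hxy. destruct (MVT_gen h x y dh) as [c [_ E]].
    - intros; apply Hd.
    - intros z _. apply continuity_pt_filterlim, @ex_derive_continuous.
      eexists; apply Hd.
    - assert (0 <= dh c); [|nra]. unfold dh. pose proof (pow2_ge_0 c).
      apply Rdiv_le_0_compat; [|lra].
      apply Rmult_le_pos; [replace (c ^ 4) with ((c ^ 2) ^ 2) by ring
        | replace ((1 - c) ^ 4) with (((1 - c) ^ 2) ^ 2) by ring]; apply pow2_ge_0. }
  assert (Hlt : h (1 / 4) < h (3 / 4)).
  { apply (incr_function_le h (1 / 4) (3 / 4) dh); simpl; try lra; auto.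
    intros x H0 H1. unfold dh. pose proof (pow2_ge_0 x).
    apply Rdiv_lt_0_compat; [|lra]. apply Rmult_lt_0_compat; apply (pow_lt _ 4); lra. }
  pose proof (Hle 0 (1 / 4) ltac:(lra)). pose proof (Hle (3 / 4) 1 ltac:(lra)).
  assert (H01 : h 0 < h 1) by lra.
  unfold h in H01. rewrite atan_0, atan_1 in H01. lra.
Qed.

Lemma PI_gt_3 : 3 < PI.
Proof. pose proof PI2_3_2. lra. Qed.

Lemma acos_decreasing x y : -1 <= x -> x < y -> y <= 1 -> acos y < acos x.
Proof.
  intros Hx Hxy Hy. pose proof (acos_bound x). pose proof (acos_bound y).
  apply cos_decreasing_0; try lra. rewrite !cos_acos; lra.
Qed.

Lemma is_derive_acos x : -1 < x < 1 -> is_derive acos x (- / sin (acos x)).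
Proof.
  intros Hx. apply is_derive_Reals.
  rewrite sin_acos by lra.
  replace (- / sqrt (1 - x²)) with (-1 / sqrt (1 - x²)) by (unfold Rdiv; ring).
  rewrite <- (derive_pt_acos x Hx). apply derive_pt_eq_1 with (derivable_pt_acos x Hx).
  reflexivity.
Qed.

(** For t = PI / 7 this is cos (4 t) = - cos (3 t), from 4 t = PI - 3 t. The spurious factor cos t +
    1 is kept, since degree 4 suits [algfun_root4]. *)
Lemma cos_PI7_quartic :
  cos (PI / 7) ^ 4 = - / 2 * cos (PI / 7) ^ 3 + (1 * cos (PI / 7) ^ 2
    + (3 / 8 * cos (PI / 7) + - / 8)).
Proof.
  set (t := PI / 7). set (c := cos t).
  assert (E2 : cos (2 * t) = 2 * c * c - 1) by apply cos_2a_cos.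
  assert (E3 : cos (3 * t) = 4 * c ^ 3 - 3 * c).
  { replace (3 * t) with (2 * t + t) by ring. rewrite cos_plus, E2, sin_2a.
    pose proof (sin2_cos2 t) as Es. unfold Rsqr in Es. fold c in Es |- *.
    replace (2 * sin t * c * sin t) with (2 * c * (sin t * sin t)) by ring.
    replace (sin t * sin t) with (1 - c * c) by lra. ring. }
  assert (E4 : cos (4 * t) = 2 * cos (2 * t) * cos (2 * t) - 1).
  { replace (4 * t) with (2 * (2 * t)) by ring. apply cos_2a_cos. }
  assert (E : cos (4 * t) = - cos (3 * t)).
  { replace (4 * t) with (- (3 * t) + PI) by (unfold t; field).
    rewrite neg_cos, cos_neg. reflexivity. }
  rewrite E4, E3, E2 in E. nra.
Qed.

(** * Angles of the symmetric configuration *)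

Definition a0 : R := 44 / 21.

(** An angle is not an algebraic function itself. Algebraicity of its cosine and sine is preserved
    by sums, and a zero of the sine detects the multiples of PI. *)
Definition algang (r : R) (u : R -> R) : Prop :=
  algfun a0 r (fun x => cos (u x)) /\ algfun a0 r (fun x => sin (u x)).

Lemma algfun_sqrt r f g : 0 <= r -> algfun a0 r g ->
  (forall x, Rabs (x - a0) <= r -> f x * f x = g x) -> algfun a0 r f.
Proof.
  intros Hr Hg Hf.
  assert (Z : algfun a0 r (fun _ => 0)).
  { apply (@algfun_ext a0 r (fun _ => 1 + - 1)); auto; [intros; ring|].
    apply algfun_plus; [|apply algfun_opp]; apply algfun_one. }
  apply (@algfun_root4 a0 r f (fun _ => 0) (fun _ => 0) g (fun _ => 0)); auto.
  intros x Hx. rewrite <- (Hf x Hx). ring.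
Qed.

Lemma algang_of_cos r u : 0 <= r -> algfun a0 r (fun x => cos (u x)) -> algang r u.
Proof.
  intros Hr Hc. split; auto.
  apply algfun_sqrt with (g := fun x => 1 + - (cos (u x) * cos (u x))); auto.
  - apply algfun_plus; [apply algfun_one|]. now apply algfun_opp, algfun_mult.
  - intros x _. pose proof (sin2_cos2 (u x)) as E. unfold Rsqr in E. lra.
Qed.

Lemma algang_plus r u v : 0 <= r -> algang r u -> algang r v ->
  algang r (fun x => u x + v x).
Proof.
  intros Hr [Hu1 Hu2] [Hv1 Hv2]. apply algang_of_cos; auto.
  apply (@algfun_ext a0 r (fun x => cos (u x) * cos (v x) + - (sin (u x) * sin (v x)))); auto.
  - intros x _. rewrite cos_plus. ring.
  - apply algfun_plus; [|apply algfun_opp]; now apply algfun_mult.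
Qed.

Lemma algang_opp r u : 0 <= r -> algang r u -> algang r (fun x => - u x).
Proof.
  intros Hr [Hu1 Hu2]. apply algang_of_cos; auto.
  apply (@algfun_ext a0 r (fun x => cos (u x))); auto.
  intros x _. now rewrite cos_neg.
Qed.

Lemma algang_PI7 r : 0 <= r -> algang r (fun _ => PI / 7).
Proof.
  intros Hr. apply algang_of_cos; auto.
  pose proof (algfun_one a0 r) as H1. pose proof (algfun_half a0 r) as H2.
  pose proof (algfun_mult H2 H2) as H4.
  pose proof (algfun_mult H4 H2) as H8.
  pose proof (algfun_plus H4 H8) as H38.
  apply (@algfun_root4 a0 r _ (fun _ => - (/ 2 * / 2 * / 2)) (fun _ => / 2 * / 2 + / 2 * / 2 * / 2)
     (fun _ => 1) (fun _ => - / 2)); auto; try (now apply algfun_opp).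
  intros x _. rewrite cos_PI7_quartic. field.
Qed.

Lemma algang_PI6 r : 0 <= r -> algang r (fun _ => PI / 6).
Proof.
  intros Hr. apply algang_of_cos; auto.
  pose proof (algfun_half a0 r) as H2.
  pose proof (algfun_mult H2 H2) as H4.
  apply (algfun_sqrt r _ (fun _ => / 2 + / 2 * / 2)); auto.
  - now apply algfun_plus.
  - intros x _. pose proof (sin2_cos2 (PI / 6)) as E. unfold Rsqr in E.
    rewrite sin_PI6 in E. lra.
Qed.

Lemma algang_const r (m : Z) : 0 <= r -> algang r (fun _ => IZR m * (PI / 42)).
Proof.
  intros Hr.
  (* PI / 42 generates both PI / 7 = 6 PI / 42 and PI / 3 = 14 PI / 42, and is itself PI / 6 - PI /
     7. *)
  assert (H42 : algang r (fun _ => PI / 42)).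
  { replace (PI / 42) with (PI / 6 + - (PI / 7)) by field.
    apply algang_plus; [auto | now apply algang_PI6 | now apply algang_opp, algang_PI7]. }
  assert (Hn : forall n : nat, algang r (fun _ => INR n * (PI / 42))).
  { induction n.
    - replace (INR 0 * (PI / 42)) with (PI / 42 + - (PI / 42)) by (simpl; ring).
      now apply algang_plus; [..| apply algang_opp].
    - rewrite S_INR. replace ((INR n + 1) * (PI / 42)) with (INR n * (PI / 42) + PI / 42) by ring.
      now apply algang_plus. }
  destruct (Z.le_gt_cases 0 m).
  - replace m with (Z.of_nat (Z.to_nat m)) by lia. rewrite <- INR_IZR_INZ. apply Hn.
  - replace m with (- Z.of_nat (Z.to_nat (- m)))%Z by lia.
    rewrite opp_IZR, <- INR_IZR_INZ.
    replace (- INR (Z.to_nat (- m)) * (PI / 42)) with (- (INR (Z.to_nat (- m)) * (PI / 42))) by ring.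
    now apply algang_opp.
Qed.

(* Since a0 has transcendental cosine, an algebraic angle function that vanishes
   mod PI at a0 vanishes mod PI near a0. *)
Lemma algang_const_near r u : 0 < r -> algang r u -> continuity_pt u a0 ->
  sin (u a0) = 0 -> locally a0 (fun x => u x = u a0).
Proof.
  intros Hr [_ Hu] Hc H0.
  destruct (@algfun_zero_near r (fun x => sin (u x)) Hr Hu) as [d [Hd Hz]]; auto.
  { apply (continuity_pt_comp u sin); auto. apply continuity_sin. }
  pose proof (proj1 (continuity_pt_locally u a0) Hc (mkposreal 1 Rlt_0_1)) as HL.
  assert (HL2 : locally a0 (fun x => Rabs (x - a0) < d)).
  { exists (mkposreal d Hd). intros y Hy. apply Hy. }
  generalize (filter_and _ _ HL HL2). apply filter_imp. simpl.
  intros x [Hx1 Hx2].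
  assert (E : sin (u x - u a0) = 0).
  { rewrite sin_minus, H0, (Hz x Hx2). ring. }
  pose proof PI_gt_3.
  destruct (Rtotal_order (u x - u a0) 0) as [Hlt|[Heq|Hgt]]; [|lra|].
  - apply Rabs_def2 in Hx1. assert (sin (u x - u a0) < 0) by (apply sin_lt_0_var; lra). lra.
  - apply Rabs_def2 in Hx1. assert (0 < sin (u x - u a0)) by (apply sin_gt_0; lra). lra.
Qed.

(* [deflect w x] is the angle between the outgoing edge and the radius when the
   incoming edge makes the angle x with it, in the branch (extension or
   suspension) selected by w. *)
Definition deflect (w x : R) : R :=
  if Rlt_dec (PI / 2) w then PI - x else acos (/ 2 - cos x).

(** The triangle O v_i v_(i+1) has the angles PI / 7, [theta i] and [ang (S i)], whence 6 PI / 7.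
    The arc cosine in [deflect] solves the radial balance 1 = 2 cos (ang i) + 2 cos (theta i) at a
    suspended vertex. The start is [alpha0 / 2]. *)
Fixpoint ang (i : nat) : R :=
  match i with O => a0 | S j => 6 * PI / 7 - deflect (ang j) (ang j) end.

Definition theta (i : nat) : R := deflect (ang i) (ang i).

(** The branches are frozen to those of the orbit of [a0], which makes [angfun i] a single algebraic
    expression in the starting angle x. *)
Fixpoint angfun (i : nat) (x : R) : R :=
  match i with O => x | S j => 6 * PI / 7 - deflect (ang j) (angfun j x) end.

Fixpoint dangfun (i : nat) (x : R) : R :=
  match i with
  | O => 1
  | S j => dangfun j x * (if Rlt_dec (PI / 2) (ang j) then 1
      else sin (angfun j x) / sin (deflect (ang j) (angfun j x)))
  end.

Lemma angfun_a0 i : angfun i a0 = ang i.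
Proof. induction i; simpl; congruence. Qed.

Lemma cos_bounds_PI3_PI2 x : PI / 3 < x < PI / 2 -> 0 < cos x < / 2.
Proof.
  intros Hx. split; [apply cos_gt_0; lra|].
  replace (/ 2) with (cos (PI / 3)) by (rewrite cos_PI3; field).
  apply cos_decreasing_1; lra.
Qed.

(** In both branches the outgoing angle is at most PI / 2, and 5 PI / 14 = 6 PI / 7 - PI / 2. As
    this exceeds PI / 3, the argument 1/2 - cos of the arc cosine stays positive under
    suspension. *)
Lemma ang_range i : 5 * PI / 14 <= ang i < PI.
Proof.
  pose proof PI_gt_3. pose proof PI_lt_22_7.
  induction i as [|i IH]; simpl; [unfold a0; lra|].
  unfold deflect. destruct (Rlt_dec (PI / 2) (ang i)); [lra|].
  assert (Hc0 : 0 <= cos (ang i)) by (apply cos_ge_0; lra).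
  assert (Hc1 : cos (ang i) < / 2).
  { replace (/ 2) with (cos (PI / 3)) by (rewrite cos_PI3; field).
    apply cos_decreasing_1; lra. }
  pose proof (acos_decreasing 0 (/ 2 - cos (ang i)) ltac:(lra) ltac:(lra) ltac:(lra)).
  rewrite acos_0 in *. pose proof (acos_bound (/ 2 - cos (ang i))). lra.
Qed.

(** On such an interval every suspended angle keeps 1/2 - cos strictly between 0 and 1/2, where the
    arc cosine is smooth and decreasing. *)
Definition regular (n : nat) (r : R) : Prop :=
  0 < r /\ forall j x, (j < n)%nat -> ang j <= PI / 2 -> Rabs (x - a0) <= r ->
    PI / 3 < angfun j x < PI / 2.

Section Regular.
Variables (n : nat) (r : R).
Hypothesis Hreg : regular n r.

Let r_pos : 0 < r := proj1 Hreg.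

Lemma regular_center : Rabs (a0 - a0) <= r.
Proof. pose proof r_pos. unfold Rminus. rewrite Rplus_opp_r, Rabs_R0. lra. Qed.

Lemma angfun_branch j x : (j < n)%nat -> Rabs (x - a0) <= r -> ~ PI / 2 < ang j ->
  0 < cos (angfun j x) < / 2 /\ 0 < sin (angfun j x) /\
  0 < sin (deflect (ang j) (angfun j x)).
Proof.
  intros Hj Hx HB. pose proof PI_gt_3.
  pose proof (proj2 Hreg j x Hj ltac:(lra) Hx) as Hb.
  pose proof (cos_bounds_PI3_PI2 _ Hb) as Hc.
  repeat split; try lra; [apply sin_gt_0; lra|].
  unfold deflect. destruct (Rlt_dec (PI / 2) (ang j)); [lra|].
  pose proof (acos_bound_lt (/ 2 - cos (angfun j x)) ltac:(lra)).
  apply sin_gt_0; lra.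
Qed.

Lemma angfun_algang j : (j <= n)%nat -> algang r (angfun j).
Proof.
  assert (Hr : 0 <= r) by (pose proof r_pos; lra).
  induction j as [|j IH]; intros Hj.
  - apply algang_of_cos; auto. apply algfun_cos.
  - specialize (IH ltac:(lia)).
    assert (H6 : algang r (fun _ => 6 * PI / 7)).
    { replace (6 * PI / 7) with (IZR 36 * (PI / 42)) by (simpl; field).
      now apply algang_const. }
    apply (algang_plus r (fun _ => 6 * PI / 7) (fun x => - deflect (ang j) (angfun j x))); auto.
    apply algang_opp; auto. unfold deflect.
    pose proof (fun x Hx => angfun_branch j x ltac:(lia) Hx) as Hb.
    destruct (Rlt_dec (PI / 2) (ang j)) as [HA|HB].
    + apply (algang_plus r (fun _ => PI) (fun x => - angfun j x)); auto.
      * replace PI with (IZR 42 * (PI / 42)) by (simpl; field). now apply algang_const.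
      * now apply algang_opp.
    + apply algang_of_cos; auto.
      apply (@algfun_ext a0 r (fun x => / 2 + - cos (angfun j x))); auto.
      * intros x Hx. specialize (Hb x Hx HB). rewrite cos_acos; [reflexivity|lra].
      * apply algfun_plus; [apply algfun_half | apply algfun_opp, IH].
Qed.

Lemma is_derive_angfun j x : (j <= n)%nat -> Rabs (x - a0) <= r ->
  is_derive (angfun j) x (dangfun j x) /\ 0 < dangfun j x.
Proof.
  induction j as [|j IH]; intros Hj Hx; simpl.
  - split; [exact (is_derive_id x) | lra].
  - destruct (IH ltac:(lia) Hx) as [Hd Hp].
    pose proof (angfun_branch j x ltac:(lia) Hx) as Hb.
    unfold deflect in *. destruct (Rlt_dec (PI / 2) (ang j)) as [HA|HB].
    + split; [|lra].
      auto_derive; [eexists; apply Hd|].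
      change (Derive (fun x => angfun j x) x) with (Derive (angfun j) x).
      rewrite (is_derive_unique _ _ _ Hd). ring.
    + specialize (Hb HB). destruct Hb as [Hc [Hs Ht]].
      assert (Ha := is_derive_acos (/ 2 - cos (angfun j x)) ltac:(lra)).
      split.
      * evar_last.
        -- refine (is_derive_minus (fun _ => 6 * PI / 7) _ x _ _ (is_derive_const _ _) _).
           apply (is_derive_comp acos (fun x => / 2 - cos (angfun j x))); [apply Ha|].
           auto_derive; [eexists; apply Hd|].
           change (Derive (fun x => angfun j x) x) with (Derive (angfun j) x).
           rewrite (is_derive_unique _ _ _ Hd). reflexivity.
        -- unfold minus, plus, opp, zero, scal; simpl. unfold mult; simpl. field. lra.
      * apply Rmult_lt_0_compat; auto. apply Rdiv_lt_0_compat; auto.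
Qed.

Lemma angfun_continuity_pt j : (j <= n)%nat -> continuity_pt (angfun j) a0.
Proof.
  intros Hj. apply continuity_pt_filterlim, @ex_derive_continuous.
  eexists. apply (proj1 (is_derive_angfun j a0 Hj regular_center)).
Qed.

Lemma angfun_increasing j x y : (j <= n)%nat -> Rabs (x - a0) <= r ->
  Rabs (y - a0) <= r -> x < y -> angfun j x < angfun j y.
Proof.
  intros Hj Hx Hy Hxy. induction j as [|j IH]; simpl; auto.
  specialize (IH ltac:(lia)).
  pose proof (angfun_branch j x ltac:(lia) Hx) as Hb1.
  pose proof (angfun_branch j y ltac:(lia) Hy) as Hb2.
  unfold deflect in *. destruct (Rlt_dec (PI / 2) (ang j)) as [HA|HB]; [lra|].
  specialize (Hb1 HB). specialize (Hb2 HB).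
  pose proof (proj2 Hreg j x ltac:(lia) ltac:(lra) Hx).
  pose proof (proj2 Hreg j y ltac:(lia) ltac:(lra) Hy).
  assert (cos (angfun j y) < cos (angfun j x)) by (apply cos_decreasing_1; lra).
  pose proof (acos_decreasing (/ 2 - cos (angfun j x)) (/ 2 - cos (angfun j y))
    ltac:(lra) ltac:(lra) ltac:(lra)). lra.
Qed.

(* The derivative of the suspension branch increases with the angle, so that
   ratios of derivatives along the orbit do too. *)
Lemma dangfun_ratio_increasing i k x y : (i + k <= n)%nat -> Rabs (x - a0) <= r ->
  Rabs (y - a0) <= r -> x < y ->
  dangfun (i + k) x * dangfun i y <= dangfun (i + k) y * dangfun i x /\
  ((exists l, (i <= l < i + k)%nat /\ ~ PI / 2 < ang l) ->
   dangfun (i + k) x * dangfun i y < dangfun (i + k) y * dangfun i x).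
Proof.
  intros Hk Hx Hy Hxy. induction k as [|k IH].
  - rewrite Nat.add_0_r. split; [lra|]. intros [l [Hl _]]. lia.
  - destruct (IH ltac:(lia)) as [IH1 IH2]. clear IH.
    replace (i + S k)%nat with (S (i + k)) by lia. simpl.
    pose proof (angfun_branch (i + k) x ltac:(lia) Hx) as Hb1.
    pose proof (angfun_branch (i + k) y ltac:(lia) Hy) as Hb2.
    destruct (is_derive_angfun (i + k) x ltac:(lia) Hx) as [_ P1].
    destruct (is_derive_angfun (i + k) y ltac:(lia) Hy) as [_ P2].
    destruct (is_derive_angfun i x ltac:(lia) Hx) as [_ P3].
    destruct (is_derive_angfun i y ltac:(lia) Hy) as [_ P4].
    pose proof (angfun_increasing (i + k) x y ltac:(lia) Hx Hy Hxy) as Hinc.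
    unfold deflect in *. destruct (Rlt_dec (PI / 2) (ang (i + k))) as [HA|HB].
    + split; [lra|]. intros [l [Hl1 Hl2]].
      assert (l <> (i + k)%nat) by (intros ->; contradiction).
      rewrite !Rmult_1_r. apply IH2. exists l. split; [lia | auto].
    + specialize (Hb1 HB). specialize (Hb2 HB).
      set (tx := acos (/ 2 - cos (angfun (i + k) x))) in *.
      set (ty := acos (/ 2 - cos (angfun (i + k) y))) in *.
      pose proof (proj2 Hreg (i + k)%nat x ltac:(lia) ltac:(lra) Hx).
      pose proof (proj2 Hreg (i + k)%nat y ltac:(lia) ltac:(lra) Hy).
      assert (Hs : sin (angfun (i + k) x) < sin (angfun (i + k) y))
        by (apply sin_increasing_1; lra).
      assert (Ht : sin ty < sin tx).
      { assert (ty < tx).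
        { apply acos_decreasing; try lra.
          assert (cos (angfun (i + k) y) < cos (angfun (i + k) x))
            by (apply cos_decreasing_1; lra). lra. }
        assert (tx < PI / 2).
        { rewrite <- acos_0. apply acos_decreasing; lra. }
        pose proof (acos_bound (/ 2 - cos (angfun (i + k) y))) as Hty. fold ty in Hty. pose proof PI_gt_3.
        apply sin_increasing_1; lra. }
      assert (Hpsi : sin (angfun (i + k) x) / sin tx < sin (angfun (i + k) y) / sin ty).
      { apply Rlt_trans with (sin (angfun (i + k) y) / sin tx).
        - apply Rmult_lt_compat_r; auto. apply Rinv_0_lt_compat; lra.
        - apply Rmult_lt_compat_l; [lra|]. apply Rinv_lt_contravar; [apply Rmult_lt_0_compat|]; lra. }
      assert (0 < sin (angfun (i + k) x) / sin tx) by (apply Rdiv_lt_0_compat; lra).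
      assert (0 < dangfun (i + k) y * dangfun i x) by (apply Rmult_lt_0_compat; auto).
      assert (dangfun (i + k) x * (sin (angfun (i + k) x) / sin tx) * dangfun i y <
        dangfun (i + k) y * (sin (angfun (i + k) y) / sin ty) * dangfun i x) by nra.
      split; [lra | auto].
Qed.

Lemma locally_regular : locally a0 (fun x => Rabs (x - a0) <= r).
Proof.
  exists (mkposreal r r_pos). intros y Hy. apply Rlt_le, Hy.
Qed.

Lemma is_derive_const_near u x l : locally x (fun y => u y = u x) ->
  is_derive u x l -> l = 0.
Proof.
  intros Hl Hd. rewrite <- (is_derive_unique _ _ _ Hd).
  rewrite (Derive_ext_loc _ (fun _ => u x)); auto. apply Derive_const.
Qed.

Lemma sin_ang_sum_neq0 i j m : (i <= n)%nat -> (j <= n)%nat ->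
  sin (ang i + ang j + IZR m * (PI / 42)) <> 0.
Proof.
  intros Hi Hj H0. assert (Hr : 0 <= r) by (pose proof r_pos; lra).
  assert (HL : locally a0 (fun x => angfun i x + angfun j x + IZR m * (PI / 42)
     = angfun i a0 + angfun j a0 + IZR m * (PI / 42))).
  { apply (algang_const_near r (fun x => angfun i x + angfun j x + IZR m * (PI / 42))).
    - apply r_pos.
    - apply (algang_plus r (fun x => angfun i x + angfun j x)); auto.
      + apply algang_plus; auto; now apply angfun_algang.
      + now apply algang_const.
    - apply continuity_pt_plus; [apply continuity_pt_plus|];
        try now apply angfun_continuity_pt. now apply continuity_pt_const.
    - now rewrite !angfun_a0. }
  destruct (is_derive_angfun i a0 Hi regular_center) as [D1 P1].
  destruct (is_derive_angfun j a0 Hj regular_center) as [D2 P2].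
  assert (D : is_derive (fun x => angfun i x + angfun j x + IZR m * (PI / 42)) a0
    (dangfun i a0 + dangfun j a0 + 0)).
  { exact (is_derive_plus _ _ _ _ _ (is_derive_plus _ _ _ _ _ D1 D2) (is_derive_const _ _)). }
  pose proof (is_derive_const_near _ _ _ HL D). lra.
Qed.

Lemma sin_ang_neq0 i m : (i <= n)%nat -> sin (ang i + IZR m * (PI / 42)) <> 0.
Proof.
  intros Hi H0. assert (Hr : 0 <= r) by (pose proof r_pos; lra).
  assert (HL : locally a0 (fun x => angfun i x + IZR m * (PI / 42)
     = angfun i a0 + IZR m * (PI / 42))).
  { apply (algang_const_near r (fun x => angfun i x + IZR m * (PI / 42))).
    - apply r_pos.
    - apply algang_plus; auto; [now apply angfun_algang | now apply algang_const].
    - apply continuity_pt_plus; [now apply angfun_continuity_pt | now apply continuity_pt_const].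
    - now rewrite angfun_a0. }
  destruct (is_derive_angfun i a0 Hi regular_center) as [D1 P1].
  assert (D : is_derive (fun x => angfun i x + IZR m * (PI / 42)) a0 (dangfun i a0 + 0)).
  { exact (is_derive_plus _ _ _ _ _ D1 (is_derive_const _ _)). }
  pose proof (is_derive_const_near _ _ _ HL D). lra.
Qed.

(** The derivative of a difference may vanish at [a0] itself. But if the difference is constant near
    [a0], the two derivatives agree at [a0] and at a second point, against the strict growth of
    their ratio once a suspension lies in between. *)
Lemma sin_ang_diff_neq0 i j m : (i < j <= n)%nat ->
  (exists l, (i <= l < j)%nat /\ ~ PI / 2 < ang l) ->
  sin (ang j - ang i + IZR m * (PI / 42)) <> 0.
Proof.
  intros Hij HB H0. assert (Hr : 0 <= r) by (pose proof r_pos; lra).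
  set (u := fun x => angfun j x + - angfun i x + IZR m * (PI / 42)).
  assert (HL : locally a0 (fun x => u x = u a0)).
  { apply (algang_const_near r u).
    - apply r_pos.
    - apply (algang_plus r (fun x => angfun j x + - angfun i x)); auto.
      + apply algang_plus; auto; [|apply algang_opp; auto]; apply angfun_algang; lia.
      + now apply algang_const.
    - apply continuity_pt_plus; [apply continuity_pt_plus; [|apply continuity_pt_opp]|];
        try (apply angfun_continuity_pt; lia). now apply continuity_pt_const.
    - unfold u. now rewrite !angfun_a0. }
  assert (Hd : locally a0 (fun x => dangfun j x = dangfun i x)).
  { generalize (filter_and _ _ (locally_locally _ _ HL) locally_regular).
    apply filter_imp. intros x [HLx Hx].
    destruct (is_derive_angfun j x ltac:(lia) Hx) as [D1 P1].
    destruct (is_derive_angfun i x ltac:(lia) Hx) as [D2 P2].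
    assert (D : is_derive u x (dangfun j x + - dangfun i x + 0)).
    { exact (is_derive_plus _ _ _ _ _
        (is_derive_plus _ _ _ _ _ D1 (is_derive_opp _ _ _ D2)) (is_derive_const _ _)). }
    assert (HLx' : locally x (fun y => u y = u x)).
    { rewrite <- (locally_singleton _ _ HLx) in HLx. exact HLx. }
    pose proof (is_derive_const_near _ _ _ HLx' D). lra. }
  destruct (filter_and _ _ Hd locally_regular) as [d Hdd].
  pose proof (cond_pos d) as Hdp.
  destruct (Hdd a0 (ball_center a0 d)) as [E1 R1].
  destruct (Hdd (a0 + d / 2)) as [E2 R2].
  { unfold ball; simpl. unfold AbsRing_ball, abs, minus, plus, opp; simpl.
    replace (a0 + d / 2 + - a0) with (d / 2) by ring. rewrite Rabs_pos_eq; lra. }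
  destruct (dangfun_ratio_increasing i (j - i) a0 (a0 + d / 2) ltac:(lia) R1 R2 ltac:(lra))
    as [_ Hlt].
  replace (i + (j - i))%nat with j in Hlt by lia.
  specialize (Hlt HB). rewrite E1, E2 in Hlt. lra.
Qed.

End Regular.

(** Regularity and transcendence feed each other: an interval regular up to n gives
    [ang n <> PI / 2] (the shift 21 PI / 42 is PI / 2), and then continuity of [angfun n] shrinks
    the interval to one regular up to n + 1. *)
Lemma regular_exists n : exists r, regular n r.
Proof.
  induction n as [|n [r Hr]].
  - exists 1. split; [lra|]. intros; lia.
  - pose proof (ang_range n) as Hrg. pose proof PI_gt_3.
    destruct (Rlt_dec (PI / 2) (ang n)) as [HA|HB].
    + exists r. destruct Hr as [Hr0 Hr]. split; auto.
      intros j x Hj HjB Hx. apply Hr; auto.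
      assert (j <> n) by (intros ->; lra). lia.
    + assert (Hneq : ang n <> PI / 2).
      { intros E. apply (sin_ang_neq0 n r Hr n 21 (le_n n)). rewrite E.
        replace (PI / 2 + 21 * (PI / 42)) with PI by (simpl; field). apply sin_PI. }
      pose proof (angfun_continuity_pt n r Hr n (le_n n)) as Hc.
      assert (Hpos : 0 < Rmin (ang n - PI / 3) (PI / 2 - ang n)) by (apply Rmin_pos; lra).
      destruct (proj1 (continuity_pt_locally _ _) Hc (mkposreal _ Hpos)) as [d Hd].
      destruct Hr as [Hr0 Hr]. pose proof (cond_pos d).
      exists (Rmin r (d / 2)). split; [apply Rmin_pos; lra|].
      intros j x Hj HjB Hx.
      pose proof (Rmin_l r (d / 2)). pose proof (Rmin_r r (d / 2)).
      destruct (Nat.eq_dec j n) as [->|Hjn]; [|apply Hr; auto; [lia | lra]].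
      assert (Hb : ball a0 d x).
      { unfold ball; simpl. unfold AbsRing_ball, abs, minus, plus, opp; simpl.
        unfold Rminus in Hx. lra. }
      specialize (Hd x Hb). simpl in Hd. rewrite angfun_a0 in Hd.
      apply Rabs_def2 in Hd.
      pose proof (Rmin_l (ang n - PI / 3) (PI / 2 - ang n)).
      pose proof (Rmin_r (ang n - PI / 3) (PI / 2 - ang n)). lra.
Qed.

Lemma sin_ang_sum i j m : sin (ang i + ang j + IZR m * (PI / 42)) <> 0.
Proof.
  destruct (regular_exists (i + j)) as [r Hr].
  apply (sin_ang_sum_neq0 _ _ Hr); lia.
Qed.

Lemma sin_ang_shift i m : sin (ang i + IZR m * (PI / 42)) <> 0.
Proof. destruct (regular_exists i) as [r Hr]. now apply (sin_ang_neq0 _ _ Hr). Qed.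

Lemma sin_ang_diff i j m : (i < j)%nat ->
  (exists l, (i <= l < j)%nat /\ ~ PI / 2 < ang l) ->
  sin (ang j - ang i + IZR m * (PI / 42)) <> 0.
Proof.
  intros Hij. destruct (regular_exists j) as [r Hr].
  apply (sin_ang_diff_neq0 _ _ Hr). lia.
Qed.

(** * Limits as phi tends to 0 *)

(** Stars are related to phi by a predicate, not given as a function of it. A filter on pairs,
    quantifying over all stars above a small phi, lets limits be stated without constructing the
    star. *)
Definition near (n : nat) (P : R * star -> Prop) : Prop :=
  exists eps, 0 < eps /\ forall phi, - eps < phi < eps ->
    forall G, is_star n phi G -> P (phi, G).

Global Instance near_filter n : Filter (near n).
Proof.
  split.
  - exists 1. split; [lra | auto].
  - intros P Q [e1 [H1 HP]] [e2 [H2 HQ]]. exists (Rmin e1 e2).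
    split; [now apply Rmin_pos|]. intros phi Hphi G HG.
    pose proof (Rmin_l e1 e2). pose proof (Rmin_r e1 e2).
    split; [apply HP | apply HQ]; auto; lra.
  - intros P Q HPQ [e [He HP]]. exists e. auto.
Qed.

Lemma near_is_star n : near n (fun t => is_star n (fst t) (snd t)).
Proof. exists 1. split; [lra | auto]. Qed.

Section Limits.
Context {T : Type} {F : (T -> Prop) -> Prop} {FF : Filter F}.

Definition Rlim (f : T -> R) (l : R) : Prop := filterlim f F (locally l).
Definition Clim (f : T -> C) (l : C) : Prop :=
  Rlim (fun t => Re (f t)) (Re l) /\ Rlim (fun t => Im (f t)) (Im l).

Lemma Rlim_const (a : R) : Rlim (fun _ => a) a.
Proof. apply filterlim_const. Qed.

Lemma Rlim_comp (g : R -> R) f l : Rlim f l -> continuous g l -> Rlim (fun t => g (f t)) (g l).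
Proof. intros Hf Hg. eapply filterlim_comp; eauto. Qed.

Lemma Rlim_ext f g l : F (fun t => f t = g t) -> Rlim f l -> Rlim g l.
Proof. apply filterlim_ext_loc. Qed.

Lemma Rlim_plus f g a b : Rlim f a -> Rlim g b -> Rlim (fun t => f t + g t) (a + b).
Proof.
  intros Hf Hg. eapply filterlim_comp_2; [apply Hf | apply Hg | apply (filterlim_plus (V := R_NormedModule) a b)].
Qed.

Lemma Rlim_mult f g a b : Rlim f a -> Rlim g b -> Rlim (fun t => f t * g t) (a * b).
Proof.
  intros Hf Hg. eapply filterlim_comp_2; [apply Hf | apply Hg | apply (filterlim_mult (K := R_AbsRing) a b)].
Qed.

Lemma Rlim_opp f a : Rlim f a -> Rlim (fun t => - f t) (- a).
Proof.
  intros Hf. apply (Rlim_ext (fun t => (-1) * f t)).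
  - apply filter_forall. intros; ring.
  - replace (- a) with (-1 * a) by ring. apply Rlim_mult; [apply Rlim_const | auto].
Qed.

Lemma Rlim_minus f g a b : Rlim f a -> Rlim g b -> Rlim (fun t => f t - g t) (a - b).
Proof. intros Hf Hg. apply Rlim_plus; [auto | now apply Rlim_opp]. Qed.

Lemma Rlim_inv f a : Rlim f a -> a <> 0 -> Rlim (fun t => / f t) (/ a).
Proof.
  intros Hf Ha. apply (Rlim_comp Rinv); auto.
  apply continuity_pt_filterlim, continuity_pt_inv; auto. apply continuity_pt_id.
Qed.

Lemma Rlim_div f g a b : Rlim f a -> Rlim g b -> b <> 0 -> Rlim (fun t => f t / g t) (a / b).
Proof. intros Hf Hg Hb. apply Rlim_mult; auto. now apply Rlim_inv. Qed.

Lemma Rlim_sqrt f a : Rlim f a -> Rlim (fun t => sqrt (f t)) (sqrt a).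
Proof. intros Hf. apply (Rlim_comp sqrt); auto. apply continuous_sqrt. Qed.

Lemma Rlim_lt f a b : Rlim f a -> a < b -> F (fun t => f t < b).
Proof. intros Hf Hab. apply (Hf (fun y => y < b)). now apply open_lt. Qed.

Lemma Rlim_gt f a b : Rlim f a -> b < a -> F (fun t => b < f t).
Proof. intros Hf Hab. apply (Hf (fun y => b < y)). now apply open_gt. Qed.

Lemma Rlim_neq0 f a : Rlim f a -> a <> 0 -> F (fun t => f t <> 0).
Proof.
  intros Hf Ha. destruct (Rtotal_order a 0) as [H|[H|H]]; [|contradiction|].
  - generalize (Rlim_lt f a 0 Hf H). apply filter_imp. intros; lra.
  - generalize (Rlim_gt f a 0 Hf H). apply filter_imp. intros; lra.
Qed.

Lemma Rlim_0_le f g : Rlim g 0 -> F (fun t => Rabs (f t) <= g t) -> Rlim f 0.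
Proof.
  intros Hg Hfg. apply filterlim_locally. intros e.
  generalize (filter_and _ _ Hfg (Rlim_lt g 0 e Hg (cond_pos e))). apply filter_imp.
  intros t [H1 H2]. unfold ball; simpl. unfold AbsRing_ball, abs, minus, plus, opp; simpl.
  rewrite Ropp_0, Rplus_0_r. lra.
Qed.

Lemma Clim_const (z : C) : Clim (fun _ => z) z.
Proof. split; apply Rlim_const. Qed.

Lemma Clim_ext f g l : F (fun t => f t = g t) -> Clim f l -> Clim g l.
Proof.
  intros H [H1 H2]. split; [eapply Rlim_ext, H1 | eapply Rlim_ext, H2];
    revert H; apply filter_imp; intros t ->; reflexivity.
Qed.

Lemma Clim_plus f g a b : Clim f a -> Clim g b -> Clim (fun t => f t + g t)%C (a + b)%C.
Proof. intros [H1 H2] [H3 H4]. split; simpl; now apply Rlim_plus. Qed.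

Lemma Clim_opp f a : Clim f a -> Clim (fun t => - f t)%C (- a)%C.
Proof. intros [H1 H2]. split; simpl; now apply Rlim_opp. Qed.

Lemma Clim_minus f g a b : Clim f a -> Clim g b -> Clim (fun t => f t - g t)%C (a - b)%C.
Proof. intros Hf Hg. apply Clim_plus; [auto | now apply Clim_opp]. Qed.

Lemma Clim_mult f g a b : Clim f a -> Clim g b -> Clim (fun t => f t * g t)%C (a * b)%C.
Proof.
  intros [H1 H2] [H3 H4]. split; simpl.
  - apply Rlim_minus; now apply Rlim_mult.
  - apply Rlim_plus; now apply Rlim_mult.
Qed.

Lemma Clim_RtoC f a : Rlim f a -> Clim (fun t => RtoC (f t)) (RtoC a).
Proof. intros H. split; simpl; [auto | apply Rlim_const]. Qed.

Lemma Clim_cross f g a b : Clim f a -> Clim g b ->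
  Rlim (fun t => cross (f t) (g t)) (cross a b).
Proof.
  intros [H1 H2] [H3 H4]. unfold cross. apply Rlim_minus; now apply Rlim_mult.
Qed.

Lemma Clim_Cmod f a : Clim f a -> Rlim (fun t => Cmod (f t)) (Cmod a).
Proof.
  intros [H1 H2]. unfold Cmod. apply Rlim_sqrt.
  apply Rlim_plus; simpl; repeat apply Rlim_mult; auto; apply Rlim_const.
Qed.

Lemma Clim_neq f g a b : Clim f a -> Clim g b -> a <> b -> F (fun t => f t <> g t).
Proof.
  intros Hf Hg Hab.
  assert (Hm : Rlim (fun t => Cmod (f t - g t)) (Cmod (a - b))) by now apply Clim_Cmod, Clim_minus.
  assert (Hne : Cmod (a - b) <> 0).
  { intros E. apply Cmod_eq_0 in E. apply Hab.
    replace a with ((a - b) + b)%C by ring. rewrite E. ring. }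
  generalize (Rlim_neq0 _ _ Hm Hne). apply filter_imp. intros t Ht E. apply Ht.
  rewrite E. replace (g t - g t)%C with (RtoC 0) by ring. apply Cmod_0.
Qed.

End Limits.

(** * Unit directions, arguments and swept angles *)

Lemma Cdiv_RtoC (z : C) (r : R) : r <> 0 -> (z / RtoC r)%C = (Re z / r, Im z / r).
Proof.
  intros Hr. destruct z as [x y]. unfold Cdiv, Cinv, Cmult, RtoC; simpl.
  f_equal; field; nra.
Qed.

Lemma Cminus_neq0 p q : p <> q -> Cmod (q - p) <> 0.
Proof.
  intros H E. apply Cmod_eq_0 in E. apply H.
  replace q with ((q - p) + p)%C by ring. rewrite E. ring.
Qed.

Lemma Cmod_dir p q : p <> q -> Cmod (dir p q) = 1.
Proof.
  intros H. pose proof (Cminus_neq0 p q H) as Hm. unfold dir.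
  rewrite Cmod_div, Cmod_R, Rabs_pos_eq; [field; auto | apply Cmod_ge_0 | ].
  intros E. apply Hm. now apply RtoC_inj.
Qed.

Lemma dir_scale p q : p <> q -> (q - p)%C = (RtoC (Cmod (q - p)) * dir p q)%C.
Proof.
  intros H. pose proof (Cminus_neq0 p q H) as Hm. unfold dir. field.
  intros E. apply Hm. now apply RtoC_inj.
Qed.

Lemma Cmod_scale_pos (t : R) (z : C) : 0 <= t -> Cmod z = 1 -> Cmod (RtoC t * z) = t.
Proof. intros Ht Hz. rewrite Cmod_mult, Cmod_R, Hz, Rabs_pos_eq; lra. Qed.

Lemma dir_of_scale p q (t : R) (u : C) : 0 < t -> Cmod u = 1 ->
  (q - p)%C = (RtoC t * u)%C -> dir p q = u.
Proof.
  intros Ht Hu E. unfold dir. rewrite E, Cmod_scale_pos by lra.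
  field. intros E'. apply RtoC_inj in E'. lra.
Qed.

Lemma Clim_dir {T} {F : (T -> Prop) -> Prop} {FF : Filter F} f g a b :
  Clim (F := F) f a -> Clim (F := F) g b -> a <> b ->
  Clim (F := F) (fun t => dir (f t) (g t)) (dir a b).
Proof.
  intros Hf Hg Hab. pose proof (Cminus_neq0 a b Hab) as Hm.
  pose proof (Clim_minus _ _ _ _ Hg Hf) as Hgf.
  pose proof (Clim_Cmod _ _ Hgf) as HM. destruct Hgf as [H1 H2].
  apply (Clim_ext (fun t => (Re (g t - f t) / Cmod (g t - f t), Im (g t - f t) / Cmod (g t - f t)))).
  - generalize (Rlim_neq0 _ _ HM Hm). apply filter_imp. intros t Ht.
    unfold dir. now rewrite Cdiv_RtoC.
  - unfold dir. rewrite Cdiv_RtoC by auto. split; cbn [Re Im fst snd]; now apply Rlim_div.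
Qed.

Lemma C_ext (z w : C) : Re z = Re w -> Im z = Im w -> z = w.
Proof. destruct z, w; simpl; congruence. Qed.

Lemma cis_plus a b : cis (a + b) = (cis a * cis b)%C.
Proof. apply C_ext; simpl; [apply cos_plus | rewrite sin_plus; ring]. Qed.

Lemma Cmod_cis a : Cmod (cis a) = 1.
Proof.
  unfold Cmod, cis; simpl. transitivity (sqrt 1); [f_equal | apply sqrt_1].
  pose proof (sin2_cos2 a) as E. unfold Rsqr in E. lra.
Qed.

Lemma cis_neq0 a : cis a <> 0.
Proof. intros E. pose proof (Cmod_cis a) as H. rewrite E, Cmod_0 in H. lra. Qed.

Lemma cis_plus_PI a : cis (a + PI) = (- cis a)%C.
Proof. apply C_ext; simpl; [apply neg_cos | apply neg_sin]. Qed.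

Lemma cis_2PI a : cis (a + 2 * PI) = cis a.
Proof. replace (a + 2 * PI) with (a + PI + PI) by ring. rewrite !cis_plus_PI. ring. Qed.

Lemma cross_cis a b : cross (cis a) (cis b) = sin (b - a).
Proof. unfold cross, cis, Re, Im; simpl. rewrite sin_minus. ring. Qed.

Lemma cross_scale (s t : R) (u w : C) :
  cross (RtoC s * u)%C (RtoC t * w)%C = s * t * cross u w.
Proof. unfold cross, Re, Im; simpl. ring. Qed.

Lemma cross_rot (c u w : C) : cross (c * u)%C (c * w)%C = (Re c ^ 2 + Im c ^ 2) * cross u w.
Proof. unfold cross, Re, Im; simpl. ring. Qed.

Lemma Cmod_sqr_ReIm (z : C) : Cmod z * Cmod z = Re z * Re z + Im z * Im z.
Proof.
  unfold Cmod. rewrite sqrt_sqrt; [simpl; unfold Re, Im; ring|].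
  pose proof (pow2_ge_0 (fst z)). pose proof (pow2_ge_0 (snd z)). lra.
Qed.

Lemma Cmod_pos_of (z : C) : z <> 0 -> 0 < Cmod z.
Proof. apply (proj1 (Cmod_gt_0 z)). Qed.

Lemma Arg_polar (z : C) : z <> 0 ->
  Re z = Cmod z * cos (Arg z) /\ Im z = Cmod z * sin (Arg z).
Proof.
  intros Hz. pose proof (Cmod_pos_of z Hz) as Hm. pose proof (Cmod_sqr_ReIm z) as E.
  set (m := Cmod z) in *. set (x := Re z) in *. set (y := Im z) in *.
  assert (Hb : -1 <= x / m <= 1).
  { assert (- m <= x <= m) by (split; nra).
    split; [apply Rle_div_r | apply Rle_div_l]; lra. }
  assert (Hs : m * sqrt (1 - (x / m)²) = Rabs y).
  { rewrite <- (sqrt_square m) at 1 by lra. rewrite <- sqrt_mult_alt by nra.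
    replace (m * m * (1 - (x / m)²)) with (y²).
    - apply sqrt_Rsqr_abs.
    - unfold Rsqr. replace (m * m * (1 - x / m * (x / m))) with (m * m - x * x)
        by (field; lra). lra. }
  unfold Arg. fold x y m. destruct (Rle_dec 0 y) as [Hy|Hy].
  - rewrite cos_acos, sin_acos, Hs, Rabs_pos_eq by lra. split; [field; lra | auto].
  - rewrite cos_neg, sin_neg, cos_acos, sin_acos by lra.
    rewrite <- Ropp_mult_distr_r, Hs, Rabs_left by lra. split; [field; lra | ring].
Qed.

Lemma Arg_bounds (z : C) : - PI <= Arg z <= PI.
Proof.
  unfold Arg. pose proof (acos_bound (Re z / Cmod z)). pose proof PI_gt_3.
  destruct (Rle_dec 0 (Im z)); lra.
Qed.

Lemma Arg_Im_pos (z : C) : 0 < Im z -> 0 < Arg z < PI.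
Proof.
  intros Hz. assert (Hz0 : z <> 0) by (intros ->; simpl in Hz; lra).
  destruct (Arg_polar z Hz0) as [_ E]. pose proof (Cmod_pos_of z Hz0).
  assert (Hs : 0 < sin (Arg z)) by nra. pose proof (Arg_bounds z) as [H1 H2].
  split.
  - apply Rnot_le_lt. intros H0. destruct (Req_dec (Arg z) (- PI)) as [E1|E1].
    + rewrite E1, sin_neg, sin_PI in Hs. lra.
    + destruct (Req_dec (Arg z) 0) as [E2|E2]; [rewrite E2, sin_0 in Hs; lra|].
      pose proof (sin_lt_0_var (Arg z) ltac:(lra) ltac:(lra)). lra.
  - destruct H2 as [H2|H2]; auto. rewrite H2, sin_PI in Hs. lra.
Qed.

Lemma Arg_Im_neg (z : C) : Im z < 0 -> - PI < Arg z < 0.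
Proof.
  intros Hz. assert (Hz0 : z <> 0) by (intros ->; simpl in Hz; lra).
  destruct (Arg_polar z Hz0) as [_ E]. pose proof (Cmod_pos_of z Hz0).
  assert (Hs : sin (Arg z) < 0) by nra. pose proof (Arg_bounds z) as [H1 H2].
  split.
  - destruct H1 as [H1|H1]; auto. rewrite <- H1, sin_neg, sin_PI in Hs. lra.
  - apply Rnot_le_lt. intros H0. pose proof (sin_ge_0 (Arg z) H0 H2). lra.
Qed.

Lemma Arg_scale (r : R) (z : C) : 0 < r -> Arg (RtoC r * z) = Arg z.
Proof.
  intros Hr. unfold Arg. rewrite Cmod_mult, Cmod_R, Rabs_pos_eq by lra.
  replace (Re (RtoC r * z)) with (r * Re z) by (unfold Re; simpl; ring).
  replace (Im (RtoC r * z)) with (r * Im z) by (unfold Im; simpl; ring).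
  replace (r * Re z / (r * Cmod z)) with (Re z / Cmod z).
  2:{ unfold Rdiv. rewrite Rinv_mult.
      transitivity (r * / r * (Re z * / Cmod z)); [rewrite Rinv_r by lra|]; ring. }
  destruct (Rle_dec 0 (r * Im z)), (Rle_dec 0 (Im z)); auto; nra.
Qed.

Lemma Im_Cdiv (u w : C) : u <> 0 -> Im (w / u) = cross u w / (Cmod u * Cmod u).
Proof.
  intros Hu. pose proof (Cmod_pos_of u Hu). rewrite Cmod_sqr_ReIm.
  pose proof (Cmod_sqr_ReIm u). destruct u as [a b], w as [c d]; simpl in *.
  unfold cross; simpl. field. nra.
Qed.

Lemma Re_Cdiv (u w : C) : u <> 0 ->
  Re (w / u) = (Re u * Re w + Im u * Im w) / (Cmod u * Cmod u).
Proof.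
  intros Hu. pose proof (Cmod_pos_of u Hu). rewrite Cmod_sqr_ReIm.
  pose proof (Cmod_sqr_ReIm u). destruct u as [a b], w as [c d]; simpl in *.
  field. nra.
Qed.

Lemma cross_neq0_l (u w : C) : cross u w <> 0 -> u <> 0.
Proof. intros H E. apply H. rewrite E. unfold cross; simpl. ring. Qed.

Lemma swept_angle_lt_PI (u w : C) : 0 < cross u w -> swept_angle u w < PI.
Proof.
  intros H. assert (Hu : u <> 0) by (apply (cross_neq0_l u w); lra).
  pose proof (Cmod_pos_of u Hu).
  assert (Hi : 0 < Im (w / u)) by (rewrite Im_Cdiv by auto; apply Rdiv_lt_0_compat; nra).
  pose proof (Arg_Im_pos _ Hi). unfold swept_angle, signed_angle.
  destruct (Rlt_dec (Arg (w / u)) 0); lra.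
Qed.

Lemma swept_angle_gt_PI (u w : C) : cross u w < 0 -> PI < swept_angle u w.
Proof.
  intros H. assert (Hu : u <> 0) by (apply (cross_neq0_l u w); lra).
  pose proof (Cmod_pos_of u Hu).
  assert (Hi : Im (w / u) < 0).
  { rewrite Im_Cdiv by auto. assert (0 < / (Cmod u * Cmod u)) by (apply Rinv_0_lt_compat; nra).
    unfold Rdiv. nra. }
  pose proof (Arg_Im_neg _ Hi). unfold swept_angle, signed_angle.
  destruct (Rlt_dec (Arg (w / u)) 0); lra.
Qed.

(** * Radii and reference points *)

Definition p7 : R := PI / 7.

Fixpoint rad (i : nat) : R :=
  match i with O => 1 | S j => rad j * (sin (theta j) / sin (ang (S j))) end.

Lemma p7_bounds : 3 / 7 < p7 < 22 / 49.
Proof. unfold p7. pose proof PI_gt_3. pose proof PI_lt_22_7. lra. Qed.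

Lemma theta_ang i : theta i = 6 * p7 - ang (S i).
Proof. unfold theta, p7. simpl. field. Qed.

Lemma sin_theta i : sin (theta i) = sin (p7 + ang (S i)).
Proof.
  rewrite theta_ang. replace (6 * p7 - ang (S i)) with (PI - (p7 + ang (S i)))
    by (unfold p7; field). apply sin_PI_x.
Qed.

Lemma sin_ang_pos i : 0 < sin (ang i).
Proof. pose proof (ang_range i). pose proof PI_gt_3. apply sin_gt_0; lra. Qed.

Lemma ang_neq_PI2 i : ang i <> PI / 2.
Proof.
  intros E. apply (sin_ang_shift i 21). rewrite E.
  replace (PI / 2 + 21 * (PI / 42)) with PI by (simpl; field). apply sin_PI.
Qed.

Lemma theta_case i :
  (PI / 2 < ang i /\ theta i = PI - ang i) \/
  (5 * PI / 14 <= ang i < PI / 2 /\ cos (theta i) = / 2 - cos (ang i) /\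
   0 < cos (theta i) /\ 0 < theta i < PI).
Proof.
  pose proof (ang_range i). pose proof (ang_neq_PI2 i). pose proof PI_gt_3.
  unfold theta, deflect. destruct (Rlt_dec (PI / 2) (ang i)); [now left|right].
  pose proof (cos_bounds_PI3_PI2 (ang i) ltac:(lra)).
  pose proof (acos_bound_lt (/ 2 - cos (ang i)) ltac:(lra)).
  rewrite cos_acos by lra. lra.
Qed.

Lemma theta_bounds i : 0 < theta i < PI.
Proof.
  destruct (theta_case i) as [[H1 H2]|H]; [|lra].
  pose proof (ang_range i). lra.
Qed.

Lemma sin_theta_pos i : 0 < sin (theta i).
Proof. apply sin_gt_0; apply theta_bounds. Qed.

Lemma rad_pos i : 0 < rad i.
Proof.
  induction i as [|i IH]; cbn [rad]; [lra|].
  apply Rmult_lt_0_compat; auto.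
  apply Rdiv_lt_0_compat; [apply sin_theta_pos | apply sin_ang_pos].
Qed.

(** By [ang_range], the angle of the triangle O v_i v_(i+1) at v_i is at most PI / 2, so v_(i+1)
    projects to the ray O v_i no farther out than v_i. *)
Lemma rad_step_le i : rad (S i) * cos p7 <= rad i.
Proof.
  pose proof (rad_pos i). pose proof (sin_ang_pos (S i)) as Hs.
  pose proof (ang_range (S i)). pose proof p7_bounds. pose proof PI_gt_3.
  cbn [rad]. rewrite sin_theta.
  assert (Hc : cos (p7 + ang (S i)) <= 0) by (apply cos_le_0; unfold p7 in *; lra).
  assert (sin (p7 + ang (S i)) * cos p7 <= sin (ang (S i))).
  { rewrite cos_plus in Hc. rewrite sin_plus.
    pose proof (sin2_cos2 p7) as E. unfold Rsqr in E.
    assert (0 < sin p7) by (apply sin_gt_0; lra). nra. }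
  assert (sin (p7 + ang (S i)) / sin (ang (S i)) * cos p7 <= 1).
  { replace (sin (p7 + ang (S i)) / sin (ang (S i)) * cos p7)
      with (sin (p7 + ang (S i)) * cos p7 / sin (ang (S i))) by (field; lra).
    apply Rle_div_l; lra. }
  nra.
Qed.

(** Now the angle at v_(i+1) is obtuse, and v_i projects to the ray O v_(i+1) beyond v_(i+1). *)
Lemma rad_step_le_ext i : PI / 2 < ang (S i) -> rad (S i) <= rad i * cos p7.
Proof.
  intros HA. pose proof (rad_pos i). pose proof (sin_ang_pos (S i)) as Hs.
  pose proof (ang_range (S i)). pose proof p7_bounds. pose proof PI_gt_3.
  cbn [rad]. rewrite sin_theta, sin_plus.
  assert (cos (ang (S i)) < 0) by (apply cos_lt_0; lra).
  assert (0 < sin p7) by (apply sin_gt_0; lra).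
  apply Rmult_le_compat_l; [lra|]. apply Rle_div_l; nra.
Qed.

(* [H 1 = (xout, yout)], and [rfermat] is the distance from the origin to the Fermat point
   of a triangle with base [H (-1)], [H 1] and third vertex on the axis. *)
Definition xout : R := Rout * cos p7.
Definition yout : R := Rout * sin p7.
Definition rfermat : R := xout - yout * sqrt 3 / 3.

Lemma Rout_eq : Rout * sin (p7 + a0) = sin a0.
Proof.
  unfold Rout, p7. replace (alpha0 / 2) with a0 by (unfold alpha0, a0; field).
  assert (0 < sin (PI / 7 + a0)).
  { pose proof PI_gt_3. pose proof PI_lt_22_7. apply sin_gt_0; unfold a0; lra. }
  field. lra.
Qed.

Lemma sin_p7_a0_pos : 0 < sin (p7 + a0).
Proof.
  pose proof PI_gt_3. pose proof PI_lt_22_7. apply sin_gt_0; unfold p7, a0; lra.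
Qed.

Lemma sin_a0_pos : 0 < sin a0.
Proof. apply (sin_ang_pos 0). Qed.

Lemma cos_a0_neg : cos a0 < 0.
Proof. pose proof PI_gt_3. pose proof PI_lt_22_7. apply cos_lt_0; unfold a0; lra. Qed.

Lemma Rout_pos : 0 < Rout.
Proof. pose proof Rout_eq. pose proof sin_p7_a0_pos. pose proof sin_a0_pos. nra. Qed.

Lemma cos_p7_pos : 0 < cos p7.
Proof. pose proof p7_bounds. pose proof PI_gt_3. apply cos_gt_0; lra. Qed.

Lemma sin_p7_pos : 0 < sin p7.
Proof. pose proof p7_bounds. pose proof PI_gt_3. apply sin_gt_0; lra. Qed.

Lemma xout_pos : 0 < xout.
Proof. apply Rmult_lt_0_compat; [apply Rout_pos | apply cos_p7_pos]. Qed.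

Lemma yout_pos : 0 < yout.
Proof. apply Rmult_lt_0_compat; [apply Rout_pos | apply sin_p7_pos]. Qed.

(* That is, xout + yout cot a0 = 1: the inner circle has radius 1. *)
Lemma xout_minus_1 : (xout - 1) * sin a0 = - yout * cos a0.
Proof.
  pose proof Rout_eq as E. rewrite sin_plus in E. unfold xout, yout. nra.
Qed.

Lemma sqrt3_facts : sqrt 3 * sqrt 3 = 3 /\ 0 < sqrt 3 < 2.
Proof.
  assert (sqrt 3 * sqrt 3 = 3) by (apply sqrt_sqrt; lra).
  pose proof (sqrt_lt_R0 3 ltac:(lra)). split; auto. nra.
Qed.

(* Amounts to PI < 22/7: the angle alpha0 exceeds 240 degrees. *)
Lemma one_le_rfermat : 1 <= rfermat.
Proof.
  pose proof PI_gt_3. pose proof PI_lt_22_7. pose proof sqrt3_facts as [S3 S3b].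
  assert (Hs : sin (a0 + PI / 3) <= 0).
  { replace (a0 + PI / 3) with ((a0 - 2 * (PI / 3)) + PI) by field.
    rewrite neg_sin. assert (0 <= sin (a0 - 2 * (PI / 3))) by (apply sin_ge_0; unfold a0; lra). lra. }
  rewrite sin_plus, sin_PI3, cos_PI3 in Hs.
  pose proof xout_minus_1 as E. pose proof sin_a0_pos. pose proof yout_pos.
  assert (0 <= (rfermat - 1) * sin a0); [|nra].
  unfold rfermat. replace ((xout - yout * sqrt 3 / 3 - 1) * sin a0)
    with ((xout - 1) * sin a0 - yout * sqrt 3 / 3 * sin a0) by ring.
  rewrite E.
  replace (- yout * cos a0 - yout * sqrt 3 / 3 * sin a0)
    with (yout * (2 * sqrt 3 / 3) * (- (sin a0 * (1 / 2) + cos a0 * (sqrt 3 / 2)))).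
  2:{ transitivity (- yout * cos a0 * (sqrt 3 * sqrt 3 / 3) - yout * sqrt 3 / 3 * sin a0); [field|].
      rewrite S3. field. }
  apply Rmult_le_pos; [|lra]. apply Rmult_le_pos; lra.
Qed.

(** The room needed for two uses of [rad_step_le] between even layers. It reduces to sqrt 3 sin p7
    cos p7 < 1, true since sin (2 p7) <= 1 and sqrt 3 < 2. *)
Lemma rfermat_lt : rfermat < xout * (cos p7 * cos p7).
Proof.
  pose proof sqrt3_facts as [S3 S3b]. pose proof cos_p7_pos. pose proof sin_p7_pos.
  pose proof Rout_pos. pose proof (sin2_cos2 p7) as E. unfold Rsqr in E.
  unfold rfermat, xout, yout.
  assert (Hk : sin p7 * cos p7 * sqrt 3 < 1).
  { pose proof (SIN_bound (2 * p7)) as [_ Hb]. rewrite sin_2a in Hb.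
    assert (0 < sin p7 * cos p7) by (apply Rmult_lt_0_compat; lra). nra. }
  assert (Hk2 : cos p7 - sin p7 * sqrt 3 / 3 < cos p7 * (cos p7 * cos p7)).
  { assert (cos p7 * (sin p7 * sin p7) < sin p7 * sqrt 3 / 3); [|nra].
    assert (0 < sin p7 * sqrt 3 / 3) by (assert (0 < sin p7 * sqrt 3) by (apply Rmult_lt_0_compat; lra); lra).
    assert (cos p7 * (sin p7 * sin p7) = (sin p7 * cos p7 * sqrt 3) * (sin p7 * sqrt 3 / 3)).
    { transitivity (cos p7 * (sin p7 * sin p7) * (sqrt 3 * sqrt 3) / 3); [rewrite S3; field | field]. }
    nra. }
  nra.
Qed.

Lemma xout_lt_Rout : xout < Rout.
Proof.
  unfold xout. pose proof Rout_pos. pose proof sin_p7_pos. pose proof cos_p7_pos.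
  pose proof (sin2_cos2 p7) as E. unfold Rsqr in E.
  assert (cos p7 < 1) by nra. nra.
Qed.

(** Distance from O to the even reference points: the height sqrt 3 [yout] of the equilateral
    triangle is added to the distance [xout] of its base. *)
Definition rapex : R := xout + sqrt 3 * yout.

Lemma H_odd i : Z.odd i = true -> H i = (RtoC Rout * cis (IZR i * p7))%C.
Proof.
  intros E. unfold H. rewrite E. do 2 f_equal. unfold p7. field.
Qed.

Lemma H_even i : Z.odd i = false -> H i = (RtoC rapex * cis (IZR i * p7))%C.
Proof.
  intros E. unfold H. rewrite E. f_equal; [|f_equal; unfold p7; field].
  f_equal. fold p7. rewrite sin_plus, sin_PI6, cos_PI6. unfold rapex, xout, yout. field.
Qed.

Lemma H_minus1 : H (-1) = (xout, - yout).
Proof.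
  rewrite H_odd by reflexivity. replace (IZR (-1) * p7) with (- p7) by ring.
  apply C_ext; unfold cis, Re, Im; simpl; rewrite cos_neg, sin_neg; unfold xout, yout; ring.
Qed.

Lemma H_1 : H 1 = (xout, yout).
Proof.
  rewrite H_odd by reflexivity. replace (IZR 1 * p7) with p7 by ring.
  apply C_ext; unfold cis, Re, Im; simpl; unfold xout, yout; ring.
Qed.

Lemma H_0 : H 0 = (rapex, 0).
Proof.
  rewrite H_even by reflexivity. replace (IZR 0 * p7) with 0 by ring.
  apply C_ext; unfold cis, Re, Im; simpl; rewrite cos_0, sin_0; ring.
Qed.

Lemma rho_cis : rho = cis (2 * p7).
Proof. unfold rho, p7. f_equal. field. Qed.

Lemma rho_H i : (rho * H i)%C = H (i + 2).
Proof.
  destruct (Z.odd i) eqn:E.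
  - rewrite !H_odd by (rewrite ?Z.odd_add, ?E; reflexivity).
    rewrite rho_cis, plus_IZR, Rmult_plus_distr_r, Rplus_comm, cis_plus. ring.
  - rewrite !H_even by (rewrite ?Z.odd_add, ?E; reflexivity).
    rewrite rho_cis, plus_IZR, Rmult_plus_distr_r, Rplus_comm, cis_plus. ring.
Qed.

Lemma xout_lt_rapex : xout < rapex.
Proof.
  unfold rapex. pose proof yout_pos. pose proof sqrt3_facts.
  assert (0 < sqrt 3 * yout) by (apply Rmult_lt_0_compat; lra). lra.
Qed.

(* The last equation is the circle of points from which H (-1) and H 1 are seen under the
   angle 2 PI - alpha0. *)
Lemma v0_equations phi v : is_v0 phi v ->
  Re v < xout /\ Im v * cos phi = - (rapex - Re v) * sin phi /\
  ((xout - Re v) * sin a0 + yout * cos a0) * (yout * sin a0 - cos a0 * (xout - Re v)) =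
    sin a0 * cos a0 * Im v ^ 2.
Proof.
  intros [[t [Ht Ev]] [Hs Ha]]. pose proof yout_pos. pose proof xout_pos.
  rewrite H_0 in Ev. unfold same_side in Hs. unfold angle, signed_angle in Ha.
  rewrite H_minus1, H_1 in Hs, Ha. destruct v as [x y]. cbn [Re Im fst snd].
  assert (Hx : x < xout).
  { unfold cross, Re, Im in Hs; simpl in Hs.
    assert (0 < (yout * xout) * (4 * yout * (xout - x))) by nra.
    assert (0 < 4 * yout * (xout - x)) by (assert (0 < yout * xout) by nra; nra). nra. }
  repeat split; auto.
  - unfold cis in Ev. apply (f_equal fst) in Ev as Ex. apply (f_equal snd) in Ev as Ey.
    simpl in Ex, Ey. rewrite Ex, Ey. ring.
  - set (u := ((xout, (- yout)%R) - (x, y))%C) in *. set (w := ((xout, yout) - (x, y))%C) in *.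
    assert (Ec : cross u w = 2 * yout * (xout - x)) by (unfold u, w, cross, Re, Im; simpl; ring).
    assert (Ed : Re u * Re w + Im u * Im w = (xout - x) ^ 2 + y ^ 2 - yout ^ 2)
      by (unfold u, w, Re, Im; simpl; ring).
    assert (Hc : 0 < cross u w) by (rewrite Ec; nra).
    assert (Hu : u <> 0) by (apply (cross_neq0_l u w); lra).
    pose proof (Cmod_pos_of u Hu) as Hm.
    assert (Hi : 0 < Im (w / u)) by (rewrite Im_Cdiv by auto; apply Rdiv_lt_0_compat; nra).
    pose proof (Arg_Im_pos _ Hi) as Hap. rewrite Rabs_pos_eq in Ha by lra.
    assert (Hz : (w / u)%C <> 0) by (intros E; rewrite E in Hi; simpl in Hi; lra).
    destruct (Arg_polar _ Hz) as [E1 E2].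
    rewrite Ha in E1, E2. rewrite Re_Cdiv in E1 by auto. rewrite Im_Cdiv in E2 by auto.
    assert (Eq : (Re u * Re w + Im u * Im w) * sin (2 * PI - alpha0)
      = cross u w * cos (2 * PI - alpha0)).
    { assert (Hm2 : Cmod u * Cmod u <> 0) by nra.
      replace (Re u * Re w + Im u * Im w)
        with (Cmod (w / u) * cos (2 * PI - alpha0) * (Cmod u * Cmod u))
        by (rewrite <- E1; field; lra).
      replace (cross u w) with (Cmod (w / u) * sin (2 * PI - alpha0) * (Cmod u * Cmod u))
        by (rewrite <- E2; field; lra).
      ring. }
    rewrite Ed, Ec in Eq.
    replace (2 * PI - alpha0) with (- (2 * a0) + 2 * PI) in Eq
      by (unfold alpha0, a0; field).
    rewrite sin_plus, cos_plus, sin_2PI, cos_2PI, sin_neg, cos_neg, sin_2a, cos_2a in Eq.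
    set (s := sin a0) in *. set (c := cos a0) in *. nra.
Qed.

(** * Limit of the initial vertex *)

Lemma near_phi n : Rlim (F := near n) (fun t => fst t) 0.
Proof.
  apply filterlim_locally. intros e. exists e. split; [apply cond_pos|].
  intros phi Hphi G _. simpl. unfold ball; simpl. unfold AbsRing_ball, abs, minus, plus, opp; simpl.
  rewrite Ropp_0, Rplus_0_r. apply Rabs_def1; lra.
Qed.

Lemma near_v0 n : near n (fun t => is_v0 (fst t) (vtx (snd t) 0)).
Proof. generalize (near_is_star n). apply filter_imp. intros t [Ht _]. exact Ht. Qed.

(** By [xout_minus_1] the first factor in the circle equation is (1 - Re v) sin a0, and the second
    is at least [yout * sin a0]. So Re v - 1 is nonnegative and quadratically small in Im v, and the
    equations need not be solved for v. *)
Lemma v0_Re_bounds phi v : is_v0 phi v ->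
  1 <= Re v < xout /\ Re v - 1 <= - cos a0 / (yout * sin a0) * Im v ^ 2.
Proof.
  intros Hv. destruct (v0_equations phi v Hv) as [Hx [_ E]].
  pose proof yout_pos. pose proof sin_a0_pos as Hs. pose proof cos_a0_neg as Hc.
  pose proof xout_minus_1 as EQ.
  set (s := sin a0) in *. set (c := cos a0) in *. set (x := Re v) in *. set (y := Im v) in *.
  assert (Hy : 0 <= y ^ 2) by apply pow2_ge_0.
  assert (HPs : 0 < yout * s) by nra.
  assert (Hk : yout * s <= yout * s - c * (xout - x)) by nra.
  replace ((xout - x) * s + yout * c) with ((1 - x) * s) in E by nra.
  assert (E' : (x - 1) * s * (yout * s - c * (xout - x)) = s * (- c) * y ^ 2) by nra.
  assert (E2 : (x - 1) * (yout * s - c * (xout - x)) = - c * y ^ 2) by nra.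
  assert (Hx1 : 0 <= x - 1) by nra.
  repeat split; try lra.
  replace (- c / (yout * s) * y ^ 2) with (- c * y ^ 2 / (yout * s)) by (field; nra).
  apply Rle_div_r; [lra|]. nra.
Qed.

Lemma v0_limit n : Clim (F := near n) (fun t => vtx (snd t) 0) 1.
Proof.
  assert (Hy : Rlim (F := near n) (fun t => Im (vtx (snd t) 0)) 0).
  { apply (Rlim_0_le _ (fun t => rapex * Rabs (sin (fst t) / cos (fst t)))).
    - replace 0 with (rapex * Rabs (sin 0 / cos 0)).
      2:{ rewrite sin_0, cos_0. unfold Rdiv. rewrite Rmult_0_l, Rabs_R0. ring. }
      apply Rlim_mult; [apply Rlim_const|].
      apply (Rlim_comp Rabs); [|apply continuous_Rabs].
      apply Rlim_div; [| | rewrite cos_0; lra].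
      + apply (Rlim_comp sin); [apply near_phi|]. apply continuity_pt_filterlim, continuity_sin.
      + apply (Rlim_comp cos); [apply near_phi|]. apply continuity_pt_filterlim, continuity_cos.
    - assert (Hc : near n (fun t => 0 < cos (fst t))).
      { apply (Rlim_gt _ (cos 0)); [|rewrite cos_0; lra].
        apply (Rlim_comp cos); [apply near_phi|]. apply continuity_pt_filterlim, continuity_cos. }
      generalize (filter_and _ _ Hc (near_v0 n)). apply filter_imp.
      intros t [Ht Hv]. destruct (v0_equations _ _ Hv) as [Hx [E _]].
      destruct (v0_Re_bounds _ _ Hv) as [Hb _]. pose proof xout_lt_rapex.
      replace (Im (vtx (snd t) 0)) with ((- (rapex - Re (vtx (snd t) 0))) * (sin (fst t) / cos (fst t))).
      2:{ transitivity (- (rapex - Re (vtx (snd t) 0)) * sin (fst t) / cos (fst t)); [field; lra|].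
          rewrite <- E. field. lra. }
      rewrite Rabs_mult, Rabs_Ropp, (Rabs_pos_eq (rapex - _)) by lra.
      apply Rmult_le_compat_r; [apply Rabs_pos | lra]. }
  split; [|exact Hy]. replace (Re 1) with (0 + 1) by (simpl; ring).
  apply (Rlim_ext (fun t => (Re (vtx (snd t) 0) - 1) + 1)).
  { apply filter_forall. intros; ring. }
  apply Rlim_plus; [|apply Rlim_const].
  apply (Rlim_0_le _ (fun t => - cos a0 / (yout * sin a0) * (Im (vtx (snd t) 0) * Im (vtx (snd t) 0)))).
  - replace 0 with (- cos a0 / (yout * sin a0) * (0 * 0)) by ring.
    apply Rlim_mult; [apply Rlim_const | now apply Rlim_mult].
  - generalize (near_v0 n). apply filter_imp. intros t Hv.
    destruct (v0_Re_bounds _ _ Hv) as [Hb1 Hb2].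
    rewrite Rabs_pos_eq by lra. simpl in Hb2. rewrite Rmult_1_r in Hb2. exact Hb2.
Qed.

(** * Convergence of vertices, incoming edges and wings *)

Definition half_shift (t : R) : C := (- / 2, t).

Definition polar (i : nat) : R := INR i * p7.

Lemma polar_S i : polar (S i) = polar i + p7.
Proof. unfold polar. rewrite S_INR. ring. Qed.

(** The induction invariant. Directions are carried along with positions, since wings are built from
    directions; the last clause keeps [dir] from dividing by zero. *)
Definition tracked (n i : nat) : Prop :=
  Clim (F := near n) (fun t => vtx (snd t) i) (RtoC (rad i) * cis (polar i))%C /\
  Clim (F := near n) (fun t => dir (vtx (snd t) i) (vprev (snd t) i))
    (cis (polar i + PI + ang i)) /\
  Clim (F := near n) (fun t => dir (vtx (snd t) i) (rho * vprev (snd t) i)%C)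
    (cis (polar i + PI - ang i)) /\
  near n (fun t => vtx (snd t) i <> vprev (snd t) i /\
    vtx (snd t) i <> (rho * vprev (snd t) i)%C).

Lemma dir_1_H1 : dir 1 (xout, yout) = cis (PI - a0) /\ dir 1 (xout, - yout) = cis (PI + a0).
Proof.
  pose proof yout_pos. pose proof sin_a0_pos. pose proof xout_minus_1 as E.
  assert (Hk : 0 < yout / sin a0) by (apply Rdiv_lt_0_compat; lra).
  assert (EQ : xout - 1 = yout / sin a0 * - cos a0).
  { apply Rmult_eq_reg_r with (sin a0); [|lra]. rewrite E. field. lra. }
  split; apply (dir_of_scale _ _ (yout / sin a0)); auto using Cmod_cis; apply C_ext;
    unfold half_shift, cis, Re, Im; simpl.
  - replace (PI - a0) with (- a0 + PI) by ring. rewrite neg_cos, cos_neg. lra.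
  - replace (PI - a0) with (- a0 + PI) by ring. rewrite neg_sin, sin_neg. field. lra.
  - rewrite Rplus_comm, (Rplus_comm PI), neg_cos. lra.
  - rewrite (Rplus_comm PI), neg_sin. field. lra.
Qed.

Lemma tracked_0 n : tracked n 0.
Proof.
  pose proof (v0_limit n) as HL. pose proof yout_pos as HP. pose proof dir_1_H1 as [D1 D2].
  assert (Hr : (rho * H (-1))%C = (xout, yout)) by (rewrite rho_H; exact H_1).
  assert (N1 : RtoC 1 <> (xout, yout)) by (intros E; apply (f_equal snd) in E; simpl in E; lra).
  assert (N2 : RtoC 1 <> (xout, - yout)) by (intros E; apply (f_equal snd) in E; simpl in E; lra).
  assert (Ep : polar 0 = 0) by (unfold polar; simpl; ring).
  unfold tracked. cbn [vprev rad ang]. rewrite Ep, Hr, H_minus1.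
  replace (0 + PI + a0) with (PI + a0) by ring. replace (0 + PI - a0) with (PI - a0) by ring.
  rewrite <- D1, <- D2.
  split; [|split; [|split]].
  - replace (1 * cis 0)%C with (RtoC 1); auto.
    apply C_ext; unfold half_shift, cis, Re, Im; simpl; rewrite cos_0, sin_0; ring.
  - apply Clim_dir; auto. apply Clim_const.
  - apply Clim_dir; auto. apply Clim_const.
  - apply filter_and; apply (Clim_neq _ _ _ _ HL (Clim_const _)); auto.
Qed.

Lemma near_star_step n i : (i < n)%nat -> near n (fun t => star_step (snd t) i).
Proof. intros Hi. generalize (near_is_star n). apply filter_imp. intros t [_ Ht]. auto. Qed.

Lemma sin_double_ang i : (PI / 2 < ang i -> sin (2 * ang i) < 0) /\
  (ang i < PI / 2 -> 0 < sin (2 * ang i)).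
Proof.
  pose proof (ang_range i). pose proof PI_gt_3. split; intros.
  - apply sin_lt_0; lra.
  - apply sin_gt_0; lra.
Qed.

(** The cross product of the incoming directions tends to sin (2 ang i), which is nonzero; its sign
    fixes the branch for all small phi. *)
Lemma interior_angle_near n i : tracked n i ->
  (PI / 2 < ang i -> near n (fun t => PI < interior_angle (snd t) i)) /\
  (ang i < PI / 2 -> near n (fun t => interior_angle (snd t) i < PI)).
Proof.
  intros (_ & L2 & L3 & L4).
  pose proof (Clim_cross _ _ _ _ L3 L2) as HX. rewrite cross_cis in HX.
  replace (polar i + PI + ang i - (polar i + PI - ang i)) with (2 * ang i) in HX by ring.
  destruct (sin_double_ang i) as [S1 S2].
  assert (Hc : forall v a b : C, v <> a -> v <> b -> exists k, 0 < k /\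
    cross (a - v) (b - v) = k * cross (dir v a) (dir v b)).
  { intros v a b Ha Hb. exists (Cmod (a - v) * Cmod (b - v)). split.
    - apply Rmult_lt_0_compat; [pose proof (Cmod_ge_0 (a - v)); pose proof (Cminus_neq0 v a Ha)
        | pose proof (Cmod_ge_0 (b - v)); pose proof (Cminus_neq0 v b Hb)]; lra.
    - rewrite (dir_scale v a Ha), (dir_scale v b Hb) at 1. apply cross_scale. }
  split; intros Ha.
  - generalize (filter_and _ _ L4 (Rlim_lt _ _ 0 HX (S1 Ha))). apply filter_imp.
    intros t [[N1 N2] Ht]. apply swept_angle_gt_PI.
    destruct (Hc _ _ _ N2 N1) as [k [Hk ->]]. nra.
  - generalize (filter_and _ _ L4 (Rlim_gt _ _ 0 HX (S2 Ha))). apply filter_imp.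
    intros t [[N1 N2] Ht]. apply swept_angle_lt_PI.
    destruct (Hc _ _ _ N2 N1) as [k [Hk ->]]. nra.
Qed.

Lemma near_extended n i : (i < n)%nat -> tracked n i -> PI / 2 < ang i ->
  near n (fun t => extended_wings (snd t) i).
Proof.
  intros Hi Ht Ha. generalize (filter_and _ _ (near_star_step n i Hi)
    (proj1 (interior_angle_near n i Ht) Ha)).
  apply filter_imp. intros t [[[[_ Hs]|[Hs _]] _] HI]; [auto | lra].
Qed.

Lemma near_balancing n i : (i < n)%nat -> tracked n i -> ang i < PI / 2 ->
  near n (fun t => balancing_wings (snd t) i /\ (Nat.Even i ->
     is_fermat_point (H (Z.of_nat i - 1)) (vtx (snd t) i) (H (Z.of_nat i + 1))
       (fermat (snd t) i))).
Proof.
  intros Hi Ht Ha. generalize (filter_and _ _ (near_star_step n i Hi)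
    (proj2 (interior_angle_near n i Ht) Ha)).
  apply filter_imp. intros t [[[[Hs _]|[_ Hs]] _] HI]; [lra | auto].
Qed.

Lemma refpt_polar i : exists k : R, xout < k /\ refpt i = (RtoC k * cis (polar i))%C /\
  (Nat.Even i -> k = rapex) /\ (Nat.Odd i -> k = Rout).
Proof.
  pose proof xout_lt_rapex. pose proof xout_lt_Rout. unfold refpt, polar.
  destruct (Z.odd (Z.of_nat i)) eqn:E.
  - exists Rout. rewrite H_odd by auto. rewrite INR_IZR_INZ.
    apply Z.odd_spec in E. destruct E as [m E]. repeat split; auto.
    intros [k Hk]. lia.
  - exists rapex. rewrite H_even by auto. rewrite INR_IZR_INZ.
    repeat split; auto. intros [k Hk].
    assert (Z.odd (Z.of_nat i) = true); [|congruence].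
    apply Z.odd_spec. exists (Z.of_nat k). lia.
Qed.

(** Inside these radii the suspension points outward. For even i the bound is the distance of the
    line H_(i-1) H_(i+1), smaller than that of H_i, because it also fixes the orientation of the
    triangle of the Fermat point. *)
Definition within (i : nat) : Prop :=
  (Nat.Even i -> rad i < xout) /\ (Nat.Odd i -> rad i < Rout).

Lemma suspension_dir_limit n i : tracked n i -> within i ->
  Clim (F := near n) (fun t => dir (vtx (snd t) i) (refpt i)) (cis (polar i)) /\
  near n (fun t => vtx (snd t) i <> refpt i).
Proof.
  intros (L1 & _) [W1 W2]. destruct (refpt_polar i) as (k & HQk & E & K1 & K2).
  assert (Hk : rad i < k).
  { destruct (Nat.Even_or_Odd i) as [Hp|Hp]; [specialize (W1 Hp); lra|].
    rewrite (K2 Hp). auto. }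
  assert (ED : dir (RtoC (rad i) * cis (polar i)) (refpt i) = cis (polar i)).
  { apply (dir_of_scale _ _ (k - rad i)); [lra | apply Cmod_cis|].
    rewrite E, RtoC_minus. ring. }
  assert (Hn : (RtoC (rad i) * cis (polar i))%C <> refpt i).
  { rewrite E. intros E'. pose proof (f_equal Cmod E') as Em. pose proof (rad_pos i).
    pose proof xout_pos.
    rewrite !Cmod_scale_pos in Em by (lra || apply Cmod_cis). lra. }
  split; [|apply (Clim_neq _ _ _ _ L1 (Clim_const _)); auto].
  rewrite <- ED. apply Clim_dir; auto. apply Clim_const.
Qed.

(** Two unit vectors with sum -I are -I/2 plus and minus a multiple k of iI, with k^2 = 1/|I|^2 -
    1/4; the positive scalar product of s and I makes the sides of s determine the sign of k. This
    exhibits the wings as continuous functions of the imbalance. *)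
Lemma balancing_solve (I s wp wm : C) :
  0 < Cmod I -> Cmod wp = 1 -> Cmod wm = 1 -> (I + wp + wm)%C = 0 ->
  0 < cross s wp -> cross s wm < 0 -> 0 < Re s * Re I + Im s * Im I ->
  let tau := sqrt (/ (Re I * Re I + Im I * Im I) - / 4) in
  wp = (half_shift tau * I)%C /\ wm = (half_shift (- tau) * I)%C.
Proof.
  intros HI H1 H2 H3 H4 H5 H6 tau.
  pose proof (Cmod_sqr_ReIm I) as EI. pose proof (Cmod_sqr_ReIm wp) as E1.
  pose proof (Cmod_sqr_ReIm wm) as E2. rewrite H1 in E1. rewrite H2 in E2.
  assert (HN : 0 < Re I * Re I + Im I * Im I) by nra.
  destruct I as [I1 I2], s as [s1 s2], wp as [x1 y1], wm as [x2 y2].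
  apply (f_equal fst) in H3 as Ea. apply (f_equal snd) in H3 as Eb.
  unfold cross in *. cbn [Re Im fst snd] in *. simpl in Ea, Eb.
  assert (Ex : x2 = - I1 - x1) by lra. assert (Ey : y2 = - I2 - y1) by lra.
  subst x2 y2. clear H3 Ea Eb.
  set (N := I1 * I1 + I2 * I2) in *.
  set (X := x1 + I1 / 2). set (Y := y1 + I2 / 2).
  assert (EO : X * I1 + Y * I2 = 0) by (unfold X, Y; nra).
  assert (EN : X * X + Y * Y = 1 - N / 4) by (unfold X, Y, N in *; nra).
  set (k := (I1 * Y - I2 * X) / N).
  assert (EX : X = - k * I2).
  { unfold k. apply Rmult_eq_reg_r with N; [|lra]. field_simplify; [|lra]. unfold N.
    transitivity (X * I1 * I1 + X * I2 * I2); [ring|].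
    replace (X * I1) with (- (Y * I2)) by lra. ring. }
  assert (EY : Y = k * I1).
  { unfold k. apply Rmult_eq_reg_r with N; [|lra]. field_simplify; [|lra]. unfold N.
    transitivity (Y * I2 * I2 + Y * I1 * I1); [ring|].
    replace (Y * I2) with (- (X * I1)) by lra. ring. }
  assert (Hk : 0 < k).
  { assert (0 < s1 * Y - s2 * X) by (unfold X, Y; lra).
    rewrite EX, EY in H. nra. }
  assert (Hkk : k * k = / N - / 4).
  { apply Rmult_eq_reg_r with N; [|lra].
    rewrite EX, EY in EN. replace ((/ N - / 4) * N) with (1 - N / 4) by (field; lra).
    rewrite <- EN. unfold N. ring. }
  assert (Et : tau = k).
  { unfold tau. rewrite <- Hkk. apply sqrt_square. lra. }
  rewrite Et. unfold X, Y in EX, EY. split; apply C_ext; unfold Re, Im; simpl; lra.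
Qed.

Definition wings_tracked (n i : nat) : Prop :=
  Clim (F := near n) (fun t => wing_ccw (snd t) i) (cis (polar i + PI - theta i)) /\
  Clim (F := near n) (fun t => wing_cw (snd t) i) (cis (polar i + PI + theta i)) /\
  near n (fun t => Cmod (wing_ccw (snd t) i) = 1 /\ Cmod (wing_cw (snd t) i) = 1).

Lemma wings_extended n i : (i < n)%nat -> tracked n i -> PI / 2 < ang i -> wings_tracked n i.
Proof.
  intros Hi Ht Ha. pose proof (near_extended n i Hi Ht Ha) as HE.
  destruct Ht as (_ & L2 & L3 & L4).
  destruct (theta_case i) as [[_ Eth]|Hc]; [|lra].
  split; [|split].
  - apply (Clim_ext (fun t => - dir (vtx (snd t) i) (vprev (snd t) i))%C).
    + revert HE. apply filter_imp. now intros t [-> _].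
    + replace (polar i + PI - theta i) with (polar i + ang i) by (rewrite Eth; ring).
      replace (cis (polar i + ang i)) with (- cis (polar i + PI + ang i))%C.
      * now apply Clim_opp.
      * replace (polar i + PI + ang i) with (polar i + ang i + PI) by ring.
        rewrite cis_plus_PI. ring.
  - apply (Clim_ext (fun t => - dir (vtx (snd t) i) (rho * vprev (snd t) i))%C).
    + revert HE. apply filter_imp. now intros t [_ ->].
    + replace (polar i + PI + theta i) with (polar i + PI - ang i + PI) by (rewrite Eth; ring).
      rewrite cis_plus_PI. now apply Clim_opp.
  - generalize (filter_and _ _ HE L4). apply filter_imp. intros t [[-> ->] [N1 N2]].
    rewrite !Cmod_opp, !Cmod_dir; auto.
Qed.

Lemma wings_balancing n i : (i < n)%nat -> tracked n i -> within i -> ang i < PI / 2 ->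
  wings_tracked n i.
Proof.
  intros Hi Ht Hw Ha. pose proof (near_balancing n i Hi Ht Ha) as HB.
  destruct (suspension_dir_limit n i Ht Hw) as [LS _].
  destruct Ht as (_ & L2 & L3 & L4).
  destruct (theta_case i) as [[? _]|(_ & Ec & Hc & Hth)]; [lra|].
  assert (LI : Clim (F := near n) (fun t => imbalance (snd t) i)
    (RtoC (2 * cos (theta i)) * cis (polar i))%C).
  { replace (RtoC (2 * cos (theta i)) * cis (polar i))%C
      with (cis (polar i) + cis (polar i + PI + ang i) + cis (polar i + PI - ang i))%C.
    - unfold imbalance. apply Clim_plus; [apply Clim_plus; [exact LS | exact L2] | exact L3].
    - replace (polar i + PI + ang i) with (polar i + ang i + PI) by ring.
      replace (polar i + PI - ang i) with (polar i - ang i + PI) by ring.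
      rewrite !cis_plus_PI, Ec.
      apply C_ext; unfold half_shift, cis, Re, Im; simpl; rewrite ?cos_plus, ?cos_minus, ?sin_plus, ?sin_minus; field. }
  pose proof (sin2_cos2 (polar i)) as E1. unfold Rsqr in E1.
  pose proof (sin2_cos2 (theta i)) as E2. unfold Rsqr in E2.
  assert (Hs : 0 < sin (theta i)) by (apply sin_gt_0; lra).
  destruct LS as [LS1 LS2]. pose proof LI as [LI1 LI2].
  assert (Hdot : near n (fun t => 0 < Re (dir (vtx (snd t) i) (refpt i)) * Re (imbalance (snd t) i)
    + Im (dir (vtx (snd t) i) (refpt i)) * Im (imbalance (snd t) i))).
  { eapply Rlim_gt; [apply Rlim_plus; apply Rlim_mult; eauto|].
    unfold half_shift, cis, Re, Im; simpl. nra. }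
  set (tau := fun t : R * star => sqrt (/ (Re (imbalance (snd t) i) * Re (imbalance (snd t) i)
    + Im (imbalance (snd t) i) * Im (imbalance (snd t) i)) - / 4)).
  assert (HS : near n (fun t => wing_ccw (snd t) i = (half_shift (tau t) * imbalance (snd t) i)%C /\
    wing_cw (snd t) i = (half_shift (- tau t) * imbalance (snd t) i)%C)).
  { generalize (filter_and _ _ HB Hdot). apply filter_imp.
    intros t [[(B1 & B2 & B3 & B4 & B5 & B6) _] rapex].
    apply (balancing_solve _ (dir (vtx (snd t) i) (refpt i))); auto; tauto. }
  assert (Lt : Rlim (F := near n) tau (sin (theta i) / (2 * cos (theta i)))).
  { replace (sin (theta i) / (2 * cos (theta i))) with
     (sqrt (/ (Re (RtoC (2 * cos (theta i)) * cis (polar i)) * Re (RtoC (2 * cos (theta i)) * cis (polar i))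
      + Im (RtoC (2 * cos (theta i)) * cis (polar i)) * Im (RtoC (2 * cos (theta i)) * cis (polar i))) - / 4)).
    - apply Rlim_sqrt, Rlim_minus; [|apply Rlim_const].
      apply Rlim_inv; [apply Rlim_plus; now apply Rlim_mult|].
      unfold half_shift, cis, Re, Im; simpl. nra.
    - apply sqrt_lem_1.
      + unfold half_shift, cis, Re, Im; simpl.
        replace (_ + _) with (4 * (cos (theta i) * cos (theta i)) * (sin (polar i) * sin (polar i) + cos (polar i) * cos (polar i))) by ring.
        rewrite E1, Rmult_1_r.
        assert (cos (theta i) * cos (theta i) <= 1) by nra.
        assert (/ 4 <= / (4 * (cos (theta i) * cos (theta i)))); [|lra].
        apply Rinv_le_contravar; nra.
      + apply Rlt_le, Rdiv_lt_0_compat; lra.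
      + unfold half_shift, cis, Re, Im; simpl.
        replace (_ + _) with (4 * (cos (theta i) * cos (theta i)) * (sin (polar i) * sin (polar i) + cos (polar i) * cos (polar i))) by ring.
        rewrite E1, Rmult_1_r.
        replace (sin (theta i) / (2 * cos (theta i)) * (sin (theta i) / (2 * cos (theta i))))
          with ((sin (theta i) * sin (theta i)) / (4 * (cos (theta i) * cos (theta i)))) by (field; lra).
        replace (sin (theta i) * sin (theta i)) with (1 - cos (theta i) * cos (theta i)) by lra.
        field. lra. }
  assert (Lm : forall c : R, Clim (F := near n) (fun t => half_shift (c * tau t))
    (half_shift (c * (sin (theta i) / (2 * cos (theta i)))))).
  { intros c. split; unfold half_shift; cbn [Re Im fst snd]; [apply Rlim_const|].
    apply Rlim_mult; [apply Rlim_const | auto]. }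
  split; [|split].
  - apply (Clim_ext (fun t => (half_shift (1 * tau t) * imbalance (snd t) i)%C)).
    + revert HS. apply filter_imp. intros t [-> _]. now rewrite Rmult_1_l.
    + replace (cis (polar i + PI - theta i)) with
        (half_shift (1 * (sin (theta i) / (2 * cos (theta i)))) * (RtoC (2 * cos (theta i)) * cis (polar i)))%C.
      * apply Clim_mult; auto.
      * replace (polar i + PI - theta i) with (polar i - theta i + PI) by ring.
        rewrite cis_plus_PI.
        apply C_ext; unfold half_shift, cis, Re, Im; simpl; rewrite ?cos_minus, ?sin_minus; field; lra.
  - apply (Clim_ext (fun t => (half_shift (-1 * tau t) * imbalance (snd t) i)%C)).
    + revert HS. apply filter_imp. intros t [_ ->]. do 2 f_equal. ring.
    + replace (cis (polar i + PI + theta i)) with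
        (half_shift (-1 * (sin (theta i) / (2 * cos (theta i)))) * (RtoC (2 * cos (theta i)) * cis (polar i)))%C.
      * apply Clim_mult; auto.
      * replace (polar i + PI + theta i) with (polar i + theta i + PI) by ring.
        rewrite cis_plus_PI.
        apply C_ext; unfold half_shift, cis, Re, Im; simpl; rewrite ?cos_plus, ?sin_plus; field; lra.
  - revert HB. apply filter_imp. intros t [(_ & B2 & B3 & _) _]. auto.
Qed.

Definition edge_len (i : nat) : R := rad i * (sin p7 / sin (ang (S i))).

Lemma edge_len_pos i : 0 < edge_len i.
Proof.
  pose proof (rad_pos i). pose proof sin_p7_pos. pose proof (sin_ang_pos (S i)).
  apply Rmult_lt_0_compat; auto. now apply Rdiv_lt_0_compat.
Qed.

Lemma ang_S_theta i : p7 + theta i = PI - ang (S i).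
Proof. rewrite theta_ang. unfold p7. field. Qed.

(* Law of sines in the triangle O v_i v_(i+1). *)
Lemma rad_S_cis i :
  (RtoC (rad i) * cis (polar i) + RtoC (edge_len i) * cis (polar i + PI - theta i))%C
  = (RtoC (rad (S i)) * cis (polar (S i)))%C.
Proof.
  pose proof (sin_ang_pos (S i)) as Hs. rewrite polar_S.
  replace (polar i + PI - theta i) with (polar i - theta i + PI) by ring.
  rewrite cis_plus_PI. unfold edge_len. cbn [rad].
  set (b := ang (S i)) in *.
  assert (Es : sin b = sin (p7 + theta i)).
  { rewrite ang_S_theta. fold b. symmetry. apply sin_PI_x. }
  rewrite sin_plus in Es.
  replace (polar i - theta i) with (polar i + - theta i) by ring.
  rewrite !cis_plus.
  transitivity (RtoC (rad i / sin b) * cis (polar i) * (RtoC (sin b) - RtoC (sin p7) * cis (- theta i)))%C.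
  - apply C_ext; unfold cis, Re, Im; simpl; field; lra.
  - transitivity (RtoC (rad i / sin b) * cis (polar i) * (RtoC (sin (theta i)) * cis p7))%C.
    + f_equal. rewrite Es. apply C_ext; unfold cis, Re, Im; simpl; rewrite cos_neg, sin_neg; ring.
    + apply C_ext; unfold cis, Re, Im; simpl; field; lra.
Qed.

Lemma sin_double_neq0 i : sin (2 * ang i) <> 0.
Proof.
  destruct (sin_double_ang i) as [S1 S2].
  destruct (Rtotal_order (ang i) (PI / 2)) as [h|[h|h]].
  - specialize (S2 h). lra.
  - now destruct (ang_neq_PI2 i).
  - specialize (S1 h). lra.
Qed.

Lemma near_next n i : (i < n)%nat -> tracked n i -> wings_tracked n i ->
  exists s s' : R * star -> R,
    Rlim (F := near n) s (edge_len i) /\ Rlim (F := near n) s' (edge_len i) /\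
    near n (fun t =>
      vtx (snd t) (S i) = (vtx (snd t) i + RtoC (s t) * wing_ccw (snd t) i)%C /\
      vtx (snd t) (S i) = (rho * vtx (snd t) i + RtoC (s' t) * (rho * wing_cw (snd t) i))%C).
Proof.
  intros Hi (L1 & _) (W1 & W2 & _).
  set (d := fun t : R * star => (rho * vtx (snd t) i - vtx (snd t) i)%C).
  set (D := fun t : R * star => cross (wing_ccw (snd t) i) (rho * wing_cw (snd t) i)).
  pose proof (Clim_mult _ _ _ _ (Clim_const (F := near n) rho) W2) as W3.
  pose proof (Clim_minus _ _ _ _ (Clim_mult _ _ _ _ (Clim_const (F := near n) rho) L1) L1) as Ld.
  assert (LD : Rlim (F := near n) D (sin (2 * (p7 + theta i)))).
  { replace (sin (2 * (p7 + theta i)))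
      with (cross (cis (polar i + PI - theta i)) (rho * cis (polar i + PI + theta i)))
      by (rewrite rho_cis, <- cis_plus, cross_cis; f_equal; ring).
    exact (Clim_cross _ _ _ _ W1 W3). }
  assert (HD : sin (2 * (p7 + theta i)) <> 0).
  { rewrite ang_S_theta. pose proof (sin_double_neq0 (S i)) as rapex.
    replace (2 * (PI - ang (S i))) with (- (2 * ang (S i)) + 2 * PI) by ring.
    rewrite sin_plus, sin_2PI, cos_2PI, sin_neg. lra. }
  pose proof (sin_ang_pos (S i)) as Hsa.
  assert (Esa : sin (p7 + theta i) = sin (ang (S i))) by (rewrite ang_S_theta; apply sin_PI_x).
  assert (HK : 2 * sin (p7 + theta i) * cos (p7 + theta i) <> 0) by (now rewrite <- sin_2a).
  assert (Hcs : cos (p7 + theta i) <> 0) by (intros E; apply HK; rewrite E; ring).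
  (* Cramer's rule for the intersection of the two rays; the determinant D tends to - sin (2 ang (S
     i)), which is not 0. *)
  exists (fun t => cross (d t) (rho * wing_cw (snd t) i) / D t),
    (fun t => cross (d t) (wing_ccw (snd t) i) / D t).
  split; [|split].
  - replace (edge_len i) with
      (cross (rho * (RtoC (rad i) * cis (polar i)) - RtoC (rad i) * cis (polar i))
        (rho * cis (polar i + PI + theta i)) / sin (2 * (p7 + theta i))).
    + apply Rlim_div; [now apply Clim_cross | exact LD | exact HD].
    + rewrite sin_2a, rho_cis, <- cis_plus.
      replace (cross _ _) with (rad i * (2 * cos (p7 + theta i) * sin p7)).
      * unfold edge_len. rewrite <- Esa. field. rewrite Esa. lra.
      * transitivity (rad i * (sin (2 * p7 + (polar i + PI + theta i) - (2 * p7 + polar i))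
          - sin (2 * p7 + (polar i + PI + theta i) - polar i))).
        -- replace (2 * p7 + (polar i + PI + theta i) - (2 * p7 + polar i)) with (theta i + PI) by ring.
           replace (2 * p7 + (polar i + PI + theta i) - polar i) with ((p7 + theta i) + p7 + PI) by ring.
           rewrite !neg_sin. replace (theta i) with ((p7 + theta i) - p7) at 2 by ring.
           rewrite (sin_minus (p7 + theta i) p7), (sin_plus (p7 + theta i) p7). ring.
        -- rewrite <- !cross_cis, (cis_plus (2 * p7) (polar i)).
           unfold cross, Re, Im; simpl; ring.
  - replace (edge_len i) with
      (cross (rho * (RtoC (rad i) * cis (polar i)) - RtoC (rad i) * cis (polar i))
        (cis (polar i + PI - theta i)) / sin (2 * (p7 + theta i))).
    + apply Rlim_div; [now apply Clim_cross | exact LD | exact HD].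
    + rewrite sin_2a, rho_cis.
      replace (cross _ _) with (rad i * (2 * cos (p7 + theta i) * sin p7)).
      * unfold edge_len. rewrite <- Esa. field. rewrite Esa. lra.
      * transitivity (rad i * (sin ((polar i + PI - theta i) - (2 * p7 + polar i))
          - sin ((polar i + PI - theta i) - polar i))).
        -- replace ((polar i + PI - theta i) - (2 * p7 + polar i)) with (- ((p7 + theta i) + p7) + PI) by ring.
           replace ((polar i + PI - theta i) - polar i) with (- theta i + PI) by ring.
           rewrite !neg_sin, !sin_neg. replace (theta i) with ((p7 + theta i) - p7) at 3 by ring.
           rewrite (sin_minus (p7 + theta i) p7), (sin_plus (p7 + theta i) p7). ring.
        -- rewrite <- !cross_cis, (cis_plus (2 * p7) (polar i)).
           unfold cross, Re, Im; simpl; ring.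
  - generalize (filter_and _ _ (near_star_step n i Hi) (Rlim_neq0 _ _ LD HD)).
    apply filter_imp. intros t [[_ Hz] HDt].
    destruct (proj2 (Hz (vtx (snd t) (S i))) eq_refl) as [[x [_ Ex]] [y [_ Ey]]].
    fold (D t) in HDt. unfold d, D in *.
    set (v := vtx (snd t) i) in *. set (w := wing_ccw (snd t) i) in *.
    set (w' := (rho * wing_cw (snd t) i)%C) in *.
    set (v' := (rho * v)%C) in *. set (z := vtx (snd t) (S i)) in *.
    assert (Exy : (v' - v)%C = (RtoC x * w - RtoC y * w')%C).
    { replace v' with (z - RtoC y * w')%C by (rewrite Ey; ring).
      replace v with (z - RtoC x * w)%C by (rewrite Ex; ring). ring. }
    rewrite Exy. split.
    + replace (cross (RtoC x * w - RtoC y * w') w' / cross w w') with x; auto.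
      replace (cross (RtoC x * w - RtoC y * w') w') with (x * cross w w')
        by (unfold cross, Re, Im; simpl; ring). field; auto.
    + replace (cross (RtoC x * w - RtoC y * w') w / cross w w') with y; auto.
      replace (cross (RtoC x * w - RtoC y * w') w) with (y * cross w w')
        by (unfold cross, Re, Im; simpl; ring). field; auto.
Qed.

Lemma near_next_dir n i : (i < n)%nat -> tracked n i -> wings_tracked n i ->
  near n (fun t =>
    dir (vtx (snd t) (S i)) (vtx (snd t) i) = (- wing_ccw (snd t) i)%C /\
    dir (vtx (snd t) (S i)) (rho * vtx (snd t) i)%C = (- (rho * wing_cw (snd t) i))%C /\
    vtx (snd t) (S i) <> vtx (snd t) i /\ vtx (snd t) (S i) <> (rho * vtx (snd t) i)%C).
Proof.
  intros Hi Ht Hw. destruct (near_next n i Hi Ht Hw) as (s & s' & L1 & L2 & HE).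
  destruct Hw as (_ & _ & HN). pose proof (edge_len_pos i) as Hl.
  generalize (filter_and _ _ (filter_and _ _ HN HE)
    (filter_and _ _ (Rlim_gt _ _ 0 L1 Hl) (Rlim_gt _ _ 0 L2 Hl))).
  apply filter_imp. intros t [[[N1 N2] [E1 E2]] [P1 P2]].
  assert (N3 : Cmod (rho * wing_cw (snd t) i) = 1)
    by (rewrite Cmod_mult, N2, rho_cis, Cmod_cis; ring).
  assert (D1 : dir (vtx (snd t) (S i)) (vtx (snd t) i) = (- wing_ccw (snd t) i)%C).
  { apply (dir_of_scale _ _ (s t)); auto; [now rewrite Cmod_opp | rewrite E1; ring]. }
  assert (D2 : dir (vtx (snd t) (S i)) (rho * vtx (snd t) i)%C = (- (rho * wing_cw (snd t) i))%C).
  { apply (dir_of_scale _ _ (s' t)); auto; [now rewrite Cmod_opp | rewrite E2; ring]. }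
  assert (Hne : forall (z v w : C) r, 0 < r -> Cmod w = 1 -> z = (v + RtoC r * w)%C -> z <> v).
  { intros z v w r Hr Hw Ez E. assert (Z : (RtoC r * w)%C = 0).
    { replace (RtoC r * w)%C with (z - v)%C by (rewrite Ez; ring). rewrite E. ring. }
    apply (f_equal Cmod) in Z. rewrite Cmod_scale_pos, Cmod_0 in Z by lra. lra. }
  split; [exact D1|]. split; [exact D2|]. split.
  - exact (Hne _ _ _ _ P1 N1 E1).
  - exact (Hne _ _ _ _ P2 N3 E2).
Qed.

Lemma tracked_S n i : (i < n)%nat -> tracked n i -> wings_tracked n i -> tracked n (S i).
Proof.
  intros Hi Ht Hw. pose proof (near_next_dir n i Hi Ht Hw) as HD.
  destruct (near_next n i Hi Ht Hw) as (s & s' & L & _ & HE).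
  destruct Ht as (L1 & _). destruct Hw as (W1 & W2 & _).
  pose proof (ang_S_theta i) as Eth. pose proof (polar_S i) as Ep.
  assert (E7 : PI = 7 * p7) by (unfold p7; field).
  split; [|split; [|split]]; cbn [vprev].
  - rewrite <- rad_S_cis.
    apply (Clim_ext (fun t => vtx (snd t) i + RtoC (s t) * wing_ccw (snd t) i)%C).
    + revert HE. apply filter_imp. now intros t [-> _].
    + apply Clim_plus; auto. apply Clim_mult; auto. now apply Clim_RtoC.
  - apply (Clim_ext (fun t => - wing_ccw (snd t) i)%C).
    + revert HD. apply filter_imp. now intros t [-> _].
    + replace (cis (polar (S i) + PI + ang (S i))) with (- cis (polar i + PI - theta i))%C;
        [now apply Clim_opp|].
      rewrite <- cis_plus_PI. replace (polar (S i) + PI + ang (S i)) with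
        (polar i + PI - theta i + PI) by lra. reflexivity.
  - apply (Clim_ext (fun t => - (rho * wing_cw (snd t) i))%C).
    + revert HD. apply filter_imp. now intros t [_ [-> _]].
    + replace (cis (polar (S i) + PI - ang (S i))) with (- (rho * cis (polar i + PI + theta i)))%C.
      * apply Clim_opp, Clim_mult; auto. apply Clim_const.
      * rewrite rho_cis, <- cis_plus, <- cis_plus_PI.
        rewrite <- (cis_2PI (polar (S i) + PI - ang (S i))). f_equal. lra.
  - revert HD. apply filter_imp. now intros t [_ [_ ?]].
Qed.

(** These are equalities for every small phi and not only in the limit: such edges stay parallel
    under perturbation and cannot be separated by transversality. *)
Lemma near_extension_dir n i : (i < n)%nat -> tracked n i -> PI / 2 < ang i ->
  near n (fun t =>
    dir (vtx (snd t) (S i)) (vtx (snd t) i) = dir (vtx (snd t) i) (vprev (snd t) i) /\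
    dir (vtx (snd t) (S i)) (rho * vtx (snd t) i)%C =
      (rho * dir (vtx (snd t) i) (rho * vprev (snd t) i))%C).
Proof.
  intros Hi Ht Ha.
  generalize (filter_and _ _ (near_extended n i Hi Ht Ha)
    (near_next_dir n i Hi Ht (wings_extended n i Hi Ht Ha))).
  apply filter_imp. intros t [[E1 E2] [D1 [D2 _]]]. rewrite D1, D2, E1, E2.
  split; ring.
Qed.

(** * Fermat points and the bound on the radii *)

Definition kap : R := sqrt 3 / 2.
Definition zeta : C := (- / 2, kap).
Definition zetab : C := (- / 2, - kap).

Lemma kap_facts : kap * kap = 3 / 4 /\ 0 < kap.
Proof. unfold kap. pose proof sqrt3_facts. split; nra. Qed.

Lemma zeta_zetab : (zeta * zetab)%C = 1.
Proof. pose proof kap_facts. apply C_ext; unfold zeta, zetab, Re, Im; simpl; nra. Qed.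

Lemma cos_2PI3 : cos (2 * PI / 3) = - / 2.
Proof.
  replace (2 * PI / 3) with (- (PI / 3) + PI) by field.
  rewrite neg_cos, cos_neg, cos_PI3. field.
Qed.

Lemma sin_2PI3 : sin (2 * PI / 3) = kap.
Proof.
  replace (2 * PI / 3) with (- (PI / 3) + PI) by field.
  rewrite neg_sin, sin_neg, sin_PI3. unfold kap. field.
Qed.

Lemma Arg_ratio_120 (u w : C) : Rabs (Arg (w / u)) = 2 * PI / 3 ->
  u <> 0 /\ exists m, 0 < m /\ (w = (RtoC m * zeta * u)%C \/ w = (RtoC m * zetab * u)%C).
Proof.
  intros E. pose proof PI_gt_3.
  assert (Hz : (w / u)%C <> 0).
  { intros Z. rewrite Z in E. unfold Arg in E. simpl in E. rewrite Cmod_0 in E.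
    destruct (Rle_dec 0 0); [|lra]. unfold Rdiv in E at 1.
    rewrite Rmult_0_l, acos_0, Rabs_pos_eq in E; lra. }
  assert (Hu : u <> 0).
  { intros ->. apply Hz. apply C_ext; unfold Cdiv, Cinv, Re, Im; simpl; unfold Rdiv; ring. }
  split; auto. exists (Cmod (w / u)). split; [now apply Cmod_pos_of|].
  destruct (Arg_polar _ Hz) as [E1 E2].
  assert (Ew : w = (w / u * u)%C) by (field; auto).
  assert (HA : Arg (w / u) = 2 * PI / 3 \/ Arg (w / u) = - (2 * PI / 3)).
  { unfold Rabs in E. destruct (Rcase_abs (Arg (w / u))); [right|left]; lra. }
  destruct HA as [HA|HA]; rewrite HA in E1, E2; [left|right]; rewrite Ew at 1; f_equal;
    apply C_ext; rewrite ?cos_neg, ?sin_neg, cos_2PI3 in *; rewrite ?sin_neg, sin_2PI3 in *;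
    rewrite ?E1, ?E2; unfold zeta, zetab, Re, Im; simpl; ring.
Qed.

Lemma cis_PI3 : cis (PI / 3) = (- zetab)%C /\ cis (- (PI / 3)) = (- zeta)%C.
Proof.
  split; apply C_ext; unfold zeta, zetab, kap, cis, Re, Im; simpl;
    rewrite ?cos_neg, ?sin_neg, ?cos_PI3, ?sin_PI3; field.
Qed.

Lemma no_positive_fixed_rotation (A : C) (k y : R) : A <> 0 -> 0 < k -> y <> 0 ->
  A = (RtoC k * ((- / 2)%R, y) * A)%C -> False.
Proof.
  intros HA Hk Hy E.
  assert (Hn : (RtoC k * ((- / 2)%R, y) - 1)%C <> 0).
  { intros Z. apply (f_equal snd) in Z. simpl in Z. nra. }
  apply (Cmult_neq_0 _ _ Hn HA).
  replace ((RtoC k * ((- / 2)%R, y) - 1) * A)%C with (RtoC k * ((- / 2)%R, y) * A - A)%C by ring.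
  rewrite <- E. ring.
Qed.

(* S points from the Fermat point f away from b. *)
Definition fermat_tripod (a b c f S : C) (r s t : R) : Prop :=
  Cmod S = 1 /\ 0 < r /\ 0 < s /\ 0 < t /\ b = (f - RtoC r * S)%C /\
  a = (f + RtoC s * (cis (- (PI / 3)) * S))%C /\ c = (f + RtoC t * (cis (PI / 3) * S))%C.

(** Each unsigned angle of 120 degrees is a rotation by [zeta] or [zetab] up to a positive factor.
    Opposite rotations in the first two angles would put a and c in the same direction from f,
    against the third angle; of the two equal choices, the orientation leaves only [zetab]. *)
Lemma fermat_point_tripod (a b c f : C) : is_fermat_point a b c f ->
  0 < cross (c - a) (b - a) -> exists S r s t, fermat_tripod a b c f S r s t.
Proof.
  intros (_ & F1 & F2 & F3) Hor. unfold angle, signed_angle in *.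
  set (A := (a - f)%C) in *. set (B := (b - f)%C) in *. set (D := (c - f)%C) in *.
  destruct (Arg_ratio_120 _ _ F1) as [HA [m1 [Hm1 E1]]].
  destruct (Arg_ratio_120 _ _ F2) as [HB [m2 [Hm2 E2]]].
  destruct (Arg_ratio_120 _ _ F3) as [HD [m3 [Hm3 E3]]].
  pose proof kap_facts as [K1 K2]. pose proof zeta_zetab as ZZ.
  assert (ZZ' : (zetab * zeta)%C = 1) by (rewrite Cmult_comm; exact ZZ).
  replace (c - a)%C with (D - A)%C in Hor by (unfold D, A; ring).
  replace (b - a)%C with (B - A)%C in Hor by (unfold B, A; ring).
  assert (Hmix : D = (RtoC (m1 * m2) * A)%C -> False).
  { intros ED. assert (Hp : 0 < m3 * (m1 * m2)) by (repeat apply Rmult_lt_0_compat; auto).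
    destruct E3 as [E3|E3]; rewrite ED in E3.
    - apply (no_positive_fixed_rotation A (m3 * (m1 * m2)) kap); auto; [lra|].
      rewrite E3 at 1. unfold zeta. rewrite (RtoC_mult m3). ring.
    - apply (no_positive_fixed_rotation A (m3 * (m1 * m2)) (- kap)); auto; [lra|].
      rewrite E3 at 1. unfold zetab. rewrite (RtoC_mult m3). ring. }
  destruct E1 as [E1|E1], E2 as [E2|E2].
  - exfalso. rewrite E2, E1 in Hor.
    replace (RtoC m2 * zeta * (RtoC m1 * zeta * A) - A)%C
      with ((RtoC m2 * zeta * (RtoC m1 * zeta) - 1) * A)%C in Hor by ring.
    replace (RtoC m1 * zeta * A - A)%C with ((RtoC m1 * zeta - 1) * A)%C in Hor by ring.
    rewrite (Cmult_comm _ A), (Cmult_comm (RtoC m1 * zeta - 1) A), cross_rot in Hor.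
    assert (HN : 0 <= Re A ^ 2 + Im A ^ 2).
    { pose proof (pow2_ge_0 (Re A)). pose proof (pow2_ge_0 (Im A)). lra. }
    assert (Hx : cross (RtoC m2 * zeta * (RtoC m1 * zeta) - 1) (RtoC m1 * zeta - 1)
      = - kap * (m1 * m1 * m2 * (1 / 4 + kap * kap) + m1 + m1 * m2)).
    { unfold cross, zeta, Re, Im; simpl. field. }
    rewrite Hx in Hor.
    set (G := m1 * m1 * m2 * (1 / 4 + kap * kap) + m1 + m1 * m2) in *.
    assert (HG : 0 < G).
    { unfold G. rewrite K1. assert (0 < m1 * m2) by nra. assert (0 < m1 * (m1 * m2)) by nra. nra. }
    assert (0 <= (Re A ^ 2 + Im A ^ 2) * (kap * G)) by (apply Rmult_le_pos; nra).
    lra.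
  - exfalso. apply Hmix. rewrite E2, E1.
    replace (RtoC m2 * zetab * (RtoC m1 * zeta * A))%C
      with (RtoC m1 * RtoC m2 * (zetab * zeta) * A)%C by ring. rewrite ZZ', RtoC_mult. ring.
  - exfalso. apply Hmix. rewrite E2, E1.
    replace (RtoC m2 * zeta * (RtoC m1 * zetab * A))%C
      with (RtoC m1 * RtoC m2 * (zeta * zetab) * A)%C by ring. rewrite ZZ, RtoC_mult. ring.
  - pose proof (Cmod_pos_of B HB) as Hr.
    assert (Hr0 : RtoC (Cmod B) <> 0) by (intros E; apply RtoC_inj in E; lra).
    assert (Hm0 : RtoC m1 <> 0) by (intros E; apply RtoC_inj in E; lra).
    exists (- (B / RtoC (Cmod B)))%C, (Cmod B), (Cmod B / m1), (m2 * Cmod B).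
    destruct cis_PI3 as [C1 C2].
    unfold fermat_tripod. rewrite C1, C2. repeat split; auto.
    + rewrite Cmod_opp, Cmod_div, Cmod_R, Rabs_pos_eq by (auto || lra). field. lra.
    + now apply Rdiv_lt_0_compat.
    + nra.
    + transitivity (f + B)%C; [unfold B; ring | field; auto].
    + transitivity (f + A)%C; [unfold A; ring | f_equal].
      rewrite RtoC_div by lra.
      transitivity (zeta * B / RtoC m1)%C; [|field; auto].
      rewrite E1. transitivity (zeta * zetab * A)%C; [rewrite ZZ; ring | field; auto].
    + transitivity (f + D)%C; [unfold D; ring | f_equal].
      rewrite E2, RtoC_mult. field; auto.
Qed.

(** The inequality says that the angle at b is less than 120 degrees. The scalar product is r^2 + (r
    s + r t)/2 - s t/2, and s, t are smaller than the sides at b. *)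
Lemma tripod_angle_condition a b c f S r s t : fermat_tripod a b c f S r s t ->
  0 < Re (a - b) * Re (c - b) + Im (a - b) * Im (c - b) + / 2 * (Cmod (a - b) * Cmod (c - b)).
Proof.
  intros (HS & Hr & Hs & Ht & Eb & Ea & Ec). destruct cis_PI3 as [C1 C2].
  pose proof kap_facts as [K1 K2].
  assert (E1 : (a - b)%C = ((RtoC r - RtoC s * zeta) * S)%C)
    by (rewrite Ea, Eb, C2; ring).
  assert (E2 : (c - b)%C = ((RtoC r - RtoC t * zetab) * S)%C)
    by (rewrite Ec, Eb, C1; ring).
  assert (HS2 : Re S * Re S + Im S * Im S = 1) by (rewrite <- Cmod_sqr_ReIm, HS; ring).
  assert (M1 : s < Cmod (a - b)).
  { apply Rsqr_incrst_0; [|lra | apply Cmod_ge_0]. unfold Rsqr. rewrite Cmod_sqr_ReIm, E1.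
    destruct S as [x y]. unfold zeta, Re, Im in *; simpl in *.
    replace (_ + _) with ((r * r + r * s + s * s * (1 / 4 + kap * kap)) * (x * x + y * y)) by field.
    rewrite HS2, K1. nra. }
  assert (M2 : t < Cmod (c - b)).
  { apply Rsqr_incrst_0; [|lra | apply Cmod_ge_0]. unfold Rsqr. rewrite Cmod_sqr_ReIm, E2.
    destruct S as [x y]. unfold zetab, Re, Im in *; simpl in *.
    replace (_ + _) with ((r * r + r * t + t * t * (1 / 4 + kap * kap)) * (x * x + y * y)) by field.
    rewrite HS2, K1. nra. }
  assert (ED : Re (a - b) * Re (c - b) + Im (a - b) * Im (c - b)
     = r * r + (r * s + r * t) / 2 - s * t / 2).
  { rewrite E1, E2. destruct S as [x y]. unfold zeta, zetab, Re, Im in *; simpl in *.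
    transitivity ((r * r + (r * s + r * t) / 2 + s * t * (1 / 4 - kap * kap)) * (x * x + y * y)).
    - field.
    - rewrite HS2, K1. field. }
  rewrite ED. assert (s * t < Cmod (a - b) * Cmod (c - b)) by nra.
  assert (0 < r * s) by nra. assert (0 < r * t) by nra. nra.
Qed.

(** Torricelli's construction: the line from b through the Fermat point meets the apex of the
    equilateral triangle on a c, at distance r + s + t. With [H_apex], all three edges at the Fermat
    point follow the suspension direction of v_i. *)
Lemma tripod_apex a b c f S r s t : fermat_tripod a b c f S r s t ->
  dir b (a + (c - a) * cis (- (PI / 3)))%C = S.
Proof.
  intros (HS & Hr & Hs & Ht & Eb & Ea & Ec).
  apply (dir_of_scale _ _ (r + s + t)); auto; [lra|].
  rewrite Ea, Eb, Ec. destruct cis_PI3 as [-> ->]. pose proof kap_facts as [K1 K2].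
  transitivity ((RtoC r - RtoC s * zeta * (1 + zeta) + RtoC t * (zeta * zetab)) * S)%C; [ring|].
  rewrite zeta_zetab. f_equal. rewrite !RtoC_plus.
  replace (zeta * (1 + zeta))%C with (- (1))%C.
  - replace (RtoC s * zeta * (1 + zeta))%C with (RtoC s * (zeta * (1 + zeta)))%C by ring.
    replace (zeta * (1 + zeta))%C with (- (1))%C; [ring|].
    apply C_ext; unfold zeta, Re, Im; simpl; nra.
  - apply C_ext; unfold zeta, Re, Im; simpl; nra.
Qed.

Lemma H_neighbours i : Nat.Even i ->
  H (Z.of_nat i - 1) = (cis (polar i) * (xout, (- yout)%R))%C /\
  H (Z.of_nat i + 1) = (cis (polar i) * (xout, yout))%C /\
  refpt i = (RtoC rapex * cis (polar i))%C.
Proof.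
  intros [m Em].
  assert (Eq1 : (xout, (- yout)%R) = (RtoC Rout * cis (- p7))%C).
  { apply C_ext; unfold cis, xout, yout, Re, Im; simpl; rewrite cos_neg, sin_neg; ring. }
  assert (Eq2 : (xout, yout) = (RtoC Rout * cis p7)%C).
  { apply C_ext; unfold cis, xout, yout, Re, Im; simpl; ring. }
  rewrite Eq1, Eq2. unfold polar. rewrite INR_IZR_INZ.
  split; [|split].
  - rewrite H_odd.
    + rewrite minus_IZR. replace ((IZR (Z.of_nat i) - 1) * p7)
        with (IZR (Z.of_nat i) * p7 + - p7) by ring. rewrite cis_plus. ring.
    + apply Z.odd_spec. exists (Z.of_nat m - 1)%Z. lia.
  - rewrite H_odd.
    + rewrite plus_IZR. replace ((IZR (Z.of_nat i) + 1) * p7)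
        with (IZR (Z.of_nat i) * p7 + p7) by ring. rewrite cis_plus. ring.
    + apply Z.odd_spec. exists (Z.of_nat m)%Z. lia.
  - unfold refpt. apply H_even. rewrite <- Z.negb_even. apply Bool.negb_false_iff, Z.even_spec.
    exists (Z.of_nat m). lia.
Qed.

Lemma H_apex i : Nat.Even i ->
  (H (Z.of_nat i - 1) + (H (Z.of_nat i + 1) - H (Z.of_nat i - 1)) * cis (- (PI / 3)))%C = refpt i.
Proof.
  intros He. destruct (H_neighbours i He) as (-> & -> & ->). destruct cis_PI3 as [_ ->].
  rewrite (Cmult_comm (RtoC rapex)).
  transitivity (cis (polar i) * ((xout, (- yout)%R) - ((xout, yout) - (xout, (- yout)%R)) * zeta))%C; [ring | f_equal].
  apply C_ext; unfold rapex, zeta, kap, Re, Im; simpl; field.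
Qed.

Lemma near_tripod n i : (i < n)%nat -> Nat.Even i -> tracked n i -> ang i < PI / 2 -> rad i < xout ->
  near n (fun t => exists r s u,
    fermat_tripod (H (Z.of_nat i - 1)) (vtx (snd t) i) (H (Z.of_nat i + 1)) (fermat (snd t) i)
      (dir (vtx (snd t) i) (refpt i)) r s u).
Proof.
  intros Hi He Ht Ha Hr. pose proof (near_balancing n i Hi Ht Ha) as HB.
  destruct Ht as (L1 & _). destruct (H_neighbours i He) as (E1 & E2 & _).
  pose proof (Clim_cross _ _ _ _ (Clim_const (F := near n) (H (Z.of_nat i + 1) - H (Z.of_nat i - 1))%C)
    (Clim_minus _ _ _ _ L1 (Clim_const (H (Z.of_nat i - 1))))) as LX.
  assert (Hx : 0 < cross (H (Z.of_nat i + 1) - H (Z.of_nat i - 1))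
    (RtoC (rad i) * cis (polar i) - H (Z.of_nat i - 1))).
  { rewrite E1, E2.
    replace (cis (polar i) * (xout, yout) - cis (polar i) * (xout, (- yout)%R))%C
      with (cis (polar i) * ((xout, yout) - (xout, (- yout)%R)))%C by ring.
    replace (RtoC (rad i) * cis (polar i) - cis (polar i) * (xout, (- yout)%R))%C
      with (cis (polar i) * (RtoC (rad i) - (xout, (- yout)%R)))%C by ring.
    rewrite cross_rot. pose proof yout_pos. pose proof (sin2_cos2 (polar i)) as E. unfold Rsqr in E.
    replace (Re (cis (polar i)) ^ 2 + Im (cis (polar i)) ^ 2) with 1
      by (unfold cis, Re, Im; simpl; lra).
    unfold cross, Re, Im; simpl. nra. }
  generalize (filter_and _ _ HB (Rlim_gt _ _ 0 LX Hx)). apply filter_imp.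
  intros t [[_ HF] Hc]. specialize (HF He).
  destruct (fermat_point_tripod _ _ _ _ HF Hc) as (S & r & s & u & HT).
  exists r, s, u. pose proof (tripod_apex _ _ _ _ _ _ _ _ HT) as ES.
  rewrite H_apex in ES by auto. now rewrite ES.
Qed.

(* A Fermat point exists only if the angle at v_i is less than 120 degrees. *)
Lemma rad_le_rfermat n i : ~ near n (fun _ => False) -> (i < n)%nat -> Nat.Even i ->
  tracked n i -> ang i < PI / 2 -> rad i < xout -> rad i <= rfermat.
Proof.
  intros Hprop Hi He Ht Ha Hr. apply Rnot_lt_le. intros Hlt. apply Hprop.
  pose proof (near_tripod n i Hi He Ht Ha Hr) as HT. destruct Ht as (L1 & _).
  destruct (H_neighbours i He) as (E1 & E2 & _).
  pose proof (Clim_minus _ _ _ _ (Clim_const (F := near n) (H (Z.of_nat i - 1))) L1) as LA.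
  pose proof (Clim_minus _ _ _ _ (Clim_const (F := near n) (H (Z.of_nat i + 1))) L1) as LC.
  pose proof (Clim_Cmod _ _ LA) as MA. pose proof (Clim_Cmod _ _ LC) as MC.
  destruct LA as [LA1 LA2]. destruct LC as [LC1 LC2].
  pose proof (Rlim_plus _ _ _ _ (Rlim_plus _ _ _ _ (Rlim_mult _ _ _ _ LA1 LC1)
     (Rlim_mult _ _ _ _ LA2 LC2))
     (Rlim_mult _ _ _ _ (Rlim_const (/ 2)) (Rlim_mult _ _ _ _ MA MC))) as LL.
  match type of LL with Rlim _ ?x => set (lim := x) in LL end.
  (* Beyond [rfermat], (xout - rad i)^2 < yout^2 / 3: the limiting angle at v_i exceeds 120
     degrees. *)
  assert (Hl : lim < 0).
  { unfold lim. clear LL lim LA1 LA2 LC1 LC2 MA MC HT. rewrite E1, E2.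
    replace (cis (polar i) * (xout, (- yout)%R) - RtoC (rad i) * cis (polar i))%C
      with (cis (polar i) * ((xout, (- yout)%R) - RtoC (rad i)))%C by ring.
    replace (cis (polar i) * (xout, yout) - RtoC (rad i) * cis (polar i))%C
      with (cis (polar i) * ((xout, yout) - RtoC (rad i)))%C by ring.
    rewrite !Cmod_mult, !Cmod_cis, !Rmult_1_l.
    pose proof (sin2_cos2 (polar i)) as E. unfold Rsqr in E.
    replace (Cmod ((xout, yout) - RtoC (rad i))) with (Cmod ((xout, (- yout)%R) - RtoC (rad i)))
      by (unfold Cmod; simpl; f_equal; ring).
    rewrite Cmod_sqr_ReIm. unfold cis, Re, Im; simpl.
    set (x := cos (polar i)) in *. set (y := sin (polar i)) in *.
    match goal with |- ?e < 0 => replace e with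
      (((xout - rad i) * (xout - rad i) - yout * yout) * (y * y + x * x)
        + / 2 * ((xout - rad i) * (xout - rad i) + yout * yout)) by ring end.
    rewrite E. unfold rfermat in Hlt. pose proof sqrt3_facts as [S1 S2]. pose proof yout_pos.
    assert (Hb : (xout - rad i) * (xout - rad i) < yout * sqrt 3 / 3 * (yout * sqrt 3 / 3)) by nra.
    replace (yout * sqrt 3 / 3 * (yout * sqrt 3 / 3)) with (yout * yout * (sqrt 3 * sqrt 3) / 9) in Hb by field.
    rewrite S1 in Hb. lra. }
  generalize (filter_and _ _ HT (Rlim_lt _ _ 0 LL Hl)). apply filter_imp.
  intros t [(r & s & u & Htri) Hneg].
  pose proof (tripod_angle_condition _ _ _ _ _ _ _ _ Htri). lra.
Qed.

(** The bounds alternate with parity. An odd layer loses at most a factor cos p7 from the even layer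
    before it. The next even layer then lies below [xout] by [rfermat_lt], and falls back below
    [rfermat]: by the obtuse step if it is extended, by the existence of its Fermat point if it is
    suspended. The last layer is neither, hence i < n. *)
Lemma tracked_within n : ~ near n (fun _ => False) -> forall i, (i <= n)%nat ->
  tracked n i /\ ((i < n)%nat -> within i) /\
  (Nat.Even i -> (i < n)%nat -> rad i <= rfermat) /\
  (Nat.Odd i -> rad i * cos p7 <= rfermat).
Proof.
  intros Hprop. pose proof cos_p7_pos as Hc. pose proof rfermat_lt as HF. pose proof one_le_rfermat as H1F.
  pose proof (COS_bound p7) as [_ Hc1].
  assert (Hcc : cos p7 * cos p7 <= 1) by nra.
  assert (FrR : rfermat < Rout * cos p7).
  { unfold xout in HF. pose proof Rout_pos.
    assert (Rout * cos p7 * (cos p7 * cos p7) <= Rout * cos p7); [|lra].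
    assert (0 < Rout * cos p7) by nra. nra. }
  induction i as [|i IH]; intros Hi.
  - split; [apply tracked_0|]. pose proof xout_pos.
    assert (rfermat < xout) by nra.
    assert (HO0 : ~ Nat.Odd 0) by (intros [m Hm]; lia).
    unfold within; cbn [rad]. split; [|split].
    + intros _. split; [intros _; lra | intros HO; contradiction].
    + intros _ _. lra.
    + intros HO; contradiction.
  - destruct (IH ltac:(lia)) as (Ht & Hw & He & Ho). specialize (Hw ltac:(lia)).
    assert (HW : wings_tracked n i).
    { destruct (Rlt_dec (PI / 2) (ang i)) as [Ha|Ha].
      - apply wings_extended; auto; lia.
      - apply wings_balancing; auto. pose proof (ang_neq_PI2 i). lra. }
    pose proof (tracked_S n i ltac:(lia) Ht HW) as HtS.
    pose proof (rad_step_le i) as Hs. pose proof (rad_step_le_ext i) as Hx.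
    split; auto.
    assert (HoS : Nat.Odd (S i) -> rad (S i) * cos p7 <= rfermat).
    { intros HO. assert (HE : Nat.Even i) by (apply Nat.Odd_succ; auto).
      specialize (He HE ltac:(lia)). lra. }
    assert (HeS : Nat.Even (S i) -> rad (S i) < xout /\ ((S i < n)%nat -> rad (S i) <= rfermat)).
    { intros HE. assert (HO : Nat.Odd i) by (apply Nat.Even_succ; auto).
      specialize (Ho HO).
      assert (HQ : rad (S i) < xout).
      { assert (rad (S i) * (cos p7 * cos p7) < xout * (cos p7 * cos p7)); nra. }
      split; auto. intros Hlt. destruct (Rlt_dec (PI / 2) (ang (S i))) as [Ha|Ha].
      - specialize (Hx Ha). lra.
      - apply (rad_le_rfermat n); auto. pose proof (ang_neq_PI2 (S i)). lra. }
    split; [|split; [|exact HoS]].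
    + intros Hlt. split; [apply HeS|]. intros HO. specialize (HoS HO). nra.
    + intros HE Hlt. now apply HeS.
Qed.

(** * Edges and overlaps *)

Definition edge_src (G : star) (e : edge) : C :=
  match e with
  | LayerEdge i k => rho ^ k * vprev G i
  | LayerEdgeRho i k => rho ^ k * (rho * vprev G i)
  | OddSuspension i k => rho ^ k * vtx G i
  | FermatPrev i k | FermatNext i k | FermatVtx i k => rho ^ k * fermat G i
  end%C.

Definition edge_tgt (G : star) (e : edge) : C :=
  match e with
  | LayerEdge i k | LayerEdgeRho i k | FermatVtx i k => rho ^ k * vtx G i
  | OddSuspension i k => rho ^ k * refpt i
  | FermatPrev i k => rho ^ k * H (Z.of_nat i - 1)
  | FermatNext i k => rho ^ k * H (Z.of_nat i + 1)
  end%C.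

Lemma on_edge_seg G e : on_edge G e = seg (edge_src G e) (edge_tgt G e).
Proof. destruct e; reflexivity. Qed.

Definition edge_dir (G : star) (e : edge) : C :=
  match e with
  | LayerEdge i k => rho ^ k * dir (vtx G i) (vprev G i)
  | LayerEdgeRho i k => rho ^ k * dir (vtx G i) (rho * vprev G i)
  | OddSuspension i k | FermatVtx i k => rho ^ k * dir (vtx G i) (refpt i)
  | FermatPrev i k => rho ^ k * (cis (- (PI / 3)) * dir (vtx G i) (refpt i))
  | FermatNext i k => rho ^ k * (cis (PI / 3) * dir (vtx G i) (refpt i))
  end%C.

(* In the symmetric configuration an edge of layer i has the direction
   edge_code * PI/42 + edge_sign * ang i. *)
Definition edge_code (e : edge) : Z :=
  match e with
  | LayerEdge i k | LayerEdgeRho i k => 6 * Z.of_nat i + 12 * Z.of_nat k + 42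
  | OddSuspension i k | FermatVtx i k => 6 * Z.of_nat i + 12 * Z.of_nat k
  | FermatPrev i k => 6 * Z.of_nat i + 12 * Z.of_nat k - 14
  | FermatNext i k => 6 * Z.of_nat i + 12 * Z.of_nat k + 14
  end%Z.

Definition edge_layer (e : edge) : nat :=
  match e with
  | LayerEdge i _ | LayerEdgeRho i _ | OddSuspension i _ | FermatVtx i _
  | FermatPrev i _ | FermatNext i _ => i
  end.

Definition edge_sign (e : edge) : R :=
  match e with LayerEdge _ _ => 1 | LayerEdgeRho _ _ => -1 | _ => 0 end.

Definition edge_angle (e : edge) : R :=
  IZR (edge_code e) * (PI / 42) + edge_sign e * ang (edge_layer e).

(** Membership is read off [ang] instead of the star, so it does not vary with phi and each edge can
    be followed along the filter. *)
Definition nominal_net (n : nat) (e : edge) : Prop :=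
  match e with
  | LayerEdge i k | LayerEdgeRho i k => (i <= n)%nat /\ (k < 7)%nat
  | OddSuspension i k => (i < n)%nat /\ ang i < PI / 2 /\ Nat.Odd i /\ (k < 7)%nat
  | FermatPrev i k | FermatNext i k | FermatVtx i k =>
      (i < n)%nat /\ ang i < PI / 2 /\ Nat.Even i /\ (k < 7)%nat
  end.

Lemma near_forall_lt n N (P : nat -> R * star -> Prop) :
  (forall i, (i < N)%nat -> near n (P i)) -> near n (fun t => forall i, (i < N)%nat -> P i t).
Proof.
  induction N as [|N IH]; intros HP.
  - apply filter_forall. intros t i Hi. lia.
  - assert (H1 : near n (fun t => forall i, (i < N)%nat -> P i t)) by (apply IH; intros; apply HP; lia).
    generalize (filter_and _ _ H1 (HP N (Nat.lt_succ_diag_r N))).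
    apply filter_imp. intros t [K1 K2] i Hi.
    destruct (Nat.eq_dec i N) as [->|Hne]; [auto | apply K1; lia].
Qed.

(** A filter allows only finite intersections: six families, at most n + 1 layers, seven
    rotations. *)
Lemma near_forall_edge n (P : edge -> R * star -> Prop) :
  (forall e, nominal_net n e -> near n (P e)) ->
  near n (fun t => forall e, nominal_net n e -> P e t).
Proof.
  intros HP.
  assert (HE : forall e, near n (fun t => nominal_net n e -> P e t)).
  { intros e. destruct (classic (nominal_net n e)) as [He|He].
    - generalize (HP e He). apply filter_imp. auto.
    - apply filter_forall. intros t He'. contradiction. }
  assert (HK : forall c : nat -> nat -> edge,
    near n (fun t => forall i, (i < S n)%nat -> forall k, (k < 7)%nat ->
      nominal_net n (c i k) -> P (c i k) t)).
  { intros c. apply near_forall_lt. intros i Hi. apply near_forall_lt. intros k Hk. apply HE. }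
  generalize (filter_and _ _ (filter_and _ _ (HK LayerEdge) (HK LayerEdgeRho))
    (filter_and _ _ (filter_and _ _ (HK OddSuspension) (HK FermatVtx))
      (filter_and _ _ (HK FermatPrev) (HK FermatNext)))).
  apply filter_imp. intros t [[P1 P2] [[P3 P4] [P5 P6]]] e He.
  destruct e; simpl in He; [apply P1 | apply P2 | apply P3 | apply P5 | apply P6 | apply P4];
    simpl; auto; lia.
Qed.

Lemma rho_pow k : (rho ^ k)%C = cis (IZR (12 * Z.of_nat k) * (PI / 42)).
Proof.
  induction k as [|k IH].
  - simpl. apply C_ext; unfold cis, Re, Im; simpl; rewrite Rmult_0_l, ?cos_0, ?sin_0; reflexivity.
  - rewrite Cpow_S, IH, rho_cis, <- cis_plus. f_equal.
    rewrite Nat2Z.inj_succ, <- Z.add_1_r, Z.mul_add_distr_l, plus_IZR. unfold p7. simpl. field.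
Qed.

Lemma polar_code i : polar i = IZR (6 * Z.of_nat i) * (PI / 42).
Proof. unfold polar, p7. rewrite INR_IZR_INZ, mult_IZR. field. Qed.

(* The filter [near n] is improper when there is no star of depth n for small phi. *)
Section NominalLimits.
Variable n : nat.
Hypothesis proper : ~ near n (fun _ => False).

Let tracked_n i (Hi : (i <= n)%nat) : tracked n i := proj1 (tracked_within n proper i Hi).

Lemma within_n i : (i < n)%nat -> within i.
Proof. intros Hi. apply (tracked_within n proper i ltac:(lia)); auto. Qed.

Lemma suspension_limit i : (i < n)%nat ->
  Clim (F := near n) (fun t => dir (vtx (snd t) i) (refpt i)) (cis (polar i)) /\
  near n (fun t => vtx (snd t) i <> refpt i).
Proof.
  intros Hi. apply suspension_dir_limit; [apply tracked_n; lia | now apply within_n].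
Qed.

Lemma edge_dir_limit e : nominal_net n e ->
  Clim (F := near n) (fun t => edge_dir (snd t) e) (cis (edge_angle e)).
Proof.
  assert (HC : forall (f : R * star -> C) k x y,
    Clim (F := near n) f (cis x) -> y = x + IZR (12 * Z.of_nat k) * (PI / 42) ->
    Clim (F := near n) (fun t => rho ^ k * f t)%C (cis y)).
  { intros f k x y Hf ->. rewrite Rplus_comm, cis_plus, <- rho_pow.
    apply Clim_mult; auto. apply Clim_const. }
  assert (HC2 : forall (f : R * star -> C) z x,
    Clim (F := near n) f (cis x) -> Clim (F := near n) (fun t => cis z * f t)%C (cis (z + x))).
  { intros f z x Hf. rewrite cis_plus. apply Clim_mult; auto. apply Clim_const. }
  destruct e as [i k|i k|i k|i k|i k|i k]; simpl; intros He; unfold edge_angle;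
    cbn [edge_code edge_sign edge_layer edge_dir].
  - eapply HC; [apply (tracked_n i); tauto|].
    rewrite polar_code, !plus_IZR. simpl. field.
  - eapply HC; [apply (tracked_n i); tauto|].
    rewrite polar_code, !plus_IZR. simpl. field.
  - eapply HC; [apply (suspension_limit i); tauto|].
    rewrite polar_code, !plus_IZR. ring.
  - eapply HC; [apply HC2, (suspension_limit i); tauto|].
    rewrite polar_code, minus_IZR, !plus_IZR. simpl. field.
  - eapply HC; [apply HC2, (suspension_limit i); tauto|].
    rewrite polar_code, !plus_IZR. simpl. field.
  - eapply HC; [apply (suspension_limit i); tauto|].
    rewrite polar_code, !plus_IZR. ring.
Qed.

Lemma near_tripod_n i : (i < n)%nat -> Nat.Even i -> ang i < PI / 2 ->
  near n (fun t => exists r s u,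
    fermat_tripod (H (Z.of_nat i - 1)) (vtx (snd t) i) (H (Z.of_nat i + 1)) (fermat (snd t) i)
      (dir (vtx (snd t) i) (refpt i)) r s u).
Proof.
  intros Hi He Ha. apply near_tripod; auto; [apply tracked_n; lia|].
  apply (proj1 (within_n i Hi) He).
Qed.

Lemma edge_aligned e : nominal_net n e ->
  near n (fun t => exists l : R,
    (edge_tgt (snd t) e - edge_src (snd t) e)%C = (RtoC l * edge_dir (snd t) e)%C).
Proof.
  destruct e as [i k|i k|i k|i k|i k|i k]; simpl; intros He.
  - destruct (tracked_n i ltac:(tauto)) as (_ & _ & _ & HN). revert HN. apply filter_imp.
    intros t [N1 _]. eexists (- Cmod (vprev (snd t) i - vtx (snd t) i)). rewrite RtoC_opp.
    transitivity (- rho ^ k * (vprev (snd t) i - vtx (snd t) i))%C; [ring|].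
    rewrite (dir_scale _ _ N1) at 1. ring.
  - destruct (tracked_n i ltac:(tauto)) as (_ & _ & _ & HN). revert HN. apply filter_imp.
    intros t [_ N1]. eexists (- Cmod (rho * vprev (snd t) i - vtx (snd t) i)). rewrite RtoC_opp.
    transitivity (- rho ^ k * (rho * vprev (snd t) i - vtx (snd t) i))%C; [ring|].
    rewrite (dir_scale _ _ N1) at 1. ring.
  - destruct (suspension_limit i ltac:(tauto)) as [_ HN]. revert HN. apply filter_imp.
    intros t N1. eexists (Cmod (refpt i - vtx (snd t) i)).
    transitivity (rho ^ k * (refpt i - vtx (snd t) i))%C; [ring|].
    rewrite (dir_scale _ _ N1) at 1. ring.
  - generalize (near_tripod_n i ltac:(tauto) ltac:(tauto) ltac:(tauto)). apply filter_imp.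
    intros t (r & s & u & _ & _ & _ & _ & _ & Ea & _). exists s. rewrite Ea. ring.
  - generalize (near_tripod_n i ltac:(tauto) ltac:(tauto) ltac:(tauto)). apply filter_imp.
    intros t (r & s & u & _ & _ & _ & _ & _ & _ & Ec). exists u. rewrite Ec. ring.
  - generalize (near_tripod_n i ltac:(tauto) ltac:(tauto) ltac:(tauto)). apply filter_imp.
    intros t (r & s & u & _ & _ & _ & _ & Eb & _). exists (- r). rewrite Eb at 1. rewrite RtoC_opp. ring.
Qed.

End NominalLimits.

(** * Criteria against overlaps, and angles modulo PI *)

Lemma overlap_cross p q p' q' (l l' : R) (u u' : C) :
  (q - p)%C = (RtoC l * u)%C -> (q' - p')%C = (RtoC l' * u')%C ->
  overlap (seg p q) (seg p' q') -> cross u u' = 0.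
Proof.
  intros E E' (x & y & Hxy & Hz).
  destruct (Hz x) as [[s1 [_ X1]] [s1' [_ X1']]].
  { exists 0. split; [lra | ring]. }
  destruct (Hz y) as [[s2 [_ Y1]] [s2' [_ Y1']]].
  { exists 1. split; [lra | ring]. }
  rewrite E in X1, Y1. rewrite E' in X1', Y1'.
  assert (D1 : (y - x)%C = (RtoC ((s2 - s1) * l) * u)%C).
  { rewrite X1, Y1, RtoC_mult, RtoC_minus. ring. }
  assert (D2 : (y - x)%C = (RtoC ((s2' - s1') * l') * u')%C).
  { rewrite X1', Y1', RtoC_mult, RtoC_minus. ring. }
  assert (H0 : forall (a : R) (w : C), (y - x)%C = (RtoC a * w)%C -> a <> 0).
  { intros a w Ea Za. apply Hxy. rewrite Za in Ea.
    replace y with ((y - x) + x)%C by ring. rewrite Ea. ring. }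
  pose proof (H0 _ _ D1) as N1. pose proof (H0 _ _ D2) as N2.
  assert (Ec : cross (y - x) (y - x) = 0) by (unfold cross; ring).
  rewrite D1 in Ec at 1. rewrite D2, cross_scale in Ec.
  apply Rmult_integral in Ec. destruct Ec as [Ec|Ec]; auto.
  apply Rmult_integral in Ec. tauto.
Qed.

Lemma opposite_rays_no_overlap (A B : C -> Prop) (V D : C) : D <> 0 ->
  (forall z, A z -> exists x, 0 <= x /\ z = (V + RtoC x * D)%C) ->
  (forall z, B z -> exists y, 0 <= y /\ z = (V - RtoC y * D)%C) -> ~ overlap A B.
Proof.
  intros HD HA HB (p & q & Hpq & Hz). apply Hpq.
  assert (HV : forall z, A z -> B z -> z = V).
  { intros z Az Bz. destruct (HA z Az) as [x [Hx Ex]]. destruct (HB z Bz) as [y [Hy Ey]].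
    assert (E : (RtoC (x + y) * D)%C = 0).
    { rewrite RtoC_plus. replace ((RtoC x + RtoC y) * D)%C with
        ((V + RtoC x * D) - (V - RtoC y * D))%C by ring. rewrite <- Ex, <- Ey. ring. }
    destruct (Req_dec (x + y) 0) as [E0|E0].
    - assert (x = 0) by lra. subst x. rewrite Ex. ring.
    - exfalso. revert E. apply Cmult_neq_0; auto. intros E. now apply RtoC_inj in E. }
  destruct (Hz p) as [A1 B1]; [exists 0; split; [lra | ring]|].
  destruct (Hz q) as [A2 B2]; [exists 1; split; [lra | ring]|].
  now rewrite (HV p A1 B1), (HV q A2 B2).
Qed.

Lemma half_planes_no_overlap (p q p' q' c : C) :
  let f z := Re c * Re z + Im c * Im z in
  0 < f p -> 0 < f q -> f p' < 0 -> f q' < 0 -> ~ overlap (seg p q) (seg p' q').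
Proof.
  intros f H1 H2 H3 H4 (x & y & _ & Hz).
  assert (Hf : forall (a b : C) s, f (a + RtoC s * (b - a))%C = (1 - s) * f a + s * f b).
  { intros a b s. unfold f, Re, Im; simpl. ring. }
  destruct (Hz x) as [[s [Hs E1]] [s' [Hs' E2]]]; [exists 0; split; [lra | ring]|].
  assert (F1 : 0 < f x).
  { rewrite E1, Hf. destruct (Req_dec s 0) as [->|]; [lra|].
    assert (0 < s * f q) by nra. nra. }
  assert (F2 : f x < 0).
  { rewrite E2, Hf. destruct (Req_dec s' 0) as [->|]; [lra|].
    assert (s' * f q' < 0) by nra. nra. }
  lra.
Qed.

Lemma sin_multiple_PI42 m : sin (IZR m * (PI / 42)) = 0 -> exists z, m = (42 * z)%Z.
Proof.
  intros E. apply sin_eq_0_0 in E. destruct E as [z E]. exists z.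
  apply eq_IZR. rewrite mult_IZR. pose proof PI_gt_3.
  apply Rmult_eq_reg_r with (PI / 42); [|lra]. rewrite E. field.
Qed.

Lemma cis_multiple_PI42 m m' z : (m = m' + 84 * z)%Z ->
  cis (IZR m * (PI / 42)) = cis (IZR m' * (PI / 42)).
Proof.
  intros ->. rewrite plus_IZR, mult_IZR.
  replace ((IZR m' + 84 * IZR z) * (PI / 42)) with (IZR m' * (PI / 42) + 2 * IZR z * PI) by field.
  assert (HN : forall x (k : nat), cis (x + 2 * INR k * PI) = cis x).
  { intros x k. apply C_ext; unfold cis, Re, Im; simpl; [apply cos_period | apply sin_period]. }
  destruct (Z.le_gt_cases 0 z) as [Hz|Hz].
  - replace z with (Z.of_nat (Z.to_nat z)) by lia. rewrite <- INR_IZR_INZ. apply HN.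
  - rewrite <- (HN (IZR m' * (PI / 42) + 2 * IZR z * PI) (Z.to_nat (- z))). f_equal.
    rewrite INR_IZR_INZ, Z2Nat.id, opp_IZR by lia. ring.
Qed.

Lemma cross_cis_mult a u w : cross (cis a * u)%C (cis a * w)%C = cross u w.
Proof.
  rewrite cross_rot. pose proof (sin2_cos2 a) as E. unfold Rsqr in E.
  unfold cis, Re, Im; simpl. replace (_ + _) with 1 by lra. ring.
Qed.

Lemma unit_parallel_eq (z w : C) : Cmod z = 1 -> Cmod w = 1 -> 0 < Re z -> 0 < Re w ->
  cross z w = 0 -> z = w.
Proof.
  intros Hz Hw Pz Pw Hc. pose proof (Cmod_sqr_ReIm z) as E1. pose proof (Cmod_sqr_ReIm w) as E2.
  rewrite Hz in E1. rewrite Hw in E2. unfold cross in Hc.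
  assert (Er : Re z * Re z = Re w * Re w).
  { transitivity (Re z * Re z * (Re w * Re w + Im w * Im w)); [rewrite <- E2; ring|].
    transitivity (Re w * Re w * (Re z * Re z + Im z * Im z)); [|rewrite <- E1; ring].
    assert (Re z * Im w = Im z * Re w) by lra.
    transitivity (Re z * Re z * (Re w * Re w) + (Re z * Im w) * (Re z * Im w)); [ring|].
    rewrite H. ring. }
  assert (Eq : Re z = Re w) by nra.
  apply C_ext; auto. rewrite Eq in Hc. nra.
Qed.

Lemma extension_ang i m : (forall l, (i <= l < i + m)%nat -> PI / 2 < ang l) ->
  ang (i + m) = ang i - IZR (6 * Z.of_nat m) * (PI / 42).
Proof.
  induction m as [|m IH]; intros HA.
  - rewrite Nat.add_0_r. simpl. ring.
  - replace (i + S m)%nat with (S (i + m)) by lia.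
    specialize (HA (i + m)%nat ltac:(lia)) as HAm.
    destruct (theta_case (i + m)) as [[_ Eth]|[Hc _]]; [|lra].
    rewrite theta_ang in Eth.
    rewrite IH in Eth by (intros l Hl; apply HA; lia).
    rewrite Nat2Z.inj_succ, <- Z.add_1_r, Z.mul_add_distr_l, plus_IZR.
    change (6 * 1)%Z with 6%Z. unfold p7 in Eth. lra.
Qed.

(** * Pairs of edges that are parallel in the limit *)

Definition suspension_distinct (n : nat) (G : star) : Prop :=
  forall i j : nat, (i <= n)%nat -> (j <= n)%nat -> i <> j ->
    suspension_angle G i <> suspension_angle G j.

Section SpecialPairs.
Variable n : nat.
Hypothesis proper : ~ near n (fun _ => False).

Let tracked_n i (Hi : (i <= n)%nat) : tracked n i := proj1 (tracked_within n proper i Hi).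

Lemma extension_chain i m : (i + m <= n)%nat ->
  (forall l, (i <= l < i + m)%nat -> PI / 2 < ang l) ->
  near n (fun t => exists s, 0 <= s /\
    vtx (snd t) (i + m) = (vtx (snd t) i - RtoC s * dir (vtx (snd t) i) (vprev (snd t) i))%C /\
    dir (vtx (snd t) (i + m)) (vprev (snd t) (i + m)) = dir (vtx (snd t) i) (vprev (snd t) i)).
Proof.
  induction m as [|m IH]; intros Hm HA.
  - apply filter_forall. intros t. rewrite Nat.add_0_r. exists 0. split; [lra|]. split; [ring | auto].
  - pose proof (near_extension_dir n (i + m) ltac:(lia) (tracked_n (i + m) ltac:(lia))
      (HA (i + m)%nat ltac:(lia))) as HE.
    destruct (tracked_n (S (i + m)) ltac:(lia)) as (_ & _ & _ & HN).
    assert (HI := IH ltac:(lia) (fun l Hl => HA l ltac:(lia))).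
    replace (i + S m)%nat with (S (i + m)) by lia. cbn [vprev] in *.
    generalize (filter_and _ _ HI (filter_and _ _ HE HN)). apply filter_imp.
    intros t [(s & Hs & E1 & E2) [[E3 _] [N1 _]]].
    exists (s + Cmod (vtx (snd t) (i + m) - vtx (snd t) (S (i + m)))). split.
    + pose proof (Cmod_ge_0 (vtx (snd t) (i + m) - vtx (snd t) (S (i + m)))). lra.
    + split; [|now rewrite E3, E2].
      pose proof (dir_scale _ _ N1) as ED. rewrite E3, E2 in ED.
      rewrite RtoC_plus.
      transitivity (vtx (snd t) (i + m) - (vtx (snd t) (i + m) - vtx (snd t) (S (i + m))))%C; [ring|].
      rewrite ED at 1. rewrite E1 at 1. ring.
Qed.

(** The clockwise wing that reaches v_(i+1) starts at rho v_i, so on this side each extension adds a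
    rotation by [rho]. *)
Lemma extension_chain_rho i m : (i + m <= n)%nat ->
  (forall l, (i <= l < i + m)%nat -> PI / 2 < ang l) ->
  near n (fun t => exists s, 0 <= s /\
    vtx (snd t) (i + m) = (rho ^ m * (vtx (snd t) i
      - RtoC s * dir (vtx (snd t) i) (rho * vprev (snd t) i)))%C /\
    dir (vtx (snd t) (i + m)) (rho * vprev (snd t) (i + m)) =
      (rho ^ m * dir (vtx (snd t) i) (rho * vprev (snd t) i))%C).
Proof.
  induction m as [|m IH]; intros Hm HA.
  - apply filter_forall. intros t. rewrite Nat.add_0_r. exists 0. split; [lra|].
    simpl. split; ring.
  - pose proof (near_extension_dir n (i + m) ltac:(lia) (tracked_n (i + m) ltac:(lia))
      (HA (i + m)%nat ltac:(lia))) as HE.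
    destruct (tracked_n (S (i + m)) ltac:(lia)) as (_ & _ & _ & HN).
    assert (HI := IH ltac:(lia) (fun l Hl => HA l ltac:(lia))).
    replace (i + S m)%nat with (S (i + m)) by lia. cbn [vprev] in *.
    generalize (filter_and _ _ HI (filter_and _ _ HE HN)). apply filter_imp.
    intros t [(s & Hs & E1 & E2) [[_ E3] [_ N1]]].
    exists (s + Cmod (rho * vtx (snd t) (i + m) - vtx (snd t) (S (i + m)))). split.
    + pose proof (Cmod_ge_0 (rho * vtx (snd t) (i + m) - vtx (snd t) (S (i + m)))). lra.
    + rewrite Cpow_S. split; [|rewrite E3, E2; ring].
      pose proof (dir_scale _ _ N1) as ED. rewrite E3, E2 in ED.
      rewrite RtoC_plus.
      transitivity (rho * vtx (snd t) (i + m) - (rho * vtx (snd t) (i + m) - vtx (snd t) (S (i + m))))%C; [ring|].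
      rewrite ED at 1. rewrite E1 at 1. ring.
Qed.

Definition no_overlap_near (e e' : edge) : Prop :=
  near n (fun t => suspension_distinct n (snd t) ->
    ~ overlap (on_edge (snd t) e) (on_edge (snd t) e')).

Lemma no_overlap_sym e e' : no_overlap_near e e' -> no_overlap_near e' e.
Proof.
  unfold no_overlap_near. apply filter_imp. intros t Ht rapex (p & q & Hpq & Hz). apply (Ht rapex).
  exists p, q. split; auto. intros z Hs. destruct (Hz z Hs). auto.
Qed.

Lemma no_overlap_cross e e' : nominal_net n e -> nominal_net n e' ->
  near n (fun t => suspension_distinct n (snd t) ->
    cross (edge_dir (snd t) e) (edge_dir (snd t) e') <> 0) -> no_overlap_near e e'.
Proof.
  intros He He' Hc.
  unfold no_overlap_near.
  generalize (filter_and _ _ Hc (filter_and _ _ (edge_aligned n proper e He)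
    (edge_aligned n proper e' He'))).
  apply filter_imp. intros t [K1 [[l K2] [l' K3]]] rapex Ho. apply (K1 rapex).
  rewrite !on_edge_seg in Ho. exact (overlap_cross _ _ _ _ _ _ _ _ K2 K3 Ho).
Qed.

Lemma transversal e e' : nominal_net n e -> nominal_net n e' ->
  sin (edge_angle e' - edge_angle e) <> 0 -> no_overlap_near e e'.
Proof.
  intros He He' Hs. apply no_overlap_cross; auto.
  pose proof (Clim_cross _ _ _ _ (edge_dir_limit n proper e He)
    (edge_dir_limit n proper e' He')) as L.
  rewrite cross_cis in L. generalize (Rlim_neq0 _ _ L Hs). apply filter_imp. auto.
Qed.

Lemma layer_chain_no_overlap i m k k' : (i + S m <= n)%nat ->
  (forall l, (i <= l < i + S m)%nat -> PI / 2 < ang l) -> (rho ^ k = rho ^ k')%C ->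
  no_overlap_near (LayerEdge i k) (LayerEdge (i + S m) k').
Proof.
  intros Hm HA Ek.
  pose proof (extension_chain i m ltac:(lia) (fun l Hl => HA l ltac:(lia))) as C1.
  pose proof (near_extension_dir n (i + m) ltac:(lia) (tracked_n (i + m) ltac:(lia))
    (HA (i + m)%nat ltac:(lia))) as HE.
  destruct (tracked_n i ltac:(lia)) as (_ & _ & _ & N1).
  destruct (tracked_n (S (i + m)) ltac:(lia)) as (_ & _ & _ & N2). cbn [vprev] in *.
  unfold no_overlap_near.
  generalize (filter_and _ _ (filter_and _ _ C1 HE) (filter_and _ _ N1 N2)).
  apply filter_imp. intros t [[(s & Hs & E1 & E2) [E3 _]] [[K1 _] [K2 _]]] _.
  pose proof (dir_scale _ _ K1) as D1. pose proof (dir_scale _ _ K2) as D2.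
  rewrite E3, E2 in D2.
  replace (i + S m)%nat with (S (i + m)) by lia.
  rewrite !on_edge_seg. cbn [edge_src edge_tgt vprev]. rewrite <- Ek.
  set (D := dir (vtx (snd t) i) (vprev (snd t) i)) in *.
  assert (HD : Cmod D = 1) by now apply Cmod_dir.
  set (c1 := Cmod (vprev (snd t) i - vtx (snd t) i)) in *.
  set (c2 := Cmod (vtx (snd t) (i + m) - vtx (snd t) (S (i + m)))) in *.
  assert (P1 : 0 <= c1) by apply Cmod_ge_0. assert (P2 : 0 <= c2) by apply Cmod_ge_0.
  apply (opposite_rays_no_overlap _ _ (rho ^ k * vtx (snd t) i)%C (rho ^ k * D)%C).
  - rewrite rho_pow. apply Cmult_neq_0; [apply cis_neq0|]. intros Z. rewrite Z, Cmod_0 in HD. lra.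
  - intros z (x & Hx & ->). exists ((1 - x) * c1). split; [nra|].
    rewrite RtoC_mult, RtoC_minus.
    transitivity (rho ^ k * vtx (snd t) i + (1 - RtoC x) * rho ^ k * (vprev (snd t) i - vtx (snd t) i))%C; [ring|].
    rewrite D1 at 1. ring.
  - intros z (x & Hx & ->). exists (s + x * c2). split; [nra|].
    rewrite RtoC_plus, RtoC_mult.
    transitivity (rho ^ k * vtx (snd t) (i + m) - RtoC x * rho ^ k * (vtx (snd t) (i + m) - vtx (snd t) (S (i + m))))%C; [ring|].
    rewrite D2 at 1. rewrite E1. ring.
Qed.

Lemma layer_rho_chain_no_overlap i m k k' : (i + S m <= n)%nat ->
  (forall l, (i <= l < i + S m)%nat -> PI / 2 < ang l) -> (rho ^ k = rho ^ (k' + S m))%C ->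
  no_overlap_near (LayerEdgeRho i k) (LayerEdgeRho (i + S m) k').
Proof.
  intros Hm HA Ek.
  pose proof (extension_chain_rho i m ltac:(lia) (fun l Hl => HA l ltac:(lia))) as C1.
  pose proof (near_extension_dir n (i + m) ltac:(lia) (tracked_n (i + m) ltac:(lia))
    (HA (i + m)%nat ltac:(lia))) as HE.
  destruct (tracked_n i ltac:(lia)) as (_ & _ & _ & N1).
  destruct (tracked_n (S (i + m)) ltac:(lia)) as (_ & _ & _ & N2). cbn [vprev] in *.
  unfold no_overlap_near.
  generalize (filter_and _ _ (filter_and _ _ C1 HE) (filter_and _ _ N1 N2)).
  apply filter_imp. intros t [[(s & Hs & E1 & E2) [_ E3]] [[_ K1] [_ K2]]] _.
  pose proof (dir_scale _ _ K1) as D1. pose proof (dir_scale _ _ K2) as D2.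
  rewrite E3, E2 in D2.
  replace (i + S m)%nat with (S (i + m)) by lia.
  rewrite !on_edge_seg. cbn [edge_src edge_tgt vprev]. rewrite Ek.
  rewrite Cpow_add_r, Cpow_S.
  set (D := dir (vtx (snd t) i) (rho * vprev (snd t) i)) in *.
  assert (HD : Cmod D = 1) by now apply Cmod_dir.
  set (c1 := Cmod (rho * vprev (snd t) i - vtx (snd t) i)) in *.
  set (c2 := Cmod (rho * vtx (snd t) (i + m) - vtx (snd t) (S (i + m)))) in *.
  assert (P1 : 0 <= c1) by apply Cmod_ge_0. assert (P2 : 0 <= c2) by apply Cmod_ge_0.
  set (g := (rho ^ k' * (rho * rho ^ m))%C) in *.
  assert (Hg : g <> 0).
  { unfold g. rewrite <- Cpow_S, <- Cpow_add_r, rho_pow. apply cis_neq0. }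
  apply (opposite_rays_no_overlap _ _ (g * vtx (snd t) i)%C (g * D)%C).
  - apply Cmult_neq_0; auto. intros Z. rewrite Z, Cmod_0 in HD. lra.
  - intros z (x & Hx & ->). exists ((1 - x) * c1). split; [nra|].
    rewrite RtoC_mult, RtoC_minus.
    transitivity (g * vtx (snd t) i + (1 - RtoC x) * g * (rho * vprev (snd t) i - vtx (snd t) i))%C; [ring|].
    rewrite D1 at 1. ring.
  - intros z (x & Hx & ->). exists (s + x * c2). split; [nra|].
    rewrite RtoC_plus, RtoC_mult.
    transitivity (rho ^ k' * (rho * vtx (snd t) (i + m)) - RtoC x * rho ^ k' * (rho * vtx (snd t) (i + m) - vtx (snd t) (S (i + m))))%C; [ring|].
    rewrite D2 at 1. rewrite E1. unfold g. ring.
Qed.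

(** The suspension direction in the frame of layer i, where its limit is 1. There the directions at
    one reference point can be compared across layers. *)
Definition sdir (G : star) (i : nat) : C := (dir (vtx G i) (refpt i) * cis (- polar i))%C.

Lemma sdir_cis G i : dir (vtx G i) (refpt i) = (cis (polar i) * sdir G i)%C.
Proof.
  unfold sdir. transitivity (dir (vtx G i) (refpt i) * (cis (polar i) * cis (- polar i)))%C.
  - rewrite <- cis_plus. replace (polar i + - polar i) with 0 by ring.
    apply C_ext; unfold cis, Re, Im; simpl; rewrite cos_0, sin_0; ring.
  - ring.
Qed.

(** From H_i, both O and v_i are seen in reversed directions; the two signs cancel in the quotient,
    leaving [sdir] times a positive factor. *)
Lemma suspension_angle_Arg G i : vtx G i <> refpt i -> suspension_angle G i = Arg (sdir G i).
Proof.
  intros Hn. destruct (refpt_polar i) as (k & Hk & E & _). pose proof xout_pos.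
  pose proof (Cminus_neq0 _ _ Hn) as Hm. pose proof (Cmod_ge_0 (refpt i - vtx G i)).
  unfold suspension_angle, signed_angle.
  rewrite <- (Arg_scale (Cmod (refpt i - vtx G i) / k) (sdir G i)) by (apply Rdiv_lt_0_compat; lra).
  f_equal.
  assert (Hk0 : RtoC k <> 0) by (intros Z; apply RtoC_inj in Z; lra).
  assert (Hc := cis_neq0 (polar i)).
  replace (vtx G i - refpt i)%C with (- (refpt i - vtx G i))%C by ring.
  rewrite (dir_scale _ _ Hn) at 1. rewrite sdir_cis, RtoC_div by lra.
  set (m := Cmod (refpt i - vtx G i)). set (s := sdir G i). rewrite E.
  field. auto.
Qed.

Lemma sdir_limit i : (i < n)%nat ->
  near n (fun t => vtx (snd t) i <> refpt i /\ Cmod (sdir (snd t) i) = 1 /\ 0 < Re (sdir (snd t) i)).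
Proof.
  intros Hi. destruct (suspension_limit n proper i Hi) as [L HN].
  pose proof (Clim_mult _ _ _ _ L (Clim_const (F := near n) (cis (- polar i)))) as [L1 _].
  rewrite <- cis_plus in L1. replace (polar i + - polar i) with 0 in L1 by ring.
  assert (P1 : 0 < Re (cis 0)) by (unfold cis, Re; simpl; rewrite cos_0; lra).
  generalize (filter_and _ _ HN (Rlim_gt _ _ 0 L1 P1)). apply filter_imp.
  intros t [K1 K2]. split; [auto|]. split; [|exact K2].
  unfold sdir. rewrite Cmod_mult, Cmod_cis, Cmod_dir; auto. ring.
Qed.

(** This is where pairwise distinct suspension angles enter. The congruence modulo 84, a full turn,
    makes the two frames agree, and parallel directions close to 1 would have equal arguments. *)
Lemma suspension_cross i j k k' z : (i < n)%nat -> (j < n)%nat -> i <> j ->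
  (6 * Z.of_nat i + 12 * Z.of_nat k = 6 * Z.of_nat j + 12 * Z.of_nat k' + 84 * z)%Z ->
  near n (fun t => suspension_distinct n (snd t) ->
    cross (rho ^ k * dir (vtx (snd t) i) (refpt i)) (rho ^ k' * dir (vtx (snd t) j) (refpt j)) <> 0).
Proof.
  intros Hi Hj Hij E.
  generalize (filter_and _ _ (sdir_limit i Hi) (sdir_limit j Hj)). apply filter_imp.
  intros t [(N1 & M1 & R1) (N2 & M2 & R2)] rapex Hc.
  apply (rapex i j ltac:(lia) ltac:(lia) Hij).
  rewrite !suspension_angle_Arg by auto. f_equal.
  apply unit_parallel_eq; auto.
  rewrite !sdir_cis, !Cmult_assoc, !rho_pow, !polar_code, <- !cis_plus in Hc.
  rewrite <- !Rmult_plus_distr_r, <- !plus_IZR in Hc.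
  rewrite (cis_multiple_PI42 _ (12 * Z.of_nat k' + 6 * Z.of_nat j) z) in Hc by lia.
  now rewrite cross_cis_mult in Hc.
Qed.

(* An odd and an even suspension edge can only be parallel on opposite sides of O. *)
Lemma odd_even_no_overlap i j k k' z : nominal_net n (OddSuspension i k) ->
  nominal_net n (FermatVtx j k') ->
  (6 * Z.of_nat j + 12 * Z.of_nat k' = 6 * Z.of_nat i + 12 * Z.of_nat k + 42 + 84 * z)%Z ->
  no_overlap_near (OddSuspension i k) (FermatVtx j k').
Proof.
  intros (Hi & _ & _ & _) (Hj & Haj & Hej & _) E.
  set (th := IZR (6 * Z.of_nat i + 12 * Z.of_nat k) * (PI / 42)).
  assert (Ei : (rho ^ k * cis (polar i))%C = cis th).
  { rewrite rho_pow, polar_code, <- cis_plus. unfold th. f_equal. rewrite plus_IZR. ring. }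
  assert (Ej : (rho ^ k' * cis (polar j))%C = (- cis th)%C).
  { rewrite rho_pow, polar_code, <- cis_plus, <- Rmult_plus_distr_r, <- plus_IZR.
    rewrite (cis_multiple_PI42 _ (6 * Z.of_nat i + 12 * Z.of_nat k + 42) z) by lia.
    rewrite plus_IZR, <- cis_plus_PI. f_equal. unfold th. simpl. field. }
  destruct (tracked_n i ltac:(lia)) as (Li & _). destruct (tracked_n j ltac:(lia)) as (Lj & _).
  destruct (suspension_limit n proper j Hj) as [Ls _].
  pose proof (Clim_mult _ _ _ _ (Clim_const (F := near n) (rho ^ k)%C) Li) as Li'.
  pose proof (Clim_mult _ _ _ _ (Clim_const (F := near n) (rho ^ k')%C) Lj) as Lj'.
  pose proof (Clim_mult _ _ _ _ (Clim_const (F := near n) (rho ^ k')%C) Ls) as Ls'.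
  replace (rho ^ k * (RtoC (rad i) * cis (polar i)))%C with (RtoC (rad i) * cis th)%C in Li'
    by (rewrite <- Ei; ring).
  replace (rho ^ k' * (RtoC (rad j) * cis (polar j)))%C with (RtoC (- rad j) * cis th)%C in Lj'
    by (transitivity (RtoC (rad j) * (rho ^ k' * cis (polar j)))%C; [rewrite Ej, RtoC_opp|]; ring).
  rewrite Ej in Ls'.
  (* Projection to the common line: the odd edge lies on its positive half and the even one on its
     negative half. *)
  set (f := fun z : C => Re (cis th) * Re z + Im (cis th) * Im z).
  assert (Hf : forall (g : R * star -> C) l, Clim (F := near n) g l ->
    Rlim (F := near n) (fun t => f (g t)) (f l)).
  { intros g l [G1 G2]. unfold f. apply Rlim_plus; apply Rlim_mult; auto; apply Rlim_const. }
  assert (Hfs : forall r : R, f (RtoC r * cis th)%C = r).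
  { intros r. unfold f, cis, Re, Im; simpl. pose proof (sin2_cos2 th) as E2. unfold Rsqr in E2.
    transitivity (r * (sin th * sin th + cos th * cos th)); [ring | rewrite E2; ring]. }
  pose proof (rad_pos i) as Pi. pose proof (rad_pos j) as Pj.
  pose proof (Rlim_gt _ _ 0 (Hf _ _ Li') ltac:(rewrite Hfs; lra)) as F1.
  pose proof (Rlim_lt _ _ 0 (Hf _ _ Lj') ltac:(rewrite Hfs; lra)) as F2.
  assert (Hm1 : f (- cis th)%C < 0).
  { replace (- cis th)%C with (RtoC (-1) * cis th)%C by (apply C_ext; unfold Re, Im; simpl; ring).
    rewrite Hfs. lra. }
  pose proof (Rlim_lt _ _ 0 (Hf _ _ Ls') Hm1) as F3.
  unfold no_overlap_near.
  generalize (filter_and _ _ (near_tripod_n n proper j Hj Hej Haj)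
    (filter_and _ _ F1 (filter_and _ _ F2 F3))).
  apply filter_imp. intros t [(r & s & u & _ & Hr & _ & _ & Eb & _) [K1 [K2 K3]]] _.
  rewrite !on_edge_seg. apply (half_planes_no_overlap _ _ _ _ (cis th)); fold (f).
  - exact K1.
  - cbn [edge_tgt]. destruct (refpt_polar i) as (q & Hq & Eq & _). pose proof xout_pos.
    rewrite Eq. replace (rho ^ k * (RtoC q * cis (polar i)))%C
      with (RtoC q * cis th)%C by (rewrite <- Ei; ring). change (0 < f (RtoC q * cis th)%C).
    rewrite Hfs. lra.
  - cbn [edge_src]. replace (fermat (snd t) j) with
      (vtx (snd t) j + RtoC r * dir (vtx (snd t) j) (refpt j))%C by (rewrite Eb at 1; ring).
    change (f (rho ^ k' * (vtx (snd t) j + RtoC r * dir (vtx (snd t) j) (refpt j)))%C < 0).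
    replace (f _) with (f (rho ^ k' * vtx (snd t) j)%C + r * f (rho ^ k' * dir (vtx (snd t) j) (refpt j))%C)
      by (unfold f, Re, Im; simpl; ring).
    nra.
  - exact K2.
Qed.

End SpecialPairs.

(** * Case analysis over all pairs of edges *)

Lemma edge_angle_diff e e' : edge_angle e' - edge_angle e =
  edge_sign e' * ang (edge_layer e') - edge_sign e * ang (edge_layer e)
  + IZR (edge_code e' - edge_code e) * (PI / 42).
Proof. unfold edge_angle. rewrite minus_IZR. ring. Qed.

Section AllPairs.
Variable n : nat.
Hypothesis proper : ~ near n (fun _ => False).

Lemma transversal_code e e' : nominal_net n e -> nominal_net n e' ->
  edge_sign e * ang (edge_layer e) = edge_sign e' * ang (edge_layer e') ->
  (forall z, (edge_code e' - edge_code e <> 42 * z)%Z) -> no_overlap_near n e e'.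
Proof.
  intros He He' Ea Hz. apply transversal; auto. rewrite edge_angle_diff, Ea.
  unfold Rminus at 1. rewrite Rplus_opp_r, Rplus_0_l. intros E.
  destruct (sin_multiple_PI42 _ E) as [z Ez]. now apply (Hz z).
Qed.

Lemma layer_pair i j k k' : (i < j <= n)%nat -> (k < 7)%nat -> (k' < 7)%nat ->
  no_overlap_near n (LayerEdge i k) (LayerEdge j k').
Proof.
  intros Hij Hk Hk'.
  destruct (classic (exists l, (i <= l < j)%nat /\ ~ PI / 2 < ang l)) as [HB|HA].
  - apply transversal; auto; [simpl; lia | simpl; lia |].
    rewrite edge_angle_diff. cbn [edge_sign edge_layer]. rewrite !Rmult_1_l.
    apply sin_ang_diff; [lia | auto].
  - assert (HA' : forall l, (i <= l < i + S (j - i - 1))%nat -> PI / 2 < ang l).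
    { intros l Hl. apply NNPP. intros Hn. apply HA. exists l. split; [lia | auto]. }
    pose proof (extension_ang i (S (j - i - 1)) HA') as Ea.
    replace j with (i + S (j - i - 1))%nat by lia.
    (* Along extensions the loss of PI / 7 per layer cancels the layer term of the code. What
       remains, 12 (k' - k), is divisible by 42 only if 7 divides k' - k. *)
    destruct (Nat.eq_dec k k') as [->|Hne].
    + apply layer_chain_no_overlap; auto. lia.
    + apply transversal; auto; [simpl; lia | simpl; lia |].
      rewrite edge_angle_diff. cbn [edge_sign edge_layer]. rewrite !Rmult_1_l, Ea.
      intros E. replace (_ + _) with
        (IZR (12 * (Z.of_nat k' - Z.of_nat k)) * (PI / 42)) in E.
      * apply sin_multiple_PI42 in E. destruct E as [z E]. lia.
      * cbn [edge_code]. rewrite Nat2Z.inj_add, !minus_IZR, !plus_IZR, !mult_IZR, minus_IZR, plus_IZR. ring.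
Qed.

Lemma layer_rho_pair i j k k' : (i < j <= n)%nat -> (k < 7)%nat -> (k' < 7)%nat ->
  no_overlap_near n (LayerEdgeRho i k) (LayerEdgeRho j k').
Proof.
  intros Hij Hk Hk'.
  destruct (classic (exists l, (i <= l < j)%nat /\ ~ PI / 2 < ang l)) as [HB|HA].
  - apply transversal; auto; [simpl; lia | simpl; lia |].
    rewrite edge_angle_diff. cbn [edge_sign edge_layer]. intros E.
    set (c := (edge_code (LayerEdgeRho j k') - edge_code (LayerEdgeRho i k))%Z) in *.
    apply (sin_ang_diff i j (- c) ltac:(lia) HB). rewrite opp_IZR.
    replace (ang j - ang i + - IZR c * (PI / 42)) with
      (- (-1 * ang j - -1 * ang i + IZR c * (PI / 42))) by ring.
    rewrite sin_neg, E. ring.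
  - assert (HA' : forall l, (i <= l < i + S (j - i - 1))%nat -> PI / 2 < ang l).
    { intros l Hl. apply NNPP. intros Hn. apply HA. exists l. split; [lia | auto]. }
    pose proof (extension_ang i (S (j - i - 1)) HA') as Ea.
    replace j with (i + S (j - i - 1))%nat by lia.
    set (m := (j - i - 1)%nat) in *.
    destruct (classic (exists z, (Z.of_nat k' + Z.of_nat (S m) - Z.of_nat k = 7 * z)%Z)) as [[z Hz]|Hne].
    + apply layer_rho_chain_no_overlap; auto; [lia|].
      rewrite !rho_pow. symmetry. apply (cis_multiple_PI42 _ _ z). lia.
    + apply transversal; auto; [simpl; lia | simpl; lia |].
      rewrite edge_angle_diff. cbn [edge_sign edge_layer]. rewrite Ea.
      intros E. replace (_ + _) with
        (IZR (12 * (Z.of_nat k' + Z.of_nat (S m) - Z.of_nat k)) * (PI / 42)) in E.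
      * apply sin_multiple_PI42 in E. destruct E as [z E]. apply Hne.
        exists (Z.of_nat k' + Z.of_nat (S m) - Z.of_nat k - 3 * z)%Z. lia.
      * cbn [edge_code]. rewrite Nat2Z.inj_add. rewrite ?minus_IZR, ?plus_IZR, ?mult_IZR, ?minus_IZR, ?plus_IZR. ring.
Qed.

Lemma layer_layer_rho_pair i j k k' : (i <= n)%nat -> (j <= n)%nat -> (k < 7)%nat -> (k' < 7)%nat ->
  no_overlap_near n (LayerEdge i k) (LayerEdgeRho j k').
Proof.
  intros Hi Hj Hk Hk'. apply transversal; auto; [simpl; auto | simpl; auto |].
  rewrite edge_angle_diff. cbn [edge_sign edge_layer]. intros E.
  set (c := (edge_code (LayerEdgeRho j k') - edge_code (LayerEdge i k))%Z) in *.
  apply (sin_ang_sum i j (- c)). rewrite opp_IZR.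
  replace (ang i + ang j + - IZR c * (PI / 42)) with
    (- (-1 * ang j - 1 * ang i + IZR c * (PI / 42))) by ring.
  rewrite sin_neg, E. ring.
Qed.

Lemma layer_suspension_pair e e' : nominal_net n e -> nominal_net n e' ->
  edge_sign e = 1 \/ edge_sign e = -1 -> edge_sign e' = 0 -> no_overlap_near n e e'.
Proof.
  intros He He' Hs Hs'. apply transversal; auto.
  rewrite edge_angle_diff, Hs'. set (c := (edge_code e' - edge_code e)%Z). intros E.
  destruct Hs as [Hs|Hs]; rewrite Hs in E.
  - apply (sin_ang_shift (edge_layer e) (- c)). rewrite opp_IZR.
    match type of E with sin ?x = 0 =>
      replace (ang (edge_layer e) + - IZR c * (PI / 42)) with (- x) by ring end.
    rewrite sin_neg, E. ring.
  - apply (sin_ang_shift (edge_layer e) c). rewrite <- E. f_equal. ring.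
Qed.

Lemma suspension_pair e e' i j k k' : nominal_net n e -> nominal_net n e' -> e <> e' ->
  edge_sign e = 0 -> edge_sign e' = 0 -> (i < n)%nat -> (j < n)%nat -> (k < 7)%nat -> (k' < 7)%nat ->
  (Nat.Even i /\ Nat.Even j \/ Nat.Odd i /\ Nat.Odd j) ->
  (edge_code e' - edge_code e = 6 * Z.of_nat j + 12 * Z.of_nat k' - (6 * Z.of_nat i + 12 * Z.of_nat k))%Z ->
  (i = j -> k = k' -> e = e') ->
  (forall G, cross (edge_dir G e) (edge_dir G e') =
    cross (rho ^ k * dir (vtx G i) (refpt i)) (rho ^ k' * dir (vtx G j) (refpt j))) ->
  no_overlap_near n e e'.
Proof.
  intros He He' Hne Hs Hs' Hi Hj Hk Hk' Hpar Hcode Heq Hdir.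
  destruct (classic (exists z, (edge_code e' - edge_code e = 42 * z)%Z)) as [[z Hz]|Hnz].
  - destruct (Nat.eq_dec i j) as [->|Hij].
    + exfalso. apply Hne, Heq; auto. lia.
    + apply no_overlap_cross; auto.
      assert (HE : exists y, (6 * Z.of_nat i + 12 * Z.of_nat k
          = 6 * Z.of_nat j + 12 * Z.of_nat k' + 84 * y)%Z).
      { rewrite Hcode in Hz.
        destruct Hpar as [[[a Ha] [b Hb]]|[[a Ha] [b Hb]]];
          (* For equal parity the difference is 12 D, so 12 D = 42 z gives 2 D = 7 z and D = 7 (D -
             3 z): a half turn is excluded and the edges belong to one reference point. *)
          exists (3 * z - (Z.of_nat b - Z.of_nat a + (Z.of_nat k' - Z.of_nat k)))%Z; lia. }
      destruct HE as [y HE].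
      generalize (suspension_cross n proper i j k k' y Hi Hj Hij HE). apply filter_imp.
      intros t Ht rapex. rewrite Hdir. auto.
  - apply transversal_code; auto; [rewrite Hs, Hs'; ring|].
    intros z Hz. apply Hnz. now exists z.
Qed.

(** For different parity the codes differ by 6 modulo 12. As 12 divides 84, a difference divisible
    by 42 is an odd multiple of it, that is, a half turn. *)
Lemma odd_fermat_vtx_pair i j k k' : nominal_net n (OddSuspension i k) ->
  nominal_net n (FermatVtx j k') -> no_overlap_near n (OddSuspension i k) (FermatVtx j k').
Proof.
  intros He He'.
  destruct (classic (exists z, (edge_code (FermatVtx j k') - edge_code (OddSuspension i k) = 42 * z)%Z))
    as [[z Hz]|Hnz].
  - pose proof He as (Hi & _ & [a Ha] & Hk). pose proof He' as (Hj & _ & [b Hb] & Hk').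
    cbn [edge_code] in Hz.
    apply (odd_even_no_overlap n proper i j k k'
      (Z.of_nat b - Z.of_nat a + Z.of_nat k' - Z.of_nat k - 1 - 3 * z)); auto. lia.
  - apply transversal_code; auto; [simpl; ring|].
    intros z Hz. apply Hnz. now exists z.
Qed.

Lemma edges_no_overlap e e' : nominal_net n e -> nominal_net n e' -> e <> e' ->
  no_overlap_near n e e'.
Proof.
  intros He He' Hne.
  assert (HR : forall (u w : C) k k' z,
    cross (rho ^ k * (cis z * u)) (rho ^ k' * (cis z * w)) = cross (rho ^ k * u) (rho ^ k' * w)).
  { intros u w k k' z.
    replace (rho ^ k * (cis z * u))%C with (cis z * (rho ^ k * u))%C by ring.
    replace (rho ^ k' * (cis z * w))%C with (cis z * (rho ^ k' * w))%C by ring.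
    apply cross_cis_mult. }
  assert (HL : forall e1 e2, nominal_net n e1 -> nominal_net n e2 ->
    edge_sign e1 = 0 -> edge_sign e2 = 0 ->
    (forall z, (edge_code e2 - edge_code e1 <> 42 * z)%Z) -> no_overlap_near n e1 e2).
  { intros e1 e2 H1 H2 S1 S2 Hz. apply transversal_code; auto. rewrite S1, S2. ring. }
  destruct e as [i k|i k|i k|i k|i k|i k], e' as [j k'|j k'|j k'|j k'|j k'|j k'];
    try (apply layer_suspension_pair; auto; simpl; auto; fail);
    try (apply no_overlap_sym, layer_suspension_pair; auto; simpl; auto; fail);
    (* Suspension edges of different kinds, at least one of them a side edge of a Fermat point:
       offsets of 14 or 28 are not divisible by 6, so the codes differ modulo 42. *)
    try (apply HL; auto; intros z Hz; cbn [edge_code] in Hz; lia);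
    try (assert (He1 := He); assert (He2 := He'); destruct He1 as (I1 & _ & I2 & I3);
      destruct He2 as (J1 & _ & J2 & J3);
      apply (suspension_pair _ _ i j k k' He He' Hne eq_refl eq_refl I1 J1 I3 J3 ltac:(auto));
      [cbn [edge_code]; lia | congruence | intros G; cbn [edge_dir]; first [reflexivity | apply HR]]; fail).
  - destruct He as [Hi Hk], He' as [Hj Hk'].
    destruct (lt_eq_lt_dec i j) as [[Hij|<-]|Hij].
    + apply layer_pair; auto.
    + apply transversal_code; [split; auto | split; auto | reflexivity |].
      intros z Hz. cbn [edge_code] in Hz. apply Hne. f_equal. lia.
    + apply no_overlap_sym, layer_pair; auto.
  - destruct He as [Hi Hk], He' as [Hj Hk']. now apply layer_layer_rho_pair.
  - destruct He as [Hi Hk], He' as [Hj Hk']. now apply no_overlap_sym, layer_layer_rho_pair.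
  - destruct He as [Hi Hk], He' as [Hj Hk'].
    destruct (lt_eq_lt_dec i j) as [[Hij|<-]|Hij].
    + apply layer_rho_pair; auto.
    + apply transversal_code; [split; auto | split; auto | reflexivity |].
      intros z Hz. cbn [edge_code] in Hz. apply Hne. f_equal. lia.
    + apply no_overlap_sym, layer_rho_pair; auto.
  - now apply odd_fermat_vtx_pair.
  - now apply no_overlap_sym, odd_fermat_vtx_pair.
Qed.

Lemma near_nominal_net : near n (fun t => forall e, in_net n (snd t) e -> nominal_net n e).
Proof.
  assert (HS : near n (fun t => forall i, (i < n)%nat -> suspended n (snd t) i -> ang i < PI / 2)).
  { apply near_forall_lt. intros i Hi.
    destruct (Rlt_dec (PI / 2) (ang i)) as [Ha|Ha].
    - generalize (proj1 (interior_angle_near n i (proj1 (tracked_within n proper i ltac:(lia)))) Ha).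
      apply filter_imp. intros t Ht [_ Hs]. lra.
    - apply filter_forall. intros t _. pose proof (ang_neq_PI2 i). lra. }
  revert HS. apply filter_imp. intros t HS [i k|i k|i k|i k|i k|i k]; simpl; auto;
    intros (Hs & Hp & Hk); pose proof (proj1 Hs); auto.
Qed.

End AllPairs.

Theorem lemma4p5p5 :
  forall n : nat,
  exists eps : R, 0 < eps /\
  forall phi : R, - eps < phi < eps ->
  forall G : star, is_star n phi G ->
    (forall i j : nat, (i <= n)%nat -> (j <= n)%nat -> i <> j ->
       suspension_angle G i <> suspension_angle G j) ->
    forall e e' : edge, in_net n G e -> in_net n G e' -> e <> e' ->
      ~ overlap (on_edge G e) (on_edge G e').
Proof.
  (* If the filter is improper, no star of depth n exists for small phi and the claim is vacuous
     there. *)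
  intros n. destruct (classic (near n (fun _ => False))) as [[eps [Heps HF]]|proper].
  - exists eps. split; auto. intros phi Hphi G HG. destruct (HF phi Hphi G HG).
  - assert (HE : near n (fun t => forall e, nominal_net n e -> forall e', nominal_net n e' ->
      e <> e' -> suspension_distinct n (snd t) ->
      ~ overlap (on_edge (snd t) e) (on_edge (snd t) e'))).
    { apply near_forall_edge. intros e He. apply near_forall_edge. intros e' He'.
      destruct (classic (e = e')) as [->|Hne].
      - apply filter_forall. intros t Ht. contradiction.
      - generalize (edges_no_overlap n proper e e' He He' Hne). unfold no_overlap_near. apply filter_imp. auto. }
    destruct (filter_and _ _ HE (near_nominal_net n proper)) as [eps [Heps HP]].
    exists eps. split; auto. intros phi Hphi G HG rapex e e' He He' Hne.
    destruct (HP phi Hphi G HG) as [P1 P2]. apply P1; auto.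
Qed.
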